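(* For each $n\geqslant 2$ let $\|X_{nij}\|_{1\leqslant i,j\leqslant n}$ be an $n\times n$ matrix of independent real random variables such that $$\sum_{i=1}^n \mathbf{E}X_{nij}=0 \ \text{ for all } 1\leqslant j\leqslant n,\qquad \sum_{j=1}^n \mathbf{E}X_{nij}=0\ \text{ for all } 1\leqslant i\leqslant n,$$ and let $\vec{\pi}_n=(\pi_n(1),\ldots,\pi_n(n))$ be a random permutation of $1,2,\ldots,n$, uniformly distributed on the set of all permutations of $1,\ldots,n$ and independent of the matrix $\|X_{nij}\|$. Put $$S_n=\sum_{i=1}^n X_{n i\pi_n(i)},\qquad B_n=\frac1n\sum_{i,j=1}^n \mathbf{E}X_{nij}^2 .$$ Let $\{M_n\}_{n\geqslant 2}$ be a non-decreasing sequence of positive numbers such that for $s=1,2,3$ the inequalities $$\left|\mathbf{E}X_{nij}^k\right|\leqslant D\,k!\,M_n^{k-s}\,\mathbf{E}|X_{nij}|^s$$ hold for all integers $k\geqslant s$, all $1\leqslant i,j\leqslant n$ and all $n\geqslant 2$, where $D$ is an absolute positive constant (not depending on $s,k,i,j,n$). Put $$\gamma_n=\max\left\{\max_{i,j}\frac{\sqrt n}{\sqrt{B_n}}\mathbf{E}|X_{nij}|,\ \max_i\sum_{j=1}^n\frac{\mathbf{E}X_{nij}^2}{B_n},\ \max_j\sum_{i=1}^n\frac{\mathbf{E}X_{nij}^2}{B_n},\ \sum_{i,j=1}^n\frac{\mathbf{E}|X_{nij}|^3}{\sqrt n\,B_n^{3/2}}\right\}.$$ Then for every sequence of positive numbers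 $\{u_n\}$ with $u_n\to\infty$, $u_n^3=o(\sqrt n/\gamma_n)$ and $u_n=o(\sqrt{B_n}/M_n)$ as $n\to\infty$, the relation $$\mathbf{P}\left(S_n\geqslant u_n\sqrt{B_n}\right)\sim 1-\Phi(u_n)\quad\text{as } n\to\infty$$ holds, where $\Phi(x)$ is the standard normal distribution function.
   Context: $\mathbf{E}$ denotes expectation and $\mathbf{P}$ probability. The relation $a_n\sim b_n$ means $a_n/b_n\to1$ as $n\to\infty$. It is implicit that all moments appearing are finite and that $B_n>0$ for all $n$ (so that $\gamma_n$ is well defined). No relation is assumed between the matrices or permutations for different values of $n$. *)

(* Defs.v *)
From mathcomp Require Import all_boot all_order all_algebra all_fingroup.
From mathcomp Require Import all_classical all_reals all_analysis.

Set Implicit Arguments.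
Unset Strict Implicit.
Unset Printing Implicit Defensive.

Import Order.TTheory GRing.Theory Num.Theory.
Import numFieldNormedType.Exports.

Local Open Scope classical_set_scope.
Local Open Scope ring_scope.

Section independence.
Context d (T : measurableType d) (R : realType) (P : probability T R).

Definition mutually_independent (I : finType) (X : I -> {RV P >-> R}) : Prop :=
  forall (J : {set I}) (A : I -> set R), (forall i, measurable (A i)) ->
    P (\bigcap_(i in [set` J]) X i @^-1` A i) =
      (\prod_(i in J) P (X i @^-1` A i))%E.

(* the sigma-algebra on [T] generated by the whole family [X] *)
Definition sigma_family (I : finType) (X : I -> {RV P >-> R}) : set (set T) :=
  <<s \bigcup_(i in [set: I]) preimage_set_system [set: T] (X i) measurable >>.

(* ['S_n] carries its power set as sigma-algebra. *)
Definition sigma_perm n (pi : T -> 'S_n) : set (set T) :=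
  preimage_set_system [set: T] pi [set: set 'S_n].

Definition independent_systems (F G : set (set T)) : Prop :=
  forall A B, F A -> G B -> P (A `&` B) = (P A * P B)%E.

Definition uniform_random_perm n (pi : T -> 'S_n) : Prop :=
  forall s : 'S_n, measurable (pi @^-1` [set s]) /\
    P (pi @^-1` [set s]) = ((n`!)%:R^-1)%:E.

End independence.

Section combinatorial_sum.
Context d (T : measurableType d) (R : realType) (P : probability T R).
Variables (n : nat) (X : 'I_n -> 'I_n -> {RV P >-> R}).

(* Real-valued moments: [fine] is only meaningful when the moment is finite. *)
Definition moment (i j : 'I_n) (k : nat) : R :=
  fine ('E_P[(fun w => X i j w ^+ k)%R])%E.

Definition abs_moment (i j : 'I_n) (k : nat) : R :=
  fine ('E_P[(fun w => `|X i j w| ^+ k)%R])%E.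

Definition comb_sum (pi : T -> 'S_n) (w : T) : R := \sum_(i < n) X i (pi w i) w.

Definition Bn : R := n%:R^-1 * \sum_(i < n) \sum_(j < n) moment i j 2.

(* All quantities compared are nonnegative, so 0 is a neutral default for the
   maxima over indices. *)
Definition gamma_n : R :=
  Num.max
    (Num.max
      (\big[Num.max/0]_(i < n) \big[Num.max/0]_(j < n)
         (Num.sqrt n%:R / Num.sqrt Bn * abs_moment i j 1))
      (\big[Num.max/0]_(i < n) \sum_(j < n) (moment i j 2 / Bn)))
    (Num.max
      (\big[Num.max/0]_(j < n) \sum_(i < n) (moment i j 2 / Bn))
      (\sum_(i < n) \sum_(j < n)
         (abs_moment i j 3 / (Num.sqrt n%:R * Bn `^ (3 / 2))))).

End combinatorial_sum.

Definition Phi (R : realType) (x : R) : R :=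
  fine (normal_prob (0 : R) 1 `]-oo, x]).

(* Unlike [f ~_F g] of [landau.v], this is convergence of the ratio to 1. *)
Definition asymp_equiv (R : realType) (a b : R ^nat) : Prop :=
  (a n / b n) @[n --> \oo] --> (1 : R).

(* Main.v *)
From HB Require Import structures.
From mathcomp Require Import all_boot all_order all_algebra all_fingroup.
From mathcomp Require Import all_classical all_reals all_analysis.
From mathcomp Require Import measurable_realfun ring lra.
Require Import Defs.
Set Implicit Arguments.
Unset Strict Implicit.
Unset Printing Implicit Defensive.
Import Order.TTheory GRing.Theory Num.Theory.
Import numFieldNormedType.Exports.
Local Open Scope classical_set_scope.
Local Open Scope ring_scope.

(* Stein's method with exponential weights.  Normalise by sqrt(B_n) and put
   eps = gamma_n / sqrt n; the moment hypothesis makes E |Y|^s exp(u |Y|) comparable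
   with E |Y|^s for s <= 3.  If f and f' are dominated by a positive combination G of
   exponentials exp(h w), 0 <= h <= u, exchanging the images of two rows and expanding
   to second order gives |E S f(S) - E f'(S)| <= C eps E G(S).  For f(w) = exp(h w)
   this is a differential inequality, hence E exp(h S) <= C exp(h^2 / 2).  For the
   solution of f' = w f + tau - N, where tau is a ramp of width eta / u at distance at
   most eta / u from u and N its Gaussian mean, it yields P(S >= u) up to factors
   exp(O(eta)) and a relative error C eps u^3 / eta; let n tend to infinity, then
   eta to 0. *)

(** * Independence *)

(** The obstacle: P(S >= u) is about exp(- u^2 / 2) / u, so an absolute error says nothing and the
    error must carry the size of the tail. Hence the bound by E G(S) with G fitted to the test
    function. Left of the ramp the Stein solution is N times a function growing like exp(w^2 / 2),
    beyond the reach of a single tilt; about u tangent exponentials dominate it, each contributing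
    O(u^2), whence u^3. Right of the ramp a multiple of exp(u (w - a)) suffices, and its mean is
    again comparable with the tail. The summands are dependent through the permutation, so the
    permutation is frozen and estimates are summed over the symmetric group. Once two rows are taken
    out, the rest is independent of their entries but still remembers which columns are used up;
    right multiplication by a permutation moving at most four points makes it forget. Single entries
    need not be centred, only rows and columns, so the products of means cancel only in sums over
    all indices. The O(1 / n) discrepancies are absorbed because gamma_n >= 1, that is eps >=
    n^(-1/2). *)

Section independent_pair.
Context d (T : measurableType d) (R : realType) (P : probability T R).
Implicit Types X Y : T -> R.

Definition mfun_of X (mX : measurable_fun setT X) : {mfun T >-> R} :=
  HB.pack X (isMeasurableFun.Build _ _ _ _ X mX).

Definition indep_pair X Y := forall A B : set R, measurable A -> measurable B ->
  P (X @^-1` A `&` Y @^-1` B) = (P (X @^-1` A) * P (Y @^-1` B))%E.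

Lemma measurable_preim X (A : set R) : measurable_fun setT X -> measurable A ->
  measurable (X @^-1` A).
Proof. by move=> mX mA; rewrite -[X in measurable X]setTI; exact: mX. Qed.

Let rect : set (set (R * R)) :=
  [set C | exists A, measurable A /\ exists B, measurable B /\ C = A `*` B].

Let rectI : setI_closed rect.
Proof.
move=> /= _ _ [X1 [mX1 [X2 [mX2 ->]]]] [Y1 [mY1 [Y2 [mY2 ->]]]].
rewrite -setXI; exists (X1 `&` Y1); split; first exact: measurableI.
by exists (X2 `&` Y2); split => //; exact: measurableI.
Qed.

Let rectE : (measurable : set (set (R * R))) = <<s rect >>.
Proof.
rewrite measurable_prod_measurableType //; congr (<<s _ >>).
rewrite predeqE; split => [[A mA [B mB <-]]|[A [mA [B [mB ->]]]]].
  by exists A; split => //; exists B.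
by exists A => //; exists B.
Qed.

(** Both sides are finite measures in [D]: the law of the pair under P restricted to [E], and P(E)
    times its law under P. They agree on rectangles, a generating system stable under intersection.
    [X] and [Y] may depend on each other. *)
Lemma pair_event_indep X Y (E : set T) :
  measurable_fun setT X -> measurable_fun setT Y -> measurable E ->
  (forall A B, measurable A -> measurable B ->
     P (X @^-1` A `&` Y @^-1` B `&` E) = (P (X @^-1` A `&` Y @^-1` B) * P E)%E) ->
  forall D : set (R * R), measurable D ->
    P ((fun t => (X t, Y t)) @^-1` D `&` E) =
    (P ((fun t => (X t, Y t)) @^-1` D) * P E)%E.
Proof.
move=> mX mY mE indE D mD.
pose f t := (X t, Y t).
have mf : measurable_fun setT f by exact: measurable_fun_pair.
pose f' : {mfun T >-> (R * R)%type} := HB.pack f (isMeasurableFun.Build _ _ _ _ f mf).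
have PEfin : P E \is a fin_num by exact: fin_num_measure.
have PE0 : 0 <= fine (P E) by rewrite fine_ge0.
pose c : {nonneg R} := NngNum PE0.
pose m1g := pushforward (mrestr P mE) f' : {measure set (R * R) -> \bar R}.
pose m1 := m1g mf.
pose m2 : {measure set (R * R) -> \bar R} := mscale c (distribution P f').
have m2E A : m2 A = (P E * P (f @^-1` A))%E by rewrite /m2/= /mscale/= fineK.
have -> : P (f @^-1` D `&` E) = m1 D by [].
rewrite muleC -m2E.
apply: (measure_unique rect (fun=> setT)) => //.
- move=> _; exists setT; split => //; exists setT; split => //.
  by rewrite setXTT.
- exact: bigcup_const.
- move=> _ [A [mA [B [mB ->]]]]; rewrite m2E muleC.
  have := indE _ _ mA mB.
  by rewrite (_ : X @^-1` A `&` Y @^-1` B = f @^-1` (A `*` B)).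
- move=> _; rewrite /m1/= /pushforward /mrestr/= preimage_setT setTI.
  by rewrite ltey_eq PEfin.
Qed.

Lemma indep_pair_law X Y (mX : measurable_fun setT X) (mY : measurable_fun setT Y) :
  indep_pair X Y -> forall D : set (R * R), measurable D ->
  P ((fun t => (X t, Y t)) @^-1` D) =
  (distribution P (mfun_of mX) \x distribution P (mfun_of mY))%E D.
Proof.
move=> XY D mD.
pose f t := (X t, Y t).
have mf : measurable_fun setT f by exact: measurable_fun_pair.
pose f' : {mfun T >-> (R * R)%type} := HB.pack f (isMeasurableFun.Build _ _ _ _ f mf).
symmetry.
apply: (@product_measure_unique _ _ _ _ R (distribution P (mfun_of mX))
  (distribution P (mfun_of mY)) (distribution P f')) => //.
Qed.

(** Tonelli, with no integrability assumed: it proves products of independent factors integrable,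
    and so prepares the hypotheses of [indep_integral]. *)
Lemma indep_ge0_integral X Y (G : R * R -> \bar R) :
  measurable_fun setT X -> measurable_fun setT Y -> indep_pair X Y ->
  measurable_fun [set: R * R] G -> (forall z, 0 <= G z)%E ->
  (\int[P]_t G (X t, Y t) = \int[P]_t \int[P]_t' G (X t, Y t'))%E.
Proof.
move=> mX mY XY mG G0.
pose f t := (X t, Y t).
have mf : measurable_fun setT f by exact: measurable_fun_pair.
pose f' : {mfun T >-> (R * R)%type} := HB.pack f (isMeasurableFun.Build _ _ _ _ f mf).
pose mu1 := distribution P (mfun_of mX); pose mu2 := distribution P (mfun_of mY).
transitivity (\int[distribution P f']_z G z)%E.
  by rewrite ge0_integral_pushforward.
transitivity (\int[mu1 \x mu2]_z G z)%E.
  apply: eq_measure_integral => D mD _ /=.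
  exact: (indep_pair_law mX mY XY).
rewrite (fubini_tonelli1 G)//.
rewrite /fubini_F ge0_integral_distribution//.
- apply: eq_integral => t _ /=.
  rewrite ge0_integral_distribution//.
  by apply: measurableT_comp => //; exact: measurable_fun_pair.
- exact: measurable_fun_fubini_tonelli_F.
- by move=> y; apply: integral_ge0.
Qed.

Section indep_integral.
Variables (X Y : T -> R) (G : R * R -> R).
Hypotheses (mX : measurable_fun setT X) (mY : measurable_fun setT Y).
Hypotheses (XY : indep_pair X Y) (mG : measurable_fun setT G).
Hypothesis iG : P.-integrable setT (fun t => (G (X t, Y t))%:E).
Hypothesis iGx : forall x, P.-integrable setT (fun t => (G (x, Y t))%:E).

Let mu1 := distribution P (mfun_of mX).
Let mu2 := distribution P (mfun_of mY).

Let f t := (X t, Y t).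
Let mf : measurable_fun setT f. Proof. exact: measurable_fun_pair. Qed.
Let f' : {mfun T >-> (R * R)%type} := HB.pack f (isMeasurableFun.Build _ _ _ _ f mf).

Let mG' : measurable_fun setT (EFin \o G). Proof. exact/measurable_EFinP. Qed.

Let iG12 : (mu1 \x mu2)%E.-integrable setT (EFin \o G).
Proof.
have i' : (distribution P f').-integrable setT (EFin \o G).
  by apply: integrable_pushforward => //; rewrite preimage_setT.
apply/integrableP; split => //; case/integrableP : i' => _.
rewrite (eq_measure_integral (mu1 \x mu2)%E)// => D mD _ /=.
exact: (indep_pair_law mX mY XY).
Qed.

Let inner x : (\int[mu2]_y (EFin \o G) (x, y) = (\int[P]_t' G (x, Y t'))%:E)%E.
Proof.
rewrite fineK; last exact: integrable_fin_num (iGx x).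
rewrite integral_distribution//; last exact: iGx.
by apply: measurableT_comp => //; exact: measurable_fun_pair.
Qed.

(** Integrability is assumed at every [x], not almost everywhere, so that the real-valued inner
    integral equals the extended one at each point and inherits its measurability. *)
Lemma indep_inner_measurable :
  measurable_fun setT (fun x => \int[P]_t' G (x, Y t')).
Proof.
apply/measurable_EFinP.
rewrite (_ : _ \o _ = fubini_F mu2 (EFin \o G)).
  exact: measurable_fubini_F iG12.
by apply/funext => x; symmetry; exact: inner.
Qed.

Lemma indep_inner_integrable :
  P.-integrable setT (fun t => (\int[P]_t' G (X t, Y t'))%:E).
Proof.
have := integrable_fubini_F iG12 => /integrableP[mGG iGG].
apply/integrableP; split.
  by apply/measurable_EFinP; exact: (measurableT_comp indep_inner_measurable mX).
move: iGG; rewrite ge0_integral_distribution//; last exact: measurableT_comp.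
congr (_ < _)%E; apply: eq_integral => t _.
by rewrite /comp -[fubini_F _ _ _]/(\int[mu2]_y (EFin \o G) (X t, y))%E inner.
Qed.

Lemma indep_integral :
  \int[P]_t G (X t, Y t) = \int[P]_t \int[P]_t' G (X t, Y t').
Proof.
congr fine.
transitivity (\int[distribution P f']_z (G z)%:E)%E.
  by rewrite integral_pushforward.
transitivity (\int[mu1 \x mu2]_z (G z)%:E)%E.
  apply: eq_measure_integral => D mD _ /=.
  exact: (indep_pair_law mX mY XY).
rewrite -(@integral12_prod_meas1 _ _ _ _ _ mu1 mu2 (EFin \o G))//.
rewrite integral_distribution.
- by apply: eq_integral => t _; exact: inner.
- exact: measurable_fubini_F iG12.
- rewrite (_ : _ \o _ = fun t => (\int[P]_t' G (X t, Y t'))%:E).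
    exact: indep_inner_integrable.
  by apply/funext => t; exact: inner.
Qed.

End indep_integral.

End independent_pair.

Section independent_family.
Context d (T : measurableType d) (R : realType) (P : probability T R).
Variables (I : finType) (Z : I -> T -> R).
Hypothesis mZ : forall i, measurable_fun setT (Z i).
Hypothesis indepZ : forall (J : {set I}) (A : I -> set R),
  (forall i, measurable (A i)) ->
  P (\bigcap_(i in [set` J]) Z i @^-1` A i) = (\prod_(i in J) P (Z i @^-1` A i))%E.

Let cyl (J : {set I}) (A : I -> set R) := \bigcap_(i in [set` J]) Z i @^-1` A i.

Let mcyl J A : (forall i, measurable (A i)) -> measurable (cyl J A).
Proof.
move=> mA; apply: fin_bigcap_measurable; first exact: finite_finset.
by move=> i _; exact: measurable_preim.
Qed.

Let upd (A : I -> set R) r C i : set R := if i == r then C else A i.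

Let cylU1 (J : {set I}) A r C : r \notin J ->
  cyl (r |: J) (upd A r C) = Z r @^-1` C `&` cyl J A.
Proof.
move=> rJ; rewrite /cyl; apply/seteqP; split => t /=.
  move=> H; split.
    by have := H r; rewrite /upd /= eqxx; apply; rewrite !inE eqxx.
  move=> i /= iJ; have := H i; rewrite /upd /= !inE iJ orbT.
  by case: eqP => [ir|_]; [move: iJ rJ; rewrite ir => ->|apply].
move=> [Hr HJ] i /=; rewrite !inE /upd; case: eqP => [->|_] //= iJ.
exact: HJ.
Qed.

Let PcylU1 (J : {set I}) A r C : r \notin J -> (forall i, measurable (A i)) ->
  measurable C ->
  P (Z r @^-1` C `&` cyl J A) = (P (Z r @^-1` C) * P (cyl J A))%E.
Proof.
move=> rJ mA mC; rewrite -cylU1//.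
have mU i : measurable (upd A r C i) by rewrite /upd; case: ifP.
rewrite /cyl !indepZ// big_setU1//= /upd eqxx; congr (_ * _)%E.
apply: eq_bigr => i iJ; case: eqP => [ir|//].
by move: iJ rJ; rewrite ir => ->.
Qed.

Lemma measurable_sum_seq (rs : seq I) :
  measurable_fun setT (fun t => \sum_(r <- rs) Z r t).
Proof. exact: measurable_sum. Qed.

(** The induction needs cylinders over an arbitrary [J] disjoint from [rs]: the head [r] is moved
    out of the sum into the cylinder, and [pair_event_indep] brings it back into the sum. *)
Lemma sum_event_indep (rs : seq I) (J : {set I}) (A : I -> set R) (B : set R) :
  uniq rs -> {in rs, forall r, r \notin J} -> (forall i, measurable (A i)) ->
  measurable B ->
  P ((fun t => \sum_(r <- rs) Z r t)%R @^-1` B `&` \bigcap_(i in [set` J]) Z i @^-1` A i) =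
  (P ((fun t => \sum_(r <- rs) Z r t)%R @^-1` B) *
   P (\bigcap_(i in [set` J]) Z i @^-1` A i))%E.
Proof.
elim: rs J A B => [|r rs IH] J A B.
  move=> _ _ mA mB.
  have [B0|B0] := pselect (B 0).
    have -> : (fun t => \sum_(r <- [::]) Z r t) @^-1` B = setT.
      by apply/seteqP; split => t //= _; rewrite big_nil.
    by rewrite setTI probability_setT mul1e.
  have -> : (fun t => \sum_(r <- [::]) Z r t) @^-1` B = set0.
    by apply/seteqP; split => t //=; rewrite big_nil.
  by rewrite set0I measure0 mul0e.
move=> /= /andP[rrs urs] rsJ mA mB.
have rJ : r \notin J by apply: rsJ; rewrite inE eqxx.
pose Y t := \sum_(r <- rs) Z r t.
have mY : measurable_fun setT Y by exact: measurable_sum_seq.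
pose D : set (R * R) := [set z | B (z.1 + z.2)].
have mD : measurable D.
  have mad : measurable_fun setT (fun z : R * R => z.1 + z.2).
    by apply: measurable_funD; [exact: measurable_fst|exact: measurable_snd].
  by rewrite -[D]setTI; exact: (mad measurableT _ mB).
have -> : (fun t => \sum_(r <- r :: rs) Z r t)%R @^-1` B =
    (fun t => (Z r t, Y t)) @^-1` D.
  by apply/seteqP; split => t; rewrite /D /Y /= big_cons.
apply: pair_event_indep => //; first exact: mcyl.
move=> C E mC mE.
have IHr (J' : {set I}) A' : {in rs, forall r, r \notin J'} -> (forall i, measurable (A' i)) ->
    P (Y @^-1` E `&` cyl J' A') = (P (Y @^-1` E) * P (cyl J' A'))%E.
  by move=> h1 h2; exact: IH.
have mU (A' : I -> set R) i : (forall i, measurable (A' i)) -> measurable (upd A' r C i).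
  by move=> h; rewrite /upd; case: ifP.
rewrite (setIC (Z r @^-1` C)) -setIA -/(cyl J A) -cylU1// IHr; last 2 first.
- move=> i irs; rewrite !inE negb_or rsJ ?inE ?irs ?orbT// andbT.
  by apply: contra rrs => /eqP <-.
- by move=> i; exact: mU.
rewrite cylU1// PcylU1// muleA; congr (_ * _)%E.
(* The event of [r] alone is a one-index cylinder, so the same induction hypothesis separates it
   from the remaining sum. *)
have cyl0 : cyl finset.set0 (fun=> setT) = setT.
  by apply/seteqP; split => t //= _ i /=; rewrite inE.
rewrite -[X in (_ * P X)%E]setIT -cyl0 -cylU1 ?inE// -IHr.
- by rewrite cylU1 ?inE// cyl0 setIT.
- move=> i irs; rewrite !inE orbF.
  by apply: contra rrs => /eqP <-.
- by move=> i; exact: mU.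
Qed.

Lemma indep_sum (rs : seq I) (r : I) : uniq rs -> r \notin rs ->
  indep_pair P (fun t => \sum_(i <- rs) Z i t) (Z r).
Proof.
move=> urs rrs A B mA mB.
have := @sum_event_indep rs (finset.set1 r) (fun=> B) A urs.
rewrite (_ : \bigcap_(i in _) _ = Z r @^-1` B); last first.
  apply/seteqP; split => t /=.
    by apply; rewrite /= !inE.
  by move=> h i /=; rewrite !inE => /eqP ->.
apply => // i irs; rewrite !inE; apply: contra rrs => /eqP <- //.
Qed.

End independent_family.

(** * Functions of exponential growth and averaging over one independent summand *)

Section tame_functions.
Context d (T : measurableType d) (R : realType) (P : probability T R).
Implicit Types (g p : R -> R) (W Y : T -> R).

Lemma le_integrableR (f g : T -> R) : measurable_fun setT f ->
  (forall t, `|f t| <= g t) -> P.-integrable setT (EFin \o g) ->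
  P.-integrable setT (EFin \o f).
Proof.
move=> mf fg ig; apply: le_integrable ig => //; first exact/measurable_EFinP.
by move=> t _ /=; rewrite lee_fin (le_trans (fg t))// ler_norm.
Qed.

Lemma integrableRD (f g : T -> R) : P.-integrable setT (EFin \o f) ->
  P.-integrable setT (EFin \o g) ->
  P.-integrable setT (EFin \o (fun t => f t + g t)).
Proof.
move=> iF iG; rewrite (_ : _ \o _ = (EFin \o f) \+ (EFin \o g))%E.
  exact: integrableD.
by apply/funext => t.
Qed.

Lemma integrableRZ (f : T -> R) c : P.-integrable setT (EFin \o f) ->
  P.-integrable setT (EFin \o (fun t => c * f t)).
Proof.
move=> iF; rewrite (_ : _ \o _ = (fun t => c%:E * (f t)%:E))%E.
  exact: integrableZl.
by apply/funext => t.
Qed.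

Lemma integrableRB (f g : T -> R) : P.-integrable setT (EFin \o f) ->
  P.-integrable setT (EFin \o g) ->
  P.-integrable setT (EFin \o (fun t => f t - g t)).
Proof.
move=> iF iG.
rewrite (_ : _ \o _ = EFin \o (fun t => f t + (-1) * g t)).
  by apply: integrableRD => //; exact: integrableRZ.
by apply/funext => t /=; rewrite mulN1r.
Qed.

Lemma integrable_cstR (c : R) : P.-integrable setT (EFin \o (fun=> c)).
Proof. exact: finite_measure_integrable_cst. Qed.

Lemma integrable_indep_mul W Y (a b : R -> R) :
  measurable_fun setT W -> measurable_fun setT Y -> indep_pair P W Y ->
  measurable_fun setT a -> measurable_fun setT b ->
  P.-integrable setT (EFin \o (fun t => b (W t))) ->
  P.-integrable setT (EFin \o (fun t => a (Y t))) ->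
  P.-integrable setT (EFin \o (fun t => b (W t) * a (Y t))).
Proof.
move=> mW mY WY ma mb ib ia.
have mbW : measurable_fun setT (fun t => b (W t)) by exact: measurableT_comp.
have maY : measurable_fun setT (fun t => a (Y t)) by exact: measurableT_comp.
apply/integrableP; split.
  by apply/measurable_EFinP; exact: measurable_funM.
pose G (z : R * R) : \bar R := (`|b z.1| * `|a z.2|)%:E.
rewrite [ltLHS](_ : _ = \int[P]_t G (W t, Y t))%E; last first.
  by apply: eq_integral => t _ /=; rewrite normrM.
rewrite indep_ge0_integral//; last 2 first.
- apply/measurable_EFinP; apply: measurable_funM.
    apply: measurableT_comp => //; apply: measurableT_comp => //.
  apply: measurableT_comp => //; apply: measurableT_comp => //.
- by move=> z; rewrite lee_fin mulr_ge0.
case/integrableP : ib => _ ib; case/integrableP : ia => _ ia.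
rewrite /G /=.
rewrite [ltLHS](_ : _ = \int[P]_t ((\int[P]_t' (`|a (Y t')|%:E)) * (`|b (W t)|%:E)))%E; last first.
  apply: eq_integral => t _; under eq_integral do rewrite EFinM.
  rewrite ge0_integralZl//; first by rewrite muleC.
  by apply/measurable_EFinP; exact: measurableT_comp.
rewrite ge0_integralZl//.
- by rewrite lte_mul_pinfty// ?integral_ge0// ge0_fin_numE// integral_ge0.
- by apply/measurable_EFinP; exact: measurableT_comp.
- exact: integral_ge0.
Qed.

Variable H : R.

(** Chosen so that integrability at [W] follows from that of exp(H W), and so that averaging over an
    independent summand stays in the class ([tame_op]). *)
Definition tame g :=
  measurable_fun setT g /\ exists c, forall w, `|g w| <= c * (1 + expR (H * w)).

(** The conditional expectation of p(Y) g(W + Y) given W = w, for [Y] independent of [W]. It is used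
    with p = 1, which averages out a summand, and with p the identity, for the Stein term Y f(W +
    Y). *)
Definition op p Y g w := \int[P]_t (p (Y t) * g (w + Y t)).

Lemma tame_bound_ge0 g : tame g ->
  exists c, 0 <= c /\ forall w, `|g w| <= c * (1 + expR (H * w)).
Proof.
move=> [_ [c gc]]; exists c; split => //.
have := le_trans (normr_ge0 _) (gc 0).
by rewrite mulr0 expR0 pmulr_lge0.
Qed.

Lemma measurable_expR_mul (f : T -> R) : measurable_fun setT f ->
  measurable_fun setT (fun t => expR (H * f t)).
Proof. by move=> mf; apply: measurableT_comp => //; exact: measurable_funM. Qed.

Lemma tame_integrable W g : measurable_fun setT W ->
  P.-integrable setT (EFin \o (fun t => expR (H * W t))) -> tame g ->
  P.-integrable setT (EFin \o (fun t => g (W t))).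
Proof.
move=> mW iW tg; have [c [c0 gc]] := tame_bound_ge0 tg; case: tg => mg _.
apply: (@le_integrableR _ (fun t => c * (1 + expR (H * W t)))) => //.
  exact: measurableT_comp.
by apply: integrableRZ; apply: integrableRD => //; exact: integrable_cstR.
Qed.

Section op_theory.
Variables (Y : T -> R) (p : R -> R).
Hypotheses (mY : measurable_fun setT Y) (mp : measurable_fun setT p).
Hypothesis ip : P.-integrable setT (EFin \o (fun t => p (Y t))).
Hypothesis ipe :
  P.-integrable setT (EFin \o (fun t => p (Y t) * expR (H * Y t))).

Let mop g : measurable_fun setT g ->
  measurable_fun setT (fun z : R * R => p z.2 * g (z.1 + z.2)).
Proof.
move=> mg; apply: measurable_funM.
  by apply: measurableT_comp => //; exact: measurable_snd.
apply: measurableT_comp => //.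
by apply: measurable_funD; [exact: measurable_fst|exact: measurable_snd].
Qed.

(** exp(H (W + Y)) factors, so the dominating function is |p(Y)| plus a product of independent
    integrable factors. *)
Lemma op_indep_integrable W g : measurable_fun setT W -> indep_pair P W Y ->
  P.-integrable setT (EFin \o (fun t => expR (H * W t))) -> tame g ->
  P.-integrable setT (EFin \o (fun t => p (Y t) * g (W t + Y t))).
Proof.
move=> mW WY iW tg; have [c [c0 gc]] := tame_bound_ge0 tg; case: tg => mg _.
apply: (@le_integrableR _ (fun t => c * (`|p (Y t)| +
   expR (H * W t) * `|p (Y t) * expR (H * Y t)|))).
- exact: (measurableT_comp (mop mg) (measurable_fun_pair mW mY)).
- move=> t; rewrite normrM mulrC.
  apply: le_trans (ler_wpM2r (normr_ge0 _) (gc _)) _.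
  rewrite -mulrA ler_wpM2l// mulrDl mul1r lerD2l.
  by rewrite mulrDr expRD normrM (ger0_norm (expR_ge0 (H * Y t))) -mulrA [_ * `|_|]mulrC.
- apply: integrableRZ; apply: integrableRD.
    exact: (integrable_norm ip).
  have ma : measurable_fun setT (fun y => `|p y * expR (H * y)|).
    apply: measurableT_comp => //; apply: measurable_funM => //.
    by apply: measurableT_comp => //; exact: measurable_funM.
  have mb : measurable_fun setT (fun y => expR (H * y)).
    by apply: measurableT_comp => //; exact: measurable_funM.
  apply: (integrable_indep_mul mW mY WY ma mb iW).
  exact: (integrable_norm ipe).
Qed.

Let indep_cst w : indep_pair P (fun=> w) Y.
Proof.
move=> A B mA mB; rewrite preimage_cst; case: ifPn => _.
  by rewrite setTI probability_setT mul1e.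
by rewrite set0I measure0 mul0e.
Qed.

Lemma op_integrable g w : tame g ->
  P.-integrable setT (EFin \o (fun t => p (Y t) * g (w + Y t))).
Proof.
move=> tg; apply: (op_indep_integrable (W := fun=> w)) => //.
exact: integrable_cstR.
Qed.

Lemma op_indep W g : measurable_fun setT W -> indep_pair P W Y ->
  P.-integrable setT (EFin \o (fun t => expR (H * W t))) -> tame g ->
  \int[P]_t (p (Y t) * g (W t + Y t)) = \int[P]_t (op p Y g (W t)).
Proof.
move=> mW WY iW tg.
have mg := tg.1.
rewrite (@indep_integral _ _ _ P W Y (fun z => p z.2 * g (z.1 + z.2)))//.
- exact: mop.
- exact: op_indep_integrable.
- by move=> w; exact: op_integrable.
Qed.

Lemma tame_op g : tame g -> tame (op p Y g).
Proof.
move=> tg; have mg := tg.1; split.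
  apply: (@indep_inner_measurable _ _ _ P (fun=> 0) Y
    (fun z => p z.2 * g (z.1 + z.2))) => //.
  - exact: mop.
  - exact: (op_integrable 0 tg).
  - by move=> w; exact: op_integrable.
have [c [c0 gc]] := tame_bound_ge0 tg.
pose a := \int[P]_t `|p (Y t)|.
pose b := \int[P]_t `|p (Y t) * expR (H * Y t)|.
have a0 : 0 <= a by exact: Rintegral_ge0.
have b0 : 0 <= b by exact: Rintegral_ge0.
exists (c * (a + b)) => w.
rewrite /op; apply: (le_trans (le_normr_Rintegral _ (op_integrable w tg))) => //.
have i1 : P.-integrable setT (EFin \o (fun t => `|p (Y t)|)) by exact: (integrable_norm ip).
have i2 : P.-integrable setT (EFin \o (fun t => `|p (Y t) * expR (H * Y t)|)).
  exact: (integrable_norm ipe).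
apply: (@le_trans _ _ (\int[P]_t (c * (`|p (Y t)| + expR (H * w) * `|p (Y t) * expR (H * Y t)|)))).
  apply: le_Rintegral => //.
  - exact: (integrable_norm (op_integrable w tg)).
  - by apply: integrableRZ; apply: integrableRD => //; exact: integrableRZ.
  move=> t _; rewrite normrM mulrC.
  apply: le_trans (ler_wpM2r (normr_ge0 _) (gc _)) _.
  rewrite -mulrA ler_wpM2l// mulrDl mul1r lerD2l.
  by rewrite mulrDr expRD normrM (ger0_norm (expR_ge0 (H * Y t))) -mulrA [_ * `|_|]mulrC.
rewrite RintegralZl//; last by apply: integrableRD => //; exact: integrableRZ.
rewrite RintegralD//; last exact: integrableRZ.
rewrite RintegralZl// -mulrA ler_wpM2l// -/a -/b.
by have := expR_ge0 (H * w); nra.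
Qed.

End op_theory.

End tame_functions.

(** * Exponential weights and local Taylor expansions *)

Section weight.
Context (R : realType).
Variable H : R.
Hypothesis H0 : 0 <= H.

(* Modelled on nonnegative combinations of the functions [exp (h * w)], [0 <= h <= H]. *)
Definition weight (G : R -> R) := [/\ measurable_fun setT G,
  (forall w, 0 <= G w),
  {homo G : x y / x <= y} &
  forall w x, 0 <= x -> G (w + x) <= expR (H * x) * G w].

Variable G : R -> R.
Hypothesis wG : weight G.

Lemma weight_max w x : G (Num.max w (w + x)) <= expR (H * `|x|) * G w.
Proof.
have [mG G0 Gle Gexp] := wG.
have [x0|x0] := leP 0 x.
  by rewrite max_r ?lerDl// ger0_norm//; exact: Gexp.
rewrite max_l; last by rewrite gerDl ltW.
by rewrite ler_peMl// -expR0 ler_expR mulr_ge0.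
Qed.

Lemma weight_shift w x : G (w + x) <= expR (H * `|x|) * G w.
Proof.
have [mG G0 Gle Gexp] := wG.
by apply: le_trans (weight_max w x); apply: Gle; rewrite le_max lexx orbT.
Qed.

(** [weight_shift] on the way back from w + x, with exp(- y) >= 1 - y. In this linear form a first
    absolute moment alone bounds the mean of G(w + Y) from below. *)
Lemma weight_low w x : (1 - H * `|x|) * G w <= G (w + x).
Proof.
have [mG G0 Gle Gexp] := wG.
have := weight_shift (w + x) (- x); rewrite addrK normrN => h.
have e1 : 1 - H * `|x| <= expR (- (H * `|x|)) by exact: expR_ge1Dx.
apply: (le_trans (ler_wpM2r (G0 _) e1)).
by rewrite expRN mulrC ler_pdivrMr ?expR_gt0// mulrC.
Qed.

Lemma weight_tame : tame H G.
Proof.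
have [mG G0 Gle Gexp] := wG; split => //.
exists (G 0) => w; rewrite ger0_norm//.
have [w0|w0] := leP 0 w.
  have := Gexp 0 w w0; rewrite add0r => /le_trans; apply.
  by rewrite mulrDr mulr1 [leRHS]addrC mulrC lerDl.
apply: le_trans (Gle _ _ (ltW w0)) _.
by rewrite ler_peMr// lerDl expR_ge0.
Qed.

Lemma weight_dom_tame (g : R -> R) c : measurable_fun setT g -> (forall w, `|g w| <= c * G w) ->
  0 <= c -> tame H g.
Proof.
move=> mg gG c0; split => //; have [_ [c' h]] := weight_tame.
exists (c * c') => w; apply: (le_trans (gG w)); rewrite -mulrA ler_wpM2l//.
by apply: le_trans (h w); rewrite ler_norm.
Qed.

(** A Lipschitz condition stands in for a bound on f'': the derivative of the Stein solution
    inherits the kinks of the ramp. The modulus is taken at the larger point because weights are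
    non-decreasing. *)
Definition stein_test (f df : R -> R) := [/\
  (forall x : R, is_derive x 1 f (df x)),
  (forall w, `|f w| <= G w),
  (forall w, `|df w| <= G w) &
  (forall x y, `|df x - df y| <= `|x - y| * G (Num.max x y))].

Variables f df : R -> R.
Hypothesis fdf : stein_test f df.

Lemma stein_test_measurable : measurable_fun setT f.
Proof.
have [h _ _ _] := fdf.
apply: continuous_measurable_fun => x.
by apply: differentiable_continuous; apply/derivable1_diffP; case: (h x).
Qed.

Lemma stein_test_df_continuous : continuous df.
Proof.
have [_ _ _ h] := fdf; have [mG G0 Gle Gexp] := wG.
move=> x; apply/cvgrPdist_le => e e0.
have M0 : 0 < G (x + 1) + 1 by rewrite ltr_wpDl.
have nd r : 0 < r -> \forall y \near x, `|x - y| <= r.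
  by move=> r0; exact: (@cvgr_dist_le _ _ _ (nbhs x) _ id).
near=> y.
have xy1 : `|x - y| <= 1 by near: y; exact: nd.
apply: (le_trans (h x y)).
have Gm : G (Num.max x y) <= G (x + 1) + 1.
  apply: (@le_trans _ _ (G (x + 1))); last by rewrite lerDl.
  apply: Gle; rewrite ge_max lerDl ler01/=.
  by move: xy1; rewrite ler_norml => /andP[+ _]; lra.
apply: (le_trans (ler_wpM2l (normr_ge0 _) Gm)).
rewrite -ler_pdivlMr//; near: y.
by apply: nd; rewrite divr_gt0.
Unshelve. all: by end_near. Qed.

Lemma stein_test_df_measurable : measurable_fun setT df.
Proof. exact: continuous_measurable_fun stein_test_df_continuous. Qed.

Lemma stein_test_tame : tame H f.
Proof.
have [_ h _ _] := fdf.
apply: (@weight_dom_tame _ 1) => //; first exact: stein_test_measurable.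
by move=> w; rewrite mul1r.
Qed.

Lemma stein_test_df_tame : tame H df.
Proof.
have [_ _ h _] := fdf.
apply: (@weight_dom_tame _ 1) => //; first exact: stein_test_df_measurable.
by move=> w; rewrite mul1r.
Qed.

Lemma stein_test_df_shift w x : `|df (w + x) - df w| <= `|x| * (expR (H * `|x|) * G w).
Proof.
have [_ _ _ h] := fdf.
apply: (le_trans (h _ _)); rewrite addrC addKr maxC.
by rewrite ler_wpM2l//; exact: weight_max.
Qed.

(** The mean value theorem gives x f'(c) with [c] between the two points, and the Lipschitz bound
    compares f'(c) with f'(w); the factor 1/2 of Taylor's formula is given up. *)
Lemma stein_test_taylor w x :
  `|f (w + x) - f w - x * df w| <= `|x| ^+ 2 * (expR (H * `|x|) * G w).
Proof.
have [hf _ _ h] := fdf; have [mG G0 Gle Gexp] := wG.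
have cf z : {for z, continuous f}.
  by apply: differentiable_continuous; apply/derivable1_diffP; case: (hf z).
have cfw a b : {within `[a, b], continuous f} by exact: continuous_subspaceT.
suff [c [c1 c2]] : exists c, f (w + x) - f w = x * df c /\
    (`|c - w| <= `|x| /\ Num.max c w <= Num.max w (w + x)).
  rewrite c1 -mulrBr normrM expr2 -mulrA ler_wpM2l//.
  apply: le_trans (h _ _) _; apply: ler_pM => //.
    by case: c2.
  by apply: le_trans (weight_max w x); apply: Gle; case: c2.
have [x0|x0|->] := ltgtP x 0; last first.
- by exists w; rewrite addr0 subrr mul0r subrr normr0 maxxx.
- have wx : w < w + x by rewrite ltrDl.
  have [c] := @MVT _ f df _ _ wx (fun z _ => hf z) (cfw _ _).
  rewrite in_itv/= => /andP[c1 c2] e.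
  exists c; split; first by rewrite e; ring.
  rewrite (gtr0_norm x0) gtr0_norm ?subr_gt0//; split; first lra.
  by rewrite (max_l (ltW c1)) (max_r (ltW wx)) ltW.
- have wx : w + x < w by rewrite gtrDl.
  have [c] := @MVT _ f df _ _ wx (fun z _ => hf z) (cfw _ _).
  rewrite in_itv/= => /andP[c1 c2] e.
  exists c; split; first by rewrite -opprB e; ring.
  rewrite (ltr0_norm x0) ltr0_norm ?subr_lt0//; split; first lra.
  by rewrite (max_r (ltW c2)) (max_l (ltW wx)).
Qed.

End weight.

Section op_bounds.
Context d (T : measurableType d) (R : realType) (P : probability T R).
Variables (H K : R) (Y : T -> R).
Hypotheses (H0 : 0 <= H) (mY : measurable_fun setT Y).
Hypothesis iYe : forall k, (k <= 3)%N ->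
  P.-integrable setT (EFin \o (fun t => `|Y t| ^+ k * expR (H * `|Y t|))).
Hypothesis YK : forall k, (1 <= k <= 3)%N ->
  \int[P]_t (`|Y t| ^+ k * expR (H * `|Y t|)) <= K * \int[P]_t (`|Y t| ^+ k).
Hypothesis HKY : H * (K * \int[P]_t (`|Y t|)) <= 1/2.

Let m k := \int[P]_t (`|Y t| ^+ k).
Let mu := \int[P]_t Y t.
Let A := op P (fun=> 1) Y.
Let B := op P id Y.

Let mYk k : measurable_fun setT (fun t => `|Y t| ^+ k).
Proof. by apply: measurable_funX; exact: measurableT_comp. Qed.

Lemma integrable_moment k : (k <= 3)%N ->
  P.-integrable setT (EFin \o (fun t => `|Y t| ^+ k)).
Proof.
move=> k3; apply: le_integrableR (iYe k3) => // t.
by rewrite normrX normr_id ler_peMr// -expR0 ler_expR mulr_ge0.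
Qed.

Lemma integrable_mean : P.-integrable setT (EFin \o Y).
Proof.
by apply: le_integrableR (@integrable_moment 1 _) => // t; rewrite expr1.
Qed.

Let ip1 : P.-integrable setT (EFin \o (fun t => (fun=> 1 : R) (Y t))).
Proof. exact: integrable_cstR. Qed.

Let ip1e : P.-integrable setT (EFin \o (fun t => (fun=> 1 : R) (Y t) * expR (H * Y t))).
Proof.
apply: le_integrableR (@iYe 0 _) => //.
  by apply: measurable_funM => //; exact: measurable_expR_mul.
move=> t; rewrite expr0 !mul1r ger0_norm ?expR_ge0// ler_expR ler_wpM2l//.
exact: ler_norm.
Qed.

Let ipid : P.-integrable setT (EFin \o (fun t => id (Y t))).
Proof. exact: integrable_mean. Qed.

Let ipide : P.-integrable setT (EFin \o (fun t => id (Y t) * expR (H * Y t))).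
Proof.
apply: le_integrableR (@iYe 1 _) => //.
  by apply: measurable_funM => //; exact: measurable_expR_mul.
move=> t; rewrite expr1 normrM ler_wpM2l// ger0_norm ?expR_ge0//.
by rewrite ler_expR ler_wpM2l// ler_norm.
Qed.

Let m1 : measurable_fun [set: R] (fun=> 1 : R). Proof. exact: measurable_cst. Qed.
Let mid : measurable_fun [set: R] (id : R -> R). Proof. exact: measurable_id. Qed.

Lemma tame_opA g : tame H g -> tame H (A g).
Proof. exact: tame_op. Qed.

Lemma tame_opB g : tame H g -> tame H (B g).
Proof. exact: tame_op. Qed.

Lemma op_indepA W g : measurable_fun setT W -> indep_pair P W Y ->
  P.-integrable setT (EFin \o (fun t => expR (H * W t))) -> tame H g ->
  P.-integrable setT (EFin \o (fun t => g (W t + Y t))) /\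
  \int[P]_t (g (W t + Y t)) = \int[P]_t (A g (W t)).
Proof.
move=> mW WY iW tg; have e : (fun t => g (W t + Y t)) = (fun t => 1 * g (W t + Y t)).
  by apply/funext => t; rewrite mul1r.
rewrite e; split; first exact: (op_indep_integrable mY m1 ip1 ip1e mW WY iW tg).
by rewrite -(op_indep mY m1 ip1 ip1e mW WY iW tg).
Qed.

Lemma op_indepB W g : measurable_fun setT W -> indep_pair P W Y ->
  P.-integrable setT (EFin \o (fun t => expR (H * W t))) -> tame H g ->
  P.-integrable setT (EFin \o (fun t => Y t * g (W t + Y t))) /\
  \int[P]_t (Y t * g (W t + Y t)) = \int[P]_t (B g (W t)).
Proof.
move=> mW WY iW tg.
split; first exact: (op_indep_integrable mY mid ipid ipide mW WY iW tg).
by rewrite -(op_indep mY mid ipid ipide mW WY iW tg).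
Qed.

Lemma opA_integrable g w : tame H g ->
  P.-integrable setT (EFin \o (fun t => g (w + Y t))).
Proof.
move=> tg; have := op_integrable mY m1 ip1 ip1e w tg.
by congr (_.-integrable _ _); apply/funext => t /=; rewrite mul1r.
Qed.

Lemma opB_integrable g w : tame H g ->
  P.-integrable setT (EFin \o (fun t => Y t * g (w + Y t))).
Proof. by move=> tg; exact: (op_integrable mY mid ipid ipide w tg). Qed.

Lemma opAE g w : A g w = \int[P]_t g (w + Y t).
Proof. by apply: eq_Rintegral => t _; rewrite mul1r. Qed.

Lemma opA_lin3 g1 g2 g3 c2 c3 w : tame H g1 -> tame H g2 -> tame H g3 ->
  A (fun w => g1 w - c2 * g2 w - c3 * g3 w) w = A g1 w - c2 * A g2 w - c3 * A g3 w.
Proof.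
move=> t1 t2 t3; rewrite !opAE.
have i1 := opA_integrable w t1.
have i2 := integrableRZ c2 (opA_integrable w t2).
have i3 := integrableRZ c3 (opA_integrable w t3).
rewrite RintegralB//; last exact: integrableRB.
rewrite RintegralB// !RintegralZl//; exact: opA_integrable.
Qed.

Lemma opA_cst1 : \int[P]_t (1 : R) = 1.
Proof.
rewrite Rintegral_cst// mul1r.
by have -> : fine (P setT) = 1 by rewrite probability_setT.
Qed.

Lemma Rintegral_cstP (c : R) : \int[P]_t c = c.
Proof.
rewrite Rintegral_cst//.
by have -> : fine (P setT) = 1; rewrite ?probability_setT ?mulr1.
Qed.

Lemma mu_le : `|mu| <= m 1.
Proof.
apply: (le_trans (le_normr_Rintegral _ integrable_mean)) => //.
Qed.

Lemma integral_bound F k c : (1 <= k <= 3)%N -> 0 <= c ->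
  P.-integrable setT (EFin \o F) ->
  (forall t, `|F t| <= `|Y t| ^+ k * expR (H * `|Y t|) * c) ->
  `|\int[P]_t F t| <= K * m k * c.
Proof.
move=> k3 c0 iF Fc; apply: (le_trans (le_normr_Rintegral _ iF)) => //.
have i := iYe (proj2 (andP k3)).
apply: (@le_trans _ _ (\int[P]_t (c * (`|Y t| ^+ k * expR (H * `|Y t|))))).
  apply: le_Rintegral => //.
  - exact: (integrable_norm iF).
  - exact: integrableRZ.
  - by move=> t _; rewrite mulrC; exact: Fc.
rewrite RintegralZl// mulrC ler_wpM2r//; exact: YK.
Qed.

(** From (1 - x) exp(x) <= 1 one gets exp(x) <= 1 + x exp(x); the mean of the last term is at most H
    K E |Y| <= 1/2. *)
Lemma exp_moment_le2 : \int[P]_t expR (H * `|Y t|) <= 2.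
Proof.
have iE : P.-integrable setT (EFin \o (fun t => expR (H * `|Y t|))).
  by have := @iYe 0 isT; congr (_.-integrable _ _); apply/funext => t /=; rewrite expr0 mul1r.
have i1 := @iYe 1 isT.
apply: (@le_trans _ _ (\int[P]_t (1 + H * (`|Y t| ^+ 1 * expR (H * `|Y t|))))).
  apply: le_Rintegral => //.
    by apply: integrableRD; [exact: integrable_cstR|exact: integrableRZ].
  move=> t _; rewrite expr1 mulrA; set x := H * _.
  have := expR_ge1Dx (- x); rewrite expRN => h.
  have e0 := expR_gt0 x.
  have : (1 - x) * expR x <= 1.
    by rewrite -ler_pdivlMr// div1r.
  by rewrite mulrBl mul1r; lra.
have ic := @integrable_cstR _ _ _ P (1 : R).
have iZ := integrableRZ H i1.
rewrite RintegralD//.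
rewrite opA_cst1 RintegralZl//.
have h1 : H * \int[P]_t (`|Y t| ^+ 1 * expR (H * `|Y t|)) <= 1/2.
  apply: le_trans HKY; rewrite ler_wpM2l//.
  apply: le_trans (@YK 1 isT) _; rewrite le_eqVlt; apply/orP; left; apply/eqP.
  by congr (_ * _); apply: eq_Rintegral => t _; rewrite expr1.
by move: h1; lra.
Qed.

Variable G : R -> R.
Hypothesis wG : weight H G.

Let tG : tame H G := weight_tame wG.
Let G0 w : 0 <= G w. Proof. by case: wG. Qed.

(** Together with [opA_weight_ge]: one summand changes the mean of a weight by a factor at most 2 in
    either direction. This makes error terms taken over different sets of rows interchangeable. *)
Lemma opA_weight_le w : A G w <= 2 * G w.
Proof.
rewrite opAE.
have iE : P.-integrable setT (EFin \o (fun t => expR (H * `|Y t|))).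
  by have := @iYe 0 isT; congr (_.-integrable _ _); apply/funext => t /=; rewrite expr0 mul1r.
apply: (@le_trans _ _ (\int[P]_t (G w * expR (H * `|Y t|)))).
  apply: le_Rintegral => //; first exact: opA_integrable.
    exact: integrableRZ.
  by move=> t _; rewrite mulrC; exact: weight_shift.
rewrite RintegralZl// mulrC ler_wpM2r//; exact: exp_moment_le2.
Qed.

Lemma opA_weight_ge (K1 : 1 <= K) w : 1/2 * G w <= A G w.
Proof.
rewrite opAE.
have i1 : P.-integrable setT (EFin \o (fun t => `|Y t|)).
  by have := @integrable_moment 1 isT; congr (_.-integrable _ _).
have i2 : P.-integrable setT (EFin \o (fun t => 1 - H * `|Y t|)).
  by apply: integrableRB; [exact: integrable_cstR|exact: integrableRZ].
apply: (@le_trans _ _ (\int[P]_t (G w * (1 - H * `|Y t|)))).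
  have ic := @integrable_cstR _ _ _ P (1 : R).
  have iZ := integrableRZ H i1.
  rewrite RintegralZl// RintegralB//.
  rewrite opA_cst1 RintegralZl// mulrC ler_wpM2l//.
  have : H * \int[P]_t `|Y t| <= 1/2.
    apply: le_trans HKY; rewrite ler_wpM2l// ler_peMl//.
    by apply: Rintegral_ge0.
  by lra.
apply: le_Rintegral => //; first exact: integrableRZ.
  exact: opA_integrable.
by move=> t _; rewrite mulrC; exact: weight_low.
Qed.

Lemma opA_dom g c w : tame H g -> 0 <= c -> (forall x, `|g x| <= c * G x) ->
  `|A g w| <= 2 * c * G w.
Proof.
move=> tg c0 gG; rewrite opAE.
apply: (le_trans (le_normr_Rintegral _ (opA_integrable w tg))) => //.
apply: (@le_trans _ _ (\int[P]_t (c * G (w + Y t)))).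
  apply: le_Rintegral => //; first exact: (integrable_norm (opA_integrable w tg)).
  by apply: integrableRZ; exact: opA_integrable.
rewrite RintegralZl//; last exact: opA_integrable.
by rewrite (mulrC 2) -mulrA ler_wpM2l// -opAE opA_weight_le.
Qed.

Variables f df : R -> R.
Hypothesis fdf : stein_test G f df.

Let tf := stein_test_tame wG fdf.
Let tdf := stein_test_df_tame wG fdf.

Let icst (c : R) : P.-integrable setT (EFin \o (fun=> c)) := @integrable_cstR _ _ _ P c.

Lemma opA_taylor0 w : `|A df w - df w| <= K * m 1 * G w.
Proof.
rewrite opAE.
have -> : \int[P]_t df (w + Y t) - df w = \int[P]_t (df (w + Y t) - df w).
  rewrite RintegralB//; last exact: opA_integrable.
  by rewrite Rintegral_cstP.
apply: integral_bound => //.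
- by apply: integrableRB => //; exact: opA_integrable.
- by move=> t; rewrite expr1 -mulrA; exact: (stein_test_df_shift H0 wG fdf).
Qed.

Lemma opA_taylor1 w : `|A f w - f w - mu * df w| <= K * m 2 * G w.
Proof.
rewrite opAE.
have -> : \int[P]_t f (w + Y t) - f w - mu * df w =
    \int[P]_t (f (w + Y t) - f w - Y t * df w).
  have i1 : P.-integrable setT (EFin \o (fun t => Y t * df w)).
    have := integrableRZ (df w) integrable_mean.
    by congr (_.-integrable _ _); apply/funext => t /=; rewrite mulrC.
  rewrite RintegralB//; last by apply: integrableRB => //; exact: opA_integrable.
  rewrite RintegralB//; last exact: opA_integrable.
  have iY := integrable_mean.
  by rewrite Rintegral_cstP RintegralZr.
apply: integral_bound => //.
- apply: integrableRB; first by apply: integrableRB => //; exact: opA_integrable.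
  have := integrableRZ (df w) integrable_mean.
  by congr (_.-integrable _ _); apply/funext => t /=; rewrite mulrC.
- by move=> t; rewrite -mulrA; exact: (stein_test_taylor H0 wG fdf).
Qed.

(** Since [Y] need not be centred, a zeroth-order term mu f(w) appears; the exchange of two rows is
    designed to cancel it. *)
Lemma opB_taylor w : `|B f w - mu * f w - m 2 * df w| <= K * m 3 * G w.
Proof.
have i1 : P.-integrable setT (EFin \o (fun t => Y t * f w)).
  have := integrableRZ (f w) integrable_mean.
  by congr (_.-integrable _ _); apply/funext => t /=; rewrite mulrC.
have i2 : P.-integrable setT (EFin \o (fun t => `|Y t| ^+ 2 * df w)).
  have := integrableRZ (df w) (@integrable_moment 2 isT).
  by congr (_.-integrable _ _); apply/funext => t /=; rewrite mulrC.
have iB := opB_integrable w tf.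
have -> : B f w - mu * f w - m 2 * df w =
    \int[P]_t (Y t * f (w + Y t) - Y t * f w - `|Y t| ^+ 2 * df w).
  rewrite RintegralB//; last exact: integrableRB.
  have iY := integrable_mean.
  have iY2 := @integrable_moment 2 isT.
  by rewrite RintegralB// !RintegralZr.
apply: integral_bound => //.
- by apply: integrableRB => //; exact: integrableRB.
- move=> t; rewrite real_normK ?num_real//.
  rewrite (_ : _ - _ = Y t * (f (w + Y t) - f w - Y t * df w)); last by ring.
  rewrite normrM exprS -!mulrA ler_wpM2l//.
  by rewrite mulrA -expr2; exact: (stein_test_taylor H0 wG fdf).
Qed.

End op_bounds.

(** * The combinatorial Stein bound *)

(* The normalised array: [H] bounds the exponential tilt, [K] compares tilted with
   untilted moments, and [eps] plays the role of gamma_n / sqrt n. *)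
Record comb_array d (T : measurableType d) (R : realType) (P : probability T R)
  (n : nat) (Y : 'I_n -> 'I_n -> T -> R) (H K eps : R) : Prop := CombArray {
  ca_n2 : (2 <= n)%N ;
  ca_H0 : 0 <= H ;
  ca_K1 : 1 <= K ;
  ca_meas : forall i j, measurable_fun setT (Y i j) ;
  ca_indep : forall (J : {set 'I_n * 'I_n}) (A : 'I_n * 'I_n -> set R),
    (forall i, measurable (A i)) ->
    P (\bigcap_(p in [set` J]) Y p.1 p.2 @^-1` A p) =
    (\prod_(p in J) P (Y p.1 p.2 @^-1` A p))%E ;
  ca_int : forall i j k, (k <= 3)%N ->
    P.-integrable setT (EFin \o (fun t => `|Y i j t| ^+ k * expR (H * `|Y i j t|))) ;
  ca_expmom : forall i j k, (1 <= k <= 3)%N ->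
    \int[P]_t (`|Y i j t| ^+ k * expR (H * `|Y i j t|)) <=
    K * \int[P]_t (`|Y i j t| ^+ k) ;
  ca_row0 : forall i, \sum_j \int[P]_t Y i j t = 0 ;
  ca_col0 : forall j, \sum_i \int[P]_t Y i j t = 0 ;
  ca_m1 : forall i j, \int[P]_t `|Y i j t| <= eps ;
  ca_m2 : \sum_i \sum_j \int[P]_t (`|Y i j t| ^+ 2) = n%:R ;
  ca_m3 : \sum_i \sum_j \int[P]_t (`|Y i j t| ^+ 3) <= n%:R * eps ;
  ca_n_eps : n%:R^-1 <= eps ;
  ca_HK : H * (K * eps) <= 1/2
}.

Section comb_sums.
Context d (T : measurableType d) (R : realType) (P : probability T R).
Variables (n : nat) (Y : 'I_n -> 'I_n -> T -> R) (H K eps : R).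
Hypothesis ca : comb_array P Y H K eps.

Definition psum (s : 'S_n) (A : {set 'I_n}) t := \sum_(r in A) Y r (s r) t.
Definition EW s A (g : R -> R) := \int[P]_t g (psum s A t).
Definition opA i j := op P (fun=> 1 : R) (Y i j).
Definition opB i j := op P (id : R -> R) (Y i j).
Definition mean i j := \int[P]_t Y i j t.
Definition amom k i j := \int[P]_t (`|Y i j t| ^+ k).

Let H0 : 0 <= H := ca_H0 ca.
Let K1 : 1 <= K := ca_K1 ca.
Let K0 : 0 <= K := le_trans ler01 K1.
Let mY := ca_meas ca.

Lemma eps_ge0 : 0 <= eps.
Proof. by apply: le_trans (ca_n_eps ca); rewrite invr_ge0. Qed.
Let eps0 := eps_ge0.

Lemma measurable_psum s A : measurable_fun setT (psum s A).
Proof.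
rewrite (_ : psum s A = fun t => \sum_(r <- enum A) Y r (s r) t).
  by apply: measurable_sum.
by apply/funext => t; rewrite /psum big_enum.
Qed.

Let indepZ s : forall (J : {set 'I_n}) (A : 'I_n -> set R),
  (forall i, measurable (A i)) ->
  P (\bigcap_(i in [set` J]) Y i (s i) @^-1` A i) =
  (\prod_(i in J) P (Y i (s i) @^-1` A i))%E.
Proof.
move=> J A mA.
pose h i : 'I_n * 'I_n := (i, s i).
have hinj : injective h by move=> i j [].
rewrite -(big_imset (h := h) (fun p => P (Y p.1 p.2 @^-1` A p.1)))/=; last first.
  by move=> i j _ _; exact: hinj.
rewrite -(ca_indep ca); last by [].
congr (P _); apply/seteqP; split => t /= hh.
  by move=> p /= /imsetP[i iJ ->] /=; exact: hh.
move=> i /= iJ; have := hh (h i) => /=; apply.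
exact: imset_f.
Qed.

Lemma indep_psum s (A : {set 'I_n}) r : r \notin A -> indep_pair P (psum s A) (Y r (s r)).
Proof.
move=> rA; rewrite (_ : psum s A = fun t => \sum_(r <- enum A) Y r (s r) t).
  apply: (indep_sum (Z := fun r => Y r (s r))).
  - by move=> i; exact: mY.
  - exact: indepZ.
  - exact: enum_uniq.
  - by rewrite mem_enum.
by apply/funext => t; rewrite /psum big_enum.
Qed.

Lemma psumU1 s (A : {set 'I_n}) r t : r \notin A ->
  psum s (r |: A) t = psum s A t + Y r (s r) t.
Proof. by move=> rA; rewrite /psum big_setU1//= addrC. Qed.

Lemma eq_psum (s s' : 'S_n) (A : {set 'I_n}) : {in A, s =1 s'} -> psum s A = psum s' A.
Proof.
move=> ss'; apply/funext => t; apply: eq_bigr => r rA.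
by rewrite ss'.
Qed.

Lemma psum_exp_integrable s A :
  P.-integrable setT (EFin \o (fun t => expR (H * psum s A t))).
Proof.
elim: {A}#|A| {-2}A (erefl #|A|) => [|m IH] A.
  move/eqP; rewrite cards_eq0 => /eqP ->.
  rewrite (_ : _ \o _ = EFin \o (fun=> 1)); first exact: integrable_cstR.
  by apply/funext => t /=; rewrite /psum big_set0 mulr0 expR0.
move=> cA; have /card_gt0P[r rA] : (0 < #|A|)%N by rewrite cA.
have cA' : #|A :\ r| = m by move: cA; rewrite (cardsD1 r A) rA => -[].
have rA' : r \notin A :\ r by rewrite !inE eqxx.
rewrite (_ : _ \o _ = EFin \o (fun t => expR (H * psum s (A :\ r) t) * expR (H * Y r (s r) t))).
  apply: (integrable_indep_mul _ (mY r (s r)) (indep_psum _ rA')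
    (a := fun y => expR (H * y)) (b := fun y => expR (H * y))).
  - exact: measurable_psum.
  - by apply: measurableT_comp => //; exact: measurable_funM.
  - by apply: measurableT_comp => //; exact: measurable_funM.
  - exact: IH.
  - apply: le_integrableR (@ca_int _ _ _ _ _ _ _ _ _ ca r (s r) 0 isT).
      exact: measurable_expR_mul.
    move=> t; rewrite expr0 mul1r ger0_norm ?expR_ge0// ler_expR ler_wpM2l//.
    exact: ler_norm.
apply/funext => t /=.
by rewrite -expRD -mulrDr -psumU1// finset.setD1K.
Qed.

Lemma HKY i j : H * (K * \int[P]_t (`|Y i j t|)) <= 1/2.
Proof.
apply: le_trans (ca_HK ca); rewrite ler_wpM2l// ler_wpM2l//.
exact: (ca_m1 ca).
Qed.
Let iYe i j := @ca_int _ _ _ _ _ _ _ _ _ ca i j.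
Let YK i j := @ca_expmom _ _ _ _ _ _ _ _ _ ca i j.

Lemma EW_integrable s A g : tame H g ->
  P.-integrable setT (EFin \o (fun t => g (psum s A t))).
Proof.
by apply: tame_integrable; [exact: measurable_psum|exact: psum_exp_integrable].
Qed.

Lemma tame_A i j g : tame H g -> tame H (opA i j g).
Proof. by apply: tame_opA => //; exact: iYe. Qed.

Lemma tame_B i j g : tame H g -> tame H (opB i j g).
Proof. by apply: tame_opB => //; exact: iYe. Qed.

Lemma EW_U1 s (A : {set 'I_n}) r g : r \notin A -> tame H g ->
  EW s (r |: A) g = EW s A (opA r (s r) g).
Proof.
move=> rA tg.
have [_ e] := op_indepA H0 (mY r (s r)) (@iYe r (s r)) (measurable_psum s A)
  (indep_psum s rA) (psum_exp_integrable s A) tg.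
by apply: etrans e; apply: eq_Rintegral => t _; rewrite psumU1.
Qed.

Lemma EWB_U1 (s : 'S_n) (A : {set 'I_n}) r g : r \notin A -> tame H g ->
  P.-integrable setT (EFin \o (fun t => Y r (s r) t * g (psum s (r |: A) t))) /\
  \int[P]_t (Y r (s r) t * g (psum s (r |: A) t)) = EW s A (opB r (s r) g).
Proof.
move=> rA tg.
have [h e] := op_indepB H0 (mY r (s r)) (@iYe r (s r)) (measurable_psum s A)
  (indep_psum s rA) (psum_exp_integrable s A) tg.
split; last by apply: etrans e; apply: eq_Rintegral => t _; rewrite psumU1.
by move: h; congr (_.-integrable _ _); apply/funext => t /=; rewrite psumU1.
Qed.

Lemma EW_lin3 s A g1 g2 g3 c2 c3 c G : tame H g1 -> tame H g2 -> tame H g3 ->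
  tame H G -> (forall w, `|g1 w - c2 * g2 w - c3 * g3 w| <= c * G w) ->
  `|EW s A g1 - c2 * EW s A g2 - c3 * EW s A g3| <= c * EW s A G.
Proof.
move=> t1 t2 t3 tG h.
have i1 := EW_integrable s A t1.
have i2 := EW_integrable s A t2.
have i3 := EW_integrable s A t3.
have iG := EW_integrable s A tG.
have i2' := integrableRZ c2 i2.
have i3' := integrableRZ c3 i3.
have i12 := integrableRB i1 i2'.
have i123 := integrableRB i12 i3'.
rewrite /EW -!RintegralZl// -!RintegralB//.
apply: (le_trans (le_normr_Rintegral _ i123)) => //.
apply: le_Rintegral => //.
- exact: (integrable_norm i123).
- exact: integrableRZ.
Qed.

Variables (G : R -> R).
Hypothesis wG : weight H G.
Let tG := weight_tame wG.
Let G0 w : 0 <= G w. Proof. by case: wG. Qed.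

Lemma EWG_ge0 s A : 0 <= EW s A G.
Proof. by apply: Rintegral_ge0. Qed.

Lemma EW_dom s A g : tame H g -> (forall w, `|g w| <= G w) ->
  `|EW s A g| <= EW s A G.
Proof.
move=> tg gG; apply: (le_trans (le_normr_Rintegral _ (EW_integrable s A tg))) => //.
apply: le_Rintegral => //; last exact: EW_integrable.
exact: (integrable_norm (EW_integrable s A tg)).
Qed.

Lemma EWG_U1_le s (A : {set 'I_n}) r : r \notin A -> EW s (r |: A) G <= 2 * EW s A G.
Proof.
move=> rA; rewrite EW_U1//.
have iA := EW_integrable s A (tame_A r (s r) tG).
rewrite /EW -RintegralZl//; last exact: EW_integrable.
apply: le_Rintegral => //; first by apply: integrableRZ; exact: EW_integrable.
by move=> t _; exact: (opA_weight_le H0 (mY _ _) (@iYe _ _) (@YK _ _) (HKY _ _) wG).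
Qed.

Lemma EWG_U1_ge s (A : {set 'I_n}) r : r \notin A -> EW s A G <= 2 * EW s (r |: A) G.
Proof.
move=> rA; rewrite EW_U1//.
have iA := EW_integrable s A (tame_A r (s r) tG).
rewrite /EW -RintegralZl//.
apply: le_Rintegral => //; first exact: EW_integrable.
  exact: integrableRZ.
move=> t _.
have := opA_weight_ge H0 (mY _ _) (@iYe _ _) (HKY r (s r)) wG K1 (psum s A t).
by rewrite -/(opA _ _); lra.
Qed.

Variables f df : R -> R.
Hypothesis fdf : stein_test G f df.
Let tf := stein_test_tame wG fdf.
Let tdf := stein_test_df_tame wG fdf.

Lemma EWdf_U1 s (A : {set 'I_n}) r : r \notin A ->
  `|EW s (r |: A) df - EW s A df| <= K * eps * EW s A G.
Proof.
move=> rA; rewrite EW_U1//.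
have h w : `|opA r (s r) df w - 1 * df w - 0 * df w| <= K * eps * G w.
  rewrite mul1r mul0r subr0.
  apply: (le_trans (opA_taylor0 H0 (mY _ _) (@iYe _ _) (@YK _ _) wG fdf w)).
  by rewrite ler_wpM2r// ler_wpM2l//; exact: (ca_m1 ca).
have := EW_lin3 s A (tame_A _ _ tdf) tdf tdf tG h.
by rewrite mul1r mul0r subr0.
Qed.

(** Rows are removed one at a time. Each removal costs a factor 2 on the weight and an error K eps
    on f', so the errors add up to 1 + 2 + ... + 2^(m - 1). *)
Lemma EW_remove s (A0 A : {set 'I_n}) m : A0 \subset A -> #|A :\: A0| = m ->
  [/\ EW s A0 G <= 2 ^+ m * EW s A G,
      EW s A G <= 2 ^+ m * EW s A0 G &
      `|EW s A df - EW s A0 df| <= (2 ^+ m - 1) * (K * eps) * EW s A0 G].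
Proof.
elim: m A => [|m IH] A A0A.
  move/eqP; rewrite cards_eq0 finset.setD_eq0 => AA0.
  have -> : A = A0 by apply/eqP; rewrite finset.eqEsubset AA0.
  by rewrite expr0 !subrr normr0 !mul0r !mul1r; split.
move=> cA; have /card_gt0P[r] : (0 < #|A :\: A0|)%N by rewrite cA.
rewrite inE => /andP[rA0 rA].
have rA' : r \notin A :\ r by rewrite !inE eqxx.
have A0A' : A0 \subset A :\ r by rewrite finset.subsetD1 A0A.
have cA' : #|(A :\ r) :\: A0| = m.
  have -> : (A :\ r) :\: A0 = (A :\: A0) :\ r.
    by apply/setP => x; rewrite !inE; case: (x == r); case: (x \in A0).
  by move: cA; rewrite (cardsD1 r (A :\: A0)) !inE rA0 rA => -[].
have [h1 h2 h3] := IH _ A0A' cA'.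
have g1 := EWG_U1_le s rA'; have g2 := EWG_U1_ge s rA'; have g3 := EWdf_U1 s rA'.
move: g1 g2 g3; rewrite finset.setD1K// => g1 g2 g3.
have p0 : 0 <= (2 : R) ^+ m by rewrite exprn_ge0.
split.
- apply: (le_trans h1); rewrite exprSr -mulrA ler_wpM2l//.
- by apply: (le_trans g1); rewrite exprS -mulrA ler_wpM2l.
- have -> : EW s A df - EW s A0 df =
    (EW s A df - EW s (A :\ r) df) + (EW s (A :\ r) df - EW s A0 df) by ring.
  apply: (le_trans (ler_normD _ _)).
  have Ke : 0 <= K * eps by rewrite mulr_ge0.
  have := ler_wpM2l Ke h2.
  move: g3 h3; rewrite exprS; lra.
Qed.

End comb_sums.

(** * Exchanging the images of two rows *)

Section local_expansion.
Context d (T : measurableType d) (R : realType) (P : probability T R).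
Variables (n : nat) (Y : 'I_n -> 'I_n -> T -> R) (H K eps : R).
Hypothesis ca : comb_array P Y H K eps.

Local Notation EW := (EW P Y).
Local Notation opA := (opA P Y).
Local Notation opB := (opB P Y).
Local Notation mean := (mean P Y).
Local Notation amom := (amom P Y).
Local Notation psum := (psum Y).

Let H0 : 0 <= H := ca_H0 ca.
Let K1 : 1 <= K := ca_K1 ca.
Let K0 : 0 <= K := le_trans ler01 K1.
Let mY := ca_meas ca.
Let eps0 := eps_ge0 ca.
Let iYe i j := @ca_int _ _ _ _ _ _ _ _ _ ca i j.
Let YK i j := @ca_expmom _ _ _ _ _ _ _ _ _ ca i j.
Let HKYij i j := HKY ca i j.

Variables (G : R -> R).
Hypothesis wG : weight H G.
Let tG := weight_tame wG.
Let G0 w : 0 <= G w. Proof. by case: wG. Qed.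
Variables f df : R -> R.
Hypothesis fdf : stein_test G f df.
Let tf := stein_test_tame wG fdf.
Let tdf := stein_test_df_tame wG fdf.

Lemma amom_ge0 k i j : 0 <= amom k i j.
Proof. by apply: Rintegral_ge0 => t _; rewrite exprn_ge0. Qed.

Lemma tame_lin3 g1 g2 g3 c2 c3 : tame H g1 -> tame H g2 -> tame H g3 ->
  tame H (fun w => g1 w - c2 * g2 w - c3 * g3 w).
Proof.
move=> t1 t2 t3.
have [a1 [a10 h1]] := tame_bound_ge0 t1.
have [a2 [a20 h2]] := tame_bound_ge0 t2.
have [a3 [a30 h3]] := tame_bound_ge0 t3.
case: t1 t2 t3 => m1 _ [m2 _] [m3 _]; split.
  by apply: measurable_funB; [apply: measurable_funB|] => //; apply: measurable_funM.
exists (a1 + `|c2| * a2 + `|c3| * a3) => w.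
apply: (le_trans (ler_normB _ _)); rewrite !mulrDl -!mulrA normrM.
apply: lerD; last by rewrite ler_wpM2l.
apply: (le_trans (ler_normB _ _)); rewrite normrM; apply: lerD => //.
by rewrite ler_wpM2l.
Qed.

(** The inner average is expanded pointwise, then the expansion is averaged over the second entry:
    the first remainder passes through [opA_dom] with a factor 2, and [f] and [df] are expanded once
    more. [opA_opB] follows the same pattern. *)
Lemma opA_opA i1 j1 i2 j2 w :
  `|opA i2 j2 (opA i1 j1 f) w - 1 * f w - (mean i1 j1 + mean i2 j2) * df w| <=
  K * (2 * amom 2 i1 j1 + amom 2 i2 j2 + `|mean i1 j1| * amom 1 i2 j2) * G w.
Proof.
have tA := tame_A ca i1 j1 tf.
pose g x := opA i1 j1 f x - 1 * f x - mean i1 j1 * df x.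
have tg : tame H g by exact: tame_lin3.
have ge x : `|g x| <= K * amom 2 i1 j1 * G x.
  by rewrite /g mul1r; exact: (opA_taylor1 H0 (mY _ _) (@iYe _ _) (@YK _ _) wG fdf x).
have Ka : 0 <= K * amom 2 i1 j1 by rewrite mulr_ge0// amom_ge0.
have h1 : `|opA i2 j2 (opA i1 j1 f) w - 1 * opA i2 j2 f w - mean i1 j1 * opA i2 j2 df w| <=
    2 * (K * amom 2 i1 j1) * G w.
  have := opA_dom H0 (mY i2 j2) (@iYe _ _) (@YK _ _) (HKYij _ _) wG w tg Ka ge.
  by rewrite (opA_lin3 H0 (mY i2 j2) (@iYe _ _) 1 (mean i1 j1) w tA tf tdf).
have h2 : `|opA i2 j2 f w - f w - mean i2 j2 * df w| <= K * amom 2 i2 j2 * G w.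
  exact: (opA_taylor1 H0 (mY i2 j2) (@iYe _ _) (@YK _ _) wG fdf w).
have h3 : `|opA i2 j2 df w - df w| <= K * amom 1 i2 j2 * G w.
  exact: (opA_taylor0 H0 (mY i2 j2) (@iYe _ _) (@YK _ _) wG fdf w).
have h3' : `|mean i1 j1 * (opA i2 j2 df w - df w)| <=
    `|mean i1 j1| * (K * amom 1 i2 j2 * G w) by rewrite normrM ler_wpM2l.
match type of h1 with is_true (`|?a| <= _) => set X1 := a in h1 end; match type of h2 with is_true (`|?a| <= _) => set X2 := a in h2 end.
match type of h3' with is_true (`|?a| <= _) => set X3 := a in h3' end.
rewrite (_ : _ - _ * df w = X1 + X2 + X3); last by rewrite /X1 /X2 /X3; ring.
apply: (le_trans (ler_normD _ _)); apply: (le_trans (lerD (ler_normD _ _) (lexx _))).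
apply: (le_trans (lerD (lerD h1 h2) h3')).
by rewrite le_eqVlt; apply/orP; left; apply/eqP; ring.
Qed.

Lemma opA_opB i1 j1 i2 j2 w :
  `|opA i2 j2 (opB i1 j1 f) w - mean i1 j1 * f w -
     (mean i1 j1 * mean i2 j2 + amom 2 i1 j1) * df w| <=
  K * (2 * amom 3 i1 j1 + `|mean i1 j1| * amom 2 i2 j2 +
     amom 2 i1 j1 * amom 1 i2 j2) * G w.
Proof.
have tB := tame_B ca i1 j1 tf.
pose g x := opB i1 j1 f x - mean i1 j1 * f x - amom 2 i1 j1 * df x.
have tg : tame H g by exact: tame_lin3.
have ge x : `|g x| <= K * amom 3 i1 j1 * G x.
  exact: (opB_taylor H0 (mY _ _) (@iYe _ _) (@YK _ _) wG fdf x).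
have Ka : 0 <= K * amom 3 i1 j1 by rewrite mulr_ge0// amom_ge0.
have h1 : `|opA i2 j2 (opB i1 j1 f) w - mean i1 j1 * opA i2 j2 f w - amom 2 i1 j1 * opA i2 j2 df w| <=
    2 * (K * amom 3 i1 j1) * G w.
  have := opA_dom H0 (mY i2 j2) (@iYe _ _) (@YK _ _) (HKYij _ _) wG w tg Ka ge.
  by rewrite (opA_lin3 H0 (mY i2 j2) (@iYe _ _) (mean i1 j1) (amom 2 i1 j1) w tB tf tdf).
have h2 : `|opA i2 j2 f w - f w - mean i2 j2 * df w| <= K * amom 2 i2 j2 * G w.
  exact: (opA_taylor1 H0 (mY i2 j2) (@iYe _ _) (@YK _ _) wG fdf w).
have h3 : `|opA i2 j2 df w - df w| <= K * amom 1 i2 j2 * G w.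
  exact: (opA_taylor0 H0 (mY i2 j2) (@iYe _ _) (@YK _ _) wG fdf w).
have h2' : `|mean i1 j1 * (opA i2 j2 f w - f w - mean i2 j2 * df w)| <=
    `|mean i1 j1| * (K * amom 2 i2 j2 * G w) by rewrite normrM ler_wpM2l.
have h3' : `|amom 2 i1 j1 * (opA i2 j2 df w - df w)| <=
    amom 2 i1 j1 * (K * amom 1 i2 j2 * G w).
  by rewrite normrM (ger0_norm (amom_ge0 _ _ _)) ler_wpM2l// amom_ge0.
match type of h1 with is_true (`|?a| <= _) => set X1 := a in h1 end; match type of h2' with is_true (`|?a| <= _) => set X2 := a in h2' end.
match type of h3' with is_true (`|?a| <= _) => set X3 := a in h3' end.
rewrite (_ : _ - _ * df w = X1 + X2 + X3); last by rewrite /X1 /X2 /X3; ring.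
apply: (le_trans (ler_normD _ _)); apply: (le_trans (lerD (ler_normD _ _) (lexx _))).
apply: (le_trans (lerD (lerD h1 h2') h3')).
by rewrite le_eqVlt; apply/orP; left; apply/eqP; ring.
Qed.

Definition rest i l : {set 'I_n} := ~: [set i; l].

Lemma rest_setT i l : finset.setT = i |: (l |: rest i l).
Proof.
apply/setP => x; rewrite !inE; case: (x == i) => //=; case: (x == l) => //=.
Qed.

Lemma rest_notin1 i l : i != l -> i \notin l |: rest i l.
Proof. by move=> il; rewrite !inE eqxx (negbTE il). Qed.

Lemma rest_notin2 i l : l \notin rest i l.
Proof. by rewrite !inE eqxx orbT. Qed.

(* [kappa] is the coefficient of E f' of the sum without rows [i] and [l] that survives
   in [local_step], and [kerr] the third-order remainder. *)
Definition kappa i l j k :=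
  amom 2 i j + mean i j * (mean l k - mean i k - mean l j).

Definition kerr i l j k := K * (2 * amom 3 i j +
  `|mean i j| * (amom 2 l k + 2 * amom 2 i k + amom 2 l j + `|mean i k| * amom 1 l j) +
  amom 2 i j * amom 1 l k).

(** The share of row [i] in E S f(S) for a frozen permutation. *)
Definition crossE (s : 'S_n) i := \int[P]_t (Y i (s i) t * f (psum s finset.setT t)).

Lemma crossE_integrable (s : 'S_n) i :
  P.-integrable setT (EFin \o (fun t => Y i (s i) t * f (psum s finset.setT t))).
Proof.
have e : finset.setT = i |: (~: [set i]).
  by apply/setP => x; rewrite !inE; case: (x == i).
have ni : i \notin ~: [set i] by rewrite !inE eqxx.
by rewrite e; have [] := EWB_U1 ca s ni tf.
Qed.

(* Summed over all [s], the subtracted term is a multiple of the sum of E f(S), because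
   [s] and [tperm i l * s] are equidistributed. *)
Lemma local_step (s : 'S_n) i l : i != l ->
  `|crossE s i - mean i (s i) * EW (tperm i l * s)%g finset.setT f -
    kappa i l (s i) (s l) * EW s (rest i l) df| <=
  kerr i l (s i) (s l) * EW s (rest i l) G.
Proof.
move=> il; set V := rest i l.
have n1 : i \notin l |: V := rest_notin1 il.
have n2 : l \notin V := rest_notin2 i l.
set s' := (tperm i l * s)%g.
have s'i : s' i = s l by rewrite permM tpermL.
have s'l : s' l = s i by rewrite permM tpermR.
have s'V g : EW s' V g = EW s V g.
  rewrite /EW (eq_psum Y (s := s') (s' := s))// => x.
  rewrite !inE negb_or => /andP[xi xl].
  by rewrite permM tpermD// eq_sym.
clearbody s'.
(* Both expectations are reduced to the common sum over [V]: the original permutation adds the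
   entries (i, s i) and (l, s l), the exchanged one (i, s l) and (l, s i). The terms in E f over [V]
   then cancel exactly, and [kappa] collects the coefficients of E f'. *)
have eC : crossE s i = EW s V (opA l (s l) (opB i (s i) f)).
  rewrite /crossE (rest_setT i l) (EWB_U1 ca s n1 tf).2.
  exact: (EW_U1 ca s n2 (tame_B ca i (s i) tf)).
have eS : EW s' finset.setT f = EW s V (opA l (s i) (opA i (s l) f)).
  rewrite (rest_setT i l); apply: etrans (EW_U1 ca s' n1 tf) _.
  apply: etrans (EW_U1 ca s' n2 (tame_A ca i (s' i) tf)) _.
  rewrite s'i.
  rewrite s'l.
  exact: s'V.
have h1 := EW_lin3 ca s V (tame_A ca l (s l) (tame_B ca i (s i) tf)) tf tdf tG
  (opA_opB i (s i) l (s l)).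
have h2 := EW_lin3 ca s V (tame_A ca l (s i) (tame_A ca i (s l) tf)) tf tdf tG
  (opA_opA i (s l) l (s i)).
rewrite -eC in h1; rewrite -eS in h2.
have h2' := ler_wpM2l (normr_ge0 (mean i (s i))) h2.
rewrite -normrM in h2'.
match type of h1 with is_true (`|?a| <= _) => set X1 := a in h1 end; match type of h2' with is_true (`|?a| <= _) => set X2 := a in h2' end.
rewrite (_ : _ - _ * EW s V df = X1 - X2); last by rewrite /X1 /X2 /kappa; ring.
apply: (le_trans (ler_normB _ _)); apply: (le_trans (lerD h1 h2')).
by rewrite le_eqVlt; apply/orP; left; apply/eqP; rewrite /kerr; ring.
Qed.

End local_expansion.

(** * Equidistribution over classes of permutations with two prescribed values *)

Section class_averages.
Context d (T : measurableType d) (R : realType) (P : probability T R).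
Variables (n : nat) (Y : 'I_n -> 'I_n -> T -> R) (H K eps : R).
Hypothesis ca : comb_array P Y H K eps.

Local Notation EW := (EW P Y).

Let K1 : 1 <= K := ca_K1 ca.
Let K0 : 0 <= K := le_trans ler01 K1.
Let eps0 := eps_ge0 ca.

(* Carries the pair (j, k) to (j', k') and moves at most four points. *)
Definition rho (j k j' k' : 'I_n) : 'S_n := (tperm j j' * tperm (tperm j j' k) k')%g.

Lemma rho1 j k j' k' : j != k -> j' != k' -> rho j k j' k' j = j'.
Proof.
move=> jk jk'.
have x1 : tperm j j' k != j'.
  by rewrite -[X in _ != X](tpermL j j') (inj_eq perm_inj) eq_sym.
have x2 : k' != j' by rewrite eq_sym.
by rewrite /rho permM tpermL; exact: tpermD.
Qed.

Lemma rho2 j k j' k' : rho j k j' k' k = k'.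
Proof. by rewrite /rho permM tpermL. Qed.

Lemma rho_fix j k j' k' r : r \notin [:: j; j'; k; k'] -> rho j k j' k' r = r.
Proof.
rewrite !inE !negb_or => /and4P[rj rj' rk rk'].
have e : tperm j j' r = r by rewrite tpermD // eq_sym.
rewrite /rho permM e; apply: tpermD; last by rewrite eq_sym.
by rewrite -[X in _ != X]e (inj_eq perm_inj) eq_sym.
Qed.

Variables (G : R -> R).
Hypothesis wG : weight H G.
Variables f df : R -> R.
Hypothesis fdf : stein_test G f df.

Let pow2_le4 m : (m <= 4)%N -> 1 <= (2 : R) ^+ m <= 16.
Proof.
move=> m4; apply/andP; split; first by rewrite exprn_ege1// ler1n.
have -> : (16 : R) = 2 ^+ 4 by rewrite !exprS expr0; ring.
by rewrite ler_eXn2l// ltr1n.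
Qed.

(** Off the rows sent by [s] into {j, j', k, k'}, the permutations [s] and [s'] agree; [A0] is the
    set of these common rows. Both sums are compared with the one over [A0] by removing at most four
    rows, which gives 256 = 16 * 16 for the weight and 480 = 2 * 15 * 16 for f'. *)
Lemma compare (s : 'S_n) i l j' k' : i != l -> j' != k' ->
  let s' := (s * rho (s i) (s l) j' k')%g in
  EW s (rest i l) G <= 256 * EW s' finset.setT G /\
  `|EW s (rest i l) df - EW s' finset.setT df| <= 480 * (K * eps) * EW s' finset.setT G.
Proof.
move=> il jk' s'.
pose Q := [:: s i; j'; s l; k'].
pose A0 : {set 'I_n} := [set r | s r \notin Q]%SET.
have A0V : A0 \subset rest i l.
  apply/fintype.subsetP => r; rewrite !inE; apply: contra.
  by move=> /orP[/eqP->|/eqP->]; rewrite eqxx ?orbT.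
have cT : (#|finset.setT :\: A0| <= 4)%N.
  rewrite -(card_imset _ (@perm_inj _ s)).
  apply: (@leq_trans #|Q|); last exact: card_size.
  apply/subset_leq_card/fintype.subsetP => x /imsetP[r].
  by rewrite !inE ?andbT negbK => rQ ->.
have cV : (#|rest i l :\: A0| <= 4)%N.
  by apply: leq_trans cT; apply/subset_leq_card/finset.setSD/finset.subsetT.
have eA0 g : EW s A0 g = EW s' A0 g.
  rewrite /EW (eq_psum Y (s := s) (s' := s'))// => r.
  by rewrite inE => rQ; rewrite permM rho_fix.
have [v1 v2 v3] := EW_remove ca wG fdf s A0V (erefl #|rest i l :\: A0|).
have [t1 t2 t3] := EW_remove ca wG fdf s' (finset.subsetT A0) (erefl #|finset.setT :\: A0|).
rewrite !eA0 in v2 v3.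
have /andP[a1 a2] := pow2_le4 cV; have /andP[b1 b2] := pow2_le4 cT.
move: v2 v3 t1 t3 a1 a2 b1 b2.
move: (2 ^+ _) (2 ^+ _) => p q.
have := EWG_ge0 P Y wG s' A0; have := EWG_ge0 P Y wG s' finset.setT.
have Ke : 0 <= K * eps by rewrite mulr_ge0.
move: (EW s' A0 G) (EW s' finset.setT G) (EW s (rest i l) G) (K * eps) Ke
  (EW s (rest i l) df) (EW s' A0 df) (EW s' finset.setT df) => g0 gT gV Ke Ke0 dV d0 dT.
move=> gT0 g00 v2 v3 t1 t3 p1 p16 q1 q16.
have g016 : g0 <= 16 * gT by apply: (le_trans t1); rewrite ler_wpM2r.
split.
  apply: (le_trans v2); apply: (@le_trans _ _ (16 * g0)); first by rewrite ler_wpM2r.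
  by lra.
have -> : dV - dT = (dV - d0) - (dT - d0) by ring.
apply: (le_trans (ler_normB _ _)).
have Kg : 0 <= Ke * g0 by rewrite mulr_ge0.
have h1 : (p - 1) * Ke * g0 <= 15 * (Ke * g0) by rewrite -mulrA ler_wpM2r//; lra.
have h2 : (q - 1) * Ke * g0 <= 15 * (Ke * g0) by rewrite -mulrA ler_wpM2r//; lra.
have := ler_wpM2l Ke0 g016.
by lra.
Qed.

Definition cls (i l j k : 'I_n) (s : 'S_n) := (s i == j) && (s l == k).

Lemma sum_cls (F : 'S_n -> R) i l : i != l ->
  \sum_s F s = \sum_j \sum_(k | k != j) \sum_(s | cls i l j k s) F s.
Proof.
move=> il.
rewrite (partition_big (fun s : 'S_n => s i) xpredT)//=.
apply: eq_bigr => j _.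
rewrite (partition_big (fun s : 'S_n => s l) (fun k => k != j))//=.
move=> s /eqP <-; rewrite (inj_eq perm_inj) eq_sym; exact: il.
Qed.

Lemma sum_cls_rho (F : 'S_n -> R) i l j k j' k' : j != k -> j' != k' ->
  \sum_(s | cls i l j' k' s) F s =
  \sum_(s | cls i l j k s) F (s * rho j k j' k')%g.
Proof.
move=> jk jk'; rewrite (reindex_inj (mulIg (rho j k j' k'))) /=.
apply: eq_bigl => s; rewrite /cls; congr (_ && _); rewrite permM.
  by rewrite -[X in _ == X](rho1 jk jk') (inj_eq perm_inj).
by rewrite -[X in _ == X](rho2 j k j' k') (inj_eq perm_inj).
Qed.

(** Expectation over a uniform permutation without the factor 1 / n!, which is restored only in
    [perm_tail_prob]. *)
Definition total (g : R -> R) := \sum_s EW s finset.setT g.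

Lemma sum_offdiag_cst (c : R) : \sum_(j < n) \sum_(k < n | k != j) c = n%:R * (n%:R - 1) * c.
Proof.
have n0 : (0 < n)%N by apply: ltnW; exact: ca_n2 ca.
under eq_bigr => j _ do rewrite sumr_const (cardC1 j) card_ord.
rewrite sumr_const card_ord -mulrnA -[LHS]mulr_natr mulrC natrM -subn1 natrB//.
by ring.
Qed.

(** As (j', k') runs over the n (n - 1) pairs of distinct columns, the images of one class under
    [rho] tile the symmetric group. Summing [compare] over them replaces a class mean by the global
    mean, so the rows left over forget the images of [i] and [l]. *)
Lemma class_average i l j k : i != l -> j != k ->
  n%:R * (n%:R - 1) * (\sum_(s | cls i l j k s) EW s (rest i l) G) <= 256 * total G /\
  `|n%:R * (n%:R - 1) * (\sum_(s | cls i l j k s) EW s (rest i l) df) - total df| <=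
     480 * (K * eps) * total G.
Proof.
move=> il jk.
have tE g : total g = \sum_j' \sum_(k' | k' != j') \sum_(s | cls i l j k s)
    EW (s * rho j k j' k')%g finset.setT g.
  rewrite /total (sum_cls _ il); apply: eq_bigr => j' _; apply: eq_bigr => k' jk'.
  by apply: sum_cls_rho => //; rewrite eq_sym.
have clsE s : cls i l j k s -> s i = j /\ s l = k by move=> /andP[/eqP-> /eqP->].
split.
  rewrite -sum_offdiag_cst tE mulr_sumr; apply: ler_sum => j' _.
  rewrite mulr_sumr; apply: ler_sum => k' jk'; rewrite mulr_sumr.
  apply: ler_sum => s /clsE[<- <-].
  by rewrite eq_sym in jk'; have [] := compare s il jk'.
rewrite -sum_offdiag_cst !tE mulr_sumr -sumrB.
apply: (le_trans (ler_norm_sum _ _ _)); apply: ler_sum => j' _.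
rewrite mulr_sumr -sumrB.
apply: (le_trans (ler_norm_sum _ _ _)); apply: ler_sum => k' jk'.
rewrite mulr_sumr -sumrB.
apply: (le_trans (ler_norm_sum _ _ _)); apply: ler_sum => s /clsE[<- <-].
by rewrite eq_sym in jk'; have [] := compare s il jk'.
Qed.

Lemma sum_offdiag_cls (phi : 'I_n -> 'I_n -> 'I_n -> 'I_n -> R)
    (psi : 'S_n -> 'I_n -> 'I_n -> R) :
  \sum_(s : 'S_n) \sum_i \sum_(l | l != i) phi i l (s i) (s l) * psi s i l =
  \sum_i \sum_(l | l != i) \sum_j \sum_(k | k != j)
    phi i l j k * \sum_(s | cls i l j k s) psi s i l.
Proof.
rewrite exchange_big/=; apply: eq_bigr => i _.
rewrite exchange_big/=; apply: eq_bigr => l li.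
rewrite eq_sym in li; rewrite (sum_cls _ li); apply: eq_bigr => j _.
apply: eq_bigr => k _; rewrite mulr_sumr; apply: eq_bigr => s /andP[/eqP-> /eqP->].
by [].
Qed.

End class_averages.

(* Here [x] is n, [Z] the sum of E S f(S), [Td] that of E f'(S), [TG] that of E G(S),
   [qk] and [qe] the sums of the [kappa] and [kerr] terms, and [m2] the sum of the
   squared means. *)
Lemma stein_arith (R : realFieldType) (x K eps TG Td U Z qk qe m2 : R) :
  `|(x - 1) * Z - U - qk| <= qe ->
  x * (x - 1) * qe <= 256 * TG * (8 * K * x ^+ 3 * eps) ->
  `|x * (x - 1) * qk - Td * ((x - 1) ^+ 2 * x + (2 * x - 1) * m2)| <=
    480 * (K * eps) * TG * (4 * x ^+ 3) ->
  `|U| <= x * eps * TG -> `|Td| <= TG -> 0 <= m2 -> m2 <= x -> 0 <= TG ->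
  2 <= x -> 1 <= x * eps -> 1 <= K -> 0 <= eps ->
  `|Z - Td| <= 16000 * K * eps * TG.
Proof.
move=> E1 E1' E4 U1 td m0 mn TG0 x2 neps K1 eps0.
have N20 : 0 <= x * (x - 1) by apply: mulr_ge0; lra.
set D := Z - Td.
have bound : x * (x - 1) ^+ 2 * `|D| <=
   (x * (x - 1) * (x * eps) + 2048 * (K * x ^+ 3 * eps) + 1920 * (K * eps * x ^+ 3) +
    2 * x ^+ 2) * TG.
  rewrite -[X in X * `|D|]ger0_norm -?normrM; last by rewrite mulr_ge0 ?sqr_ge0//; lra.
  (* [qk] is traded for its class-averaged value, whose leading part x (x - 1)^2 Td meets x (x -
     1)^2 Z; the part with [m2] is of order x^2 only, smaller by 1 / x. *)
  have -> : x * (x - 1) ^+ 2 * D = x * (x - 1) * ((x - 1) * Z - U - qk) + x * (x - 1) * U +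
     (x * (x - 1) * qk - Td * ((x - 1) ^+ 2 * x + (2 * x - 1) * m2)) + Td * ((2 * x - 1) * m2).
    by rewrite /D; ring.
  apply: (le_trans (ler_normD _ _)); rewrite [leRHS]mulrDl; apply: lerD; last first.
    rewrite normrM mulrC; apply: ler_pM => //.
    rewrite ger0_norm; last by rewrite mulr_ge0//; lra.
    have := ler_wpM2l (_ : 0 <= 2 * x - 1) mn.
    move=> /(_ ltac:(lra)); nra.
  apply: (le_trans (ler_normD _ _)); rewrite [leRHS]mulrDl; apply: lerD; last first.
    by apply: (le_trans E4); rewrite le_eqVlt; apply/orP; left; apply/eqP; ring.
  apply: (le_trans (ler_normD _ _)); rewrite [leRHS]mulrDl [leLHS]addrC; apply: lerD.
    rewrite normrM (ger0_norm N20) -mulrA; apply: ler_wpM2l => //.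
  rewrite normrM (ger0_norm N20).
  apply: (le_trans (ler_wpM2l N20 E1)); apply: (le_trans E1').
  by rewrite le_eqVlt; apply/orP; left; apply/eqP; ring.
clear E1 E1' E4 U1 td m0 mn N20; clearbody D.
have x3 : 0 < x ^+ 3 by rewrite exprn_gt0//; lra.
have low : x ^+ 3 / 4 * `|D| <= x * (x - 1) ^+ 2 * `|D|.
  rewrite ler_wpM2r//.
  have : 0 <= x * ((x - 2) * (3 * x - 2)) by rewrite !mulr_ge0//; lra.
  rewrite (_ : x ^+ 3 = x * x * x); last by ring.
  by rewrite (_ : (x - 1) ^+ 2 = (x-1) * (x-1)); [lra|ring].
(* Since x eps >= 1 and K >= 1, every term is a multiple of K x^3 eps, and 1 + 2048 + 1920 + 2 <=
   4000. The factor 4 lost in x - 1 >= x / 2 makes 16000. *)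
have up : x * (x - 1) * (x * eps) + 2048 * (K * x ^+ 3 * eps) + 1920 * (K * eps * x ^+ 3) +
    2 * x ^+ 2 <= x ^+ 3 * (4000 * K * eps).
  have e1 : x * (x - 1) * (x * eps) <= x ^+ 3 * eps.
    have : 0 <= x * (x * eps) by rewrite !mulr_ge0//; lra.
    by rewrite (_ : x ^+ 3 = x * x * x); [lra|ring].
  have e2 : x ^+ 2 <= x ^+ 3 * eps.
    rewrite (_ : x ^+ 3 * eps = x ^+ 2 * (x * eps)); last by ring.
    by rewrite ler_peMr// exprn_ge0//; lra.
  have e3 : x ^+ 3 * eps <= x ^+ 3 * eps * K.
    by rewrite ler_peMr// mulr_ge0// ltW.
  have e4 : 0 <= x ^+ 3 * eps by rewrite mulr_ge0// ltW.
  by lra.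
have := le_trans low (le_trans bound (ler_wpM2r TG0 up)).
rewrite -mulrA -(mulrA (x ^+ 3)) ler_pM2l//.
by lra.
Qed.

(** * Summation over rows and permutations *)

Section stein_bound.
Context d (T : measurableType d) (R : realType) (P : probability T R).
Variables (n : nat) (Y : 'I_n -> 'I_n -> T -> R) (H K eps : R).
Hypothesis ca : comb_array P Y H K eps.

Local Notation EW := (EW P Y).
Local Notation mean := (mean P Y).
Local Notation amom := (amom P Y).
Local Notation total := (total P Y).

Let K1 : 1 <= K := ca_K1 ca.
Let K0 : 0 <= K := le_trans ler01 K1.
Let eps0 := eps_ge0 ca.
Let n2 : (2 <= n)%N := ca_n2 ca.
Let iYe i j := @ca_int _ _ _ _ _ _ _ _ _ ca i j.
Let mY := ca_meas ca.

Lemma mean_le_amom i j : `|mean i j| <= amom 1 i j.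
Proof. exact: (mu_le (ca_H0 ca) (mY i j) (@iYe i j)). Qed.

Lemma amom1_le i j : amom 1 i j <= eps.
Proof. exact: ca_m1 ca i j. Qed.

Lemma mean_sqr i j : mean i j ^+ 2 <= amom 2 i j.
Proof.
have iY := integrable_mean (ca_H0 ca) (mY i j) (@iYe i j).
have iY2 := @integrable_moment _ _ _ P _ _ (ca_H0 ca) (mY i j) (@iYe i j) 2 isT.
have i1 := integrableRZ (2 * mean i j) iY.
have i2 := @integrable_cstR _ _ _ P (mean i j ^+ 2).
have i3 := integrableRD (integrableRB iY2 i1) i2.
have : 0 <= \int[P]_t (`|Y i j t| ^+ 2 - 2 * mean i j * Y i j t + mean i j ^+ 2).
  apply: Rintegral_ge0 => t _; rewrite real_normK ?num_real//.
  have -> : Y i j t ^+ 2 - 2 * mean i j * Y i j t + mean i j ^+ 2 = (Y i j t - mean i j) ^+ 2 by ring.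
  exact: sqr_ge0.
rewrite RintegralD//; last exact: integrableRB.
rewrite RintegralB// RintegralZl// Rintegral_cstP -/(amom 2 i j) -/(mean i j).
have -> : amom 2 i j - 2 * mean i j * mean i j + mean i j ^+ 2 = amom 2 i j - mean i j ^+ 2 by ring.
by rewrite subr_ge0.
Qed.

Lemma mean_mul i j i' j' : `|mean i j| * `|mean i' j'| <= (amom 2 i j + amom 2 i' j') / 2.
Proof.
have h1 := mean_sqr i j; have h2 := mean_sqr i' j'.
have : 0 <= (`|mean i j| - `|mean i' j'|) ^+ 2 by exact: sqr_ge0.
rewrite sqrrB !real_normK ?num_real// => h.
rewrite -mulr_natr in h; lra.
Qed.

Lemma sum4_cst (x y z v : 'I_n -> 'I_n -> R) :
  \sum_i \sum_l \sum_j \sum_k (x i j + y l k + z i k + v l j) =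
  n%:R ^+ 2 * (\sum_i \sum_j x i j + \sum_i \sum_j y i j +
               \sum_i \sum_j z i j + \sum_i \sum_j v i j).
Proof.
have cst (c : R) : \sum_(k < n) c = n%:R * c by rewrite sumr_const card_ord mulr_natl.
have eq4 i l : \sum_j \sum_k (x i j + y l k + z i k + v l j) =
  n%:R * (\sum_j x i j) + n%:R * (\sum_j y l j) + n%:R * (\sum_j z i j) + n%:R * (\sum_j v l j).
  have e j : \sum_k (x i j + y l k + z i k + v l j) =
     n%:R * x i j + \sum_k y l k + \sum_k z i k + n%:R * v l j.
    by rewrite !big_split/= !cst.
  under eq_bigr => j _ do rewrite e.
  by rewrite !big_split/= !cst -!mulr_sumr.
under eq_bigr => i _ do under eq_bigr => l _ do rewrite eq4.
under eq_bigr => i _ do rewrite !big_split/= !cst -!mulr_sumr.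
by rewrite !big_split/= !cst -!mulr_sumr; ring.
Qed.

Definition quad (F : 'I_n -> 'I_n -> 'I_n -> 'I_n -> R) :=
  \sum_i \sum_(l | l != i) \sum_j \sum_(k | k != j) F i l j k.

Lemma le_quad F F' : (forall i l j k, i != l -> j != k -> F i l j k <= F' i l j k) ->
  quad F <= quad F'.
Proof.
move=> h; apply: ler_sum => i _; apply: ler_sum => l li; apply: ler_sum => j _.
by apply: ler_sum => k kj; apply: h; rewrite eq_sym.
Qed.

Lemma quad_le_full F : (forall i l j k, 0 <= F i l j k) ->
  quad F <= \sum_i \sum_l \sum_j \sum_k F i l j k.
Proof.
move=> F0; apply: ler_sum => i _.
rewrite [leRHS](bigID (fun l => l != i))/= -[leLHS]addr0; apply: lerD; last first.
  by apply: sumr_ge0 => l _; apply: sumr_ge0 => j _; exact: sumr_ge0.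
apply: ler_sum => l _; apply: ler_sum => j _.
rewrite [leRHS](bigID (fun k => k != j))/= -[leLHS]addr0; apply: lerD => //.
exact: sumr_ge0.
Qed.

Lemma ler_norm_quad F : `|quad F| <= quad (fun i l j k => `|F i l j k|).
Proof.
apply: (le_trans (ler_norm_sum _ _ _)); apply: ler_sum => i _.
apply: (le_trans (ler_norm_sum _ _ _)); apply: ler_sum => l _.
apply: (le_trans (ler_norm_sum _ _ _)); apply: ler_sum => j _.
exact: ler_norm_sum.
Qed.

Lemma quadZ c F : c * quad F = quad (fun i l j k => c * F i l j k).
Proof.
rewrite mulr_sumr; apply: eq_bigr => i _; rewrite mulr_sumr; apply: eq_bigr => l _.
by rewrite mulr_sumr; apply: eq_bigr => j _; rewrite mulr_sumr.
Qed.

Lemma quadB F F' : quad F - quad F' = quad (fun i l j k => F i l j k - F' i l j k).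
Proof.
rewrite -sumrB; apply: eq_bigr => i _; rewrite -sumrB; apply: eq_bigr => l _.
by rewrite -sumrB; apply: eq_bigr => j _; rewrite -sumrB.
Qed.

Let sum_neq (F : 'I_n -> R) j : \sum_(k | k != j) F k = \sum_k F k - F j.
Proof. by rewrite [X in _ = X - _](bigD1 j)//=; ring. Qed.

Let sum_neq_cst (c : R) (j : 'I_n) : \sum_(k < n | k != j) c = (n%:R - 1) * c.
Proof. by rewrite sum_neq sumr_const card_ord mulrBl mulr_natl mul1r. Qed.

(** An exact evaluation, and the place where both row and column sums must vanish: they kill the
    products of different means, and only the exclusions l != i, k != j leave squared means behind.
    The leading term is n (n - 1)^2 by the normalisation of the second moments. *)
Lemma quad_kappa :
  quad (kappa P Y) = (n%:R - 1) ^+ 2 * n%:R +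
    (2 * n%:R - 1) * \sum_i \sum_j mean i j ^+ 2.
Proof.
have row0 i : \sum_j mean i j = 0 by exact: (ca_row0 ca).
have col0 j : \sum_i mean i j = 0 by exact: (ca_col0 ca).
have e1 i l j : \sum_(k | k != j) kappa P Y i l j k =
    (n%:R - 1) * amom 2 i j + mean i j ^+ 2 - n%:R * mean i j * mean l j.
  rewrite /kappa big_split/= sum_neq_cst -mulr_sumr !big_split/= sum_neq row0.
  rewrite sumrN sum_neq row0 sumrN sum_neq_cst; ring.
have e2 i j : \sum_(l | l != i) ((n%:R - 1) * amom 2 i j + mean i j ^+ 2 -
     n%:R * mean i j * mean l j) =
   (n%:R - 1) ^+ 2 * amom 2 i j + (2 * n%:R - 1) * mean i j ^+ 2.
  rewrite !big_split/= !sum_neq_cst sumrN -mulr_sumr sum_neq col0; ring.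
rewrite /quad -[X in _ = _ * X + _](ca_m2 ca) !mulr_sumr -big_split/=.
apply: eq_bigr => i _.
rewrite exchange_big/= !mulr_sumr -big_split/=; apply: eq_bigr => j _.
by under eq_bigr => l _ do rewrite e1; exact: e2.
Qed.

Lemma sum_mean_sqr : 0 <= \sum_i \sum_j mean i j ^+ 2 <= n%:R.
Proof.
apply/andP; split; first by apply: sumr_ge0 => i _; apply: sumr_ge0 => j _; exact: sqr_ge0.
rewrite -(ca_m2 ca); apply: ler_sum => i _; apply: ler_sum => j _.
exact: mean_sqr.
Qed.

Let amom2_sum : \sum_i \sum_j amom 2 i j = n%:R. Proof. exact: (ca_m2 ca). Qed.

Let sumZ c (x : 'I_n -> 'I_n -> R) : \sum_i \sum_j c * x i j = c * \sum_i \sum_j x i j.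
Proof. by rewrite mulr_sumr; apply: eq_bigr => i _; rewrite mulr_sumr. Qed.

(** It multiplies the error of [class_average], so only the order n^3 counts. Products of means are
    split by the arithmetic-geometric inequality, and 4 = 5/2 + 3 * 1/2. *)
Lemma quad_abs_kappa : quad (fun i l j k => `|kappa P Y i l j k|) <= 4 * n%:R ^+ 3.
Proof.
have a0 i j : 0 <= amom 2 i j by exact: amom_ge0.
pose F i l j k := 5/2 * amom 2 i j + 1/2 * amom 2 l k + 1/2 * amom 2 i k + 1/2 * amom 2 l j.
apply: (@le_trans _ _ (quad F)).
  apply: le_quad => i l j k _ _; rewrite /kappa.
  apply: (le_trans (ler_normD _ _)); rewrite (ger0_norm (a0 i j)) normrM.
  have h1 := mean_mul i j l k; have h2 := mean_mul i j i k; have h3 := mean_mul i j l j.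
  have h4 : `|mean l k - mean i k - mean l j| <= `|mean l k| + `|mean i k| + `|mean l j|.
    by apply: (le_trans (ler_normB _ _)); apply: lerD => //; exact: ler_normB.
  have := ler_wpM2l (normr_ge0 (mean i j)) h4; rewrite !mulrDr /F; lra.
apply: (le_trans (quad_le_full _)).
  by move=> i l j k; rewrite /F !addr_ge0// mulr_ge0// divr_ge0.
rewrite /F sum4_cst !sumZ amom2_sum.
by rewrite le_eqVlt; apply/orP; left; apply/eqP; field.
Qed.

(** In each product one first absolute moment is bounded by [eps], leaving second moments whose
    double sum is n; the third moments sum to n eps by assumption. The coefficients add up to 2 +
    3/2 + 1 + 5/2 + 1 = 8. *)
Lemma quad_kerr : quad (kerr P Y K) <= 8 * K * n%:R ^+ 3 * eps.
Proof.
have a0 k i j : 0 <= amom k i j by exact: amom_ge0.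
pose x i j := K * (2 * amom 3 i j + eps * (3/2) * amom 2 i j).
pose y (l k : 'I_n) := K * eps * amom 2 l k.
pose z (i k : 'I_n) := K * eps * (5/2) * amom 2 i k.
pose v (l j : 'I_n) := K * eps * amom 2 l j.
apply: (@le_trans _ _ (quad (fun i l j k => x i j + y l k + z i k + v l j))).
  apply: le_quad => i l j k _ _; rewrite /kerr /x /y /z /v.
  have -> : K * (2 * amom 3 i j + eps * (3/2) * amom 2 i j) + K * eps * amom 2 l k +
     K * eps * (5/2) * amom 2 i k + K * eps * amom 2 l j =
     K * (2 * amom 3 i j + eps * (amom 2 l k + 2 * amom 2 i k + amom 2 l j) +
      eps * ((amom 2 i j + amom 2 i k) / 2) + eps * amom 2 i j) by field.
  rewrite ler_wpM2l//.
  have h1 := le_trans (mean_le_amom i j) (amom1_le i j).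
  have h2 : `|mean i j| * (amom 2 l k + 2 * amom 2 i k + amom 2 l j) <=
     eps * (amom 2 l k + 2 * amom 2 i k + amom 2 l j).
    rewrite ler_wpM2r//; have := a0 2%N l k; have := a0 2%N i k; have := a0 2%N l j.
    by lra.
  have h3 : (`|mean i j| * `|mean i k|) * amom 1 l j <=
    (amom 2 i j + amom 2 i k) / 2 * eps.
    by apply: ler_pM => //; [exact: mean_mul|exact: amom1_le].
  have h4 : amom 2 i j * amom 1 l k <= amom 2 i j * eps.
    by rewrite ler_wpM2l//; exact: amom1_le.
  by rewrite mulrDr mulrA; lra.
apply: (le_trans (quad_le_full _)).
  move=> i l j k; rewrite /x /y /z /v.
  by repeat first [apply: addr_ge0 | apply: mulr_ge0 | apply: divr_ge0 | exact: a0 | exact: K0 | exact: eps0 | done].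
rewrite sum4_cst /x /y /z /v !sumZ amom2_sum.
under eq_bigr => i _ do rewrite big_split/=.
rewrite big_split/= !sumZ amom2_sum.
have h3 : \sum_i \sum_j amom 3 i j <= n%:R * eps by exact: (ca_m3 ca).
have nn : 0 <= n%:R ^+ 2 * K by rewrite mulr_ge0.
have := ler_wpM2l nn h3.
by rewrite (_ : n%:R ^+ 3 = n%:R * n%:R ^+ 2) ?exprS// ; lra.
Qed.

Variables (G : R -> R).
Hypothesis wG : weight H G.
Variables f df : R -> R.
Hypothesis fdf : stein_test G f df.
Let tf := stein_test_tame wG fdf.
Let tdf := stein_test_df_tame wG fdf.

Lemma total_ge0 : 0 <= total G.
Proof. by apply: sumr_ge0 => s _; exact: (EWG_ge0 P Y wG). Qed.

Lemma total_dom g : tame H g -> (forall w, `|g w| <= G w) -> `|total g| <= total G.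
Proof.
move=> tg gG; apply: (le_trans (ler_norm_sum _ _ _)); apply: ler_sum => s _.
exact: (EW_dom ca).
Qed.

(** Reindexing by the transposition turns the coefficient into [mean i (s l)], and the sum over l !=
    i collapses to [- mean i (s i)] because the row sum vanishes. Thus about n^2 terms shrink to n
    terms of size [eps]. *)
Let swap_sum : `|\sum_(s : 'S_n) \sum_i \sum_(l | l != i)
    mean i (s i) * EW (tperm i l * s)%g finset.setT f| <= n%:R * eps * total G.
Proof.
have -> : \sum_(s : 'S_n) \sum_i \sum_(l | l != i)
    mean i (s i) * EW (tperm i l * s)%g finset.setT f =
   - \sum_(s : 'S_n) (\sum_i mean i (s i)) * EW s finset.setT f.
  transitivity (\sum_i \sum_(l | l != i) \sum_(s : 'S_n) mean i (s l) * EW s finset.setT f).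
    rewrite exchange_big/=; apply: eq_bigr => i _.
    rewrite exchange_big/=; apply: eq_bigr => l _.
    rewrite [RHS](reindex_inj (mulgI (tperm i l)))/=.
    by apply: eq_bigr => s _; rewrite permM tpermR.
  transitivity (\sum_i \sum_(s : 'S_n) - mean i (s i) * EW s finset.setT f).
    apply: eq_bigr => i _; rewrite exchange_big/=; apply: eq_bigr => s _.
    rewrite -mulr_suml sum_neq; congr (_ * _).
    have -> : \sum_l mean i (s l) = \sum_l mean i l.
      by rewrite [RHS](reindex_inj (@perm_inj _ s)).
    by rewrite (_ : \sum_j mean i j = 0) ?sub0r//; exact: (ca_row0 ca).
  rewrite exchange_big/= -sumrN; apply: eq_bigr => s _.
  by rewrite -mulr_suml sumrN mulNr.
rewrite normrN mulr_sumr; apply: (le_trans (ler_norm_sum _ _ _)); apply: ler_sum => s _.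
rewrite normrM; apply: ler_pM => //.
  apply: (le_trans (ler_norm_sum _ _ _)).
  apply: (@le_trans _ _ (\sum_(i < n) eps)); last by rewrite sumr_const card_ord mulr_natl.
  by apply: ler_sum => i _; exact: le_trans (mean_le_amom _ _) (amom1_le _ _).
by apply: (EW_dom ca) => //; case: fdf.
Qed.

Theorem stein_bound :
  `|\sum_(s : 'S_n) \sum_i crossE P Y f s i - total df| <= 16000 * K * eps * total G.
Proof.
set Z := \sum_(s : 'S_n) \sum_i crossE P Y f s i.
pose SG i l j k := \sum_(s | cls i l j k s) EW s (rest i l) G.
pose Sd i l j k := \sum_(s | cls i l j k s) EW s (rest i l) df.
pose N2 : R := n%:R * (n%:R - 1).
have nR2 : (2 : R) <= n%:R by rewrite ler_nat.
have N20 : 0 <= N2 by rewrite /N2 mulr_ge0//; lra.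
set U := \sum_(s : 'S_n) \sum_i \sum_(l | l != i)
    mean i (s i) * EW (tperm i l * s)%g finset.setT f.
have TG0 := total_ge0.
have c256 : 0 <= 256 * total G := mulr_ge0 (ler0n _ _) TG0.
have c480 : 0 <= 480 * (K * eps) * total G.
  apply: mulr_ge0 TG0; apply: mulr_ge0; first by rewrite ler0n.
  exact: mulr_ge0 K0 eps0.
(* Row [i] is exchanged with each of the n - 1 others, hence the factor in front of [Z]. *)
have E1 : `|(n%:R - 1) * Z - U - quad (fun i l j k => kappa P Y i l j k * Sd i l j k)| <=
    quad (fun i l j k => kerr P Y K i l j k * SG i l j k).
  rewrite /quad -!sum_offdiag_cls /U /Z mulr_sumr -!sumrB.
  apply: (le_trans (ler_norm_sum _ _ _)); apply: ler_sum => s _.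
  rewrite mulr_sumr -!sumrB.
  apply: (le_trans (ler_norm_sum _ _ _)); apply: ler_sum => i _.
  rewrite -(sum_neq_cst _ i) -!sumrB.
  apply: (le_trans (ler_norm_sum _ _ _)); apply: ler_sum => l li.
  by apply: (local_step ca wG fdf); rewrite eq_sym.
have cavg i l j k (il : i != l) (jk : j != k) := class_average ca wG fdf il jk.
have E1' : N2 * quad (fun i l j k => kerr P Y K i l j k * SG i l j k) <=
    256 * total G * (8 * K * n%:R ^+ 3 * eps).
  apply: (@le_trans _ _ (256 * total G * quad (kerr P Y K))); last first.
    exact: (ler_wpM2l c256 quad_kerr).
  rewrite !quadZ; apply: le_quad => i l j k il jk.
  rewrite mulrCA [leRHS]mulrC; apply: ler_wpM2l; last by have [] := cavg _ _ _ _ il jk.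
  rewrite /kerr; have a0 q i' j' : 0 <= amom q i' j' by exact: amom_ge0.
  by repeat first [apply: addr_ge0 | apply: mulr_ge0 | exact: a0 | exact: K0 | exact: normr_ge0 | done].
have E4 : `|N2 * quad (fun i l j k => kappa P Y i l j k * Sd i l j k) -
    total df * quad (kappa P Y)| <= 480 * (K * eps) * total G * (4 * n%:R ^+ 3).
  rewrite !quadZ quadB; apply: (le_trans (ler_norm_quad _)).
  apply: (@le_trans _ _ (480 * (K * eps) * total G * quad (fun i l j k => `|kappa P Y i l j k|))).
    rewrite quadZ; apply: le_quad => i l j k il jk.
    rewrite (_ : _ - _ = kappa P Y i l j k * (N2 * Sd i l j k - total df)); last by ring.
    by rewrite normrM mulrC ler_wpM2r//; have [] := cavg _ _ _ _ il jk.
  exact: (ler_wpM2l c480 quad_abs_kappa).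
have U1 := swap_sum; rewrite -/U in U1.
have td : `|total df| <= total G by apply: total_dom => //; case: fdf.
rewrite quad_kappa in E4.
have /andP[m0 mn] := sum_mean_sqr.
have neps : 1 <= n%:R * eps.
  by have := ca_n_eps ca; rewrite -ler_pdivrMl ?mulr1//; lra.
exact: stein_arith E1 E1' E4 U1 td m0 mn TG0 nR2 neps K1 eps0.
Qed.

End stein_bound.

(** * Gaussian bound on the moment generating function *)

Section moment_generating.
Context d (T : measurableType d) (R : realType) (P : probability T R).
Variables (n : nat) (Y : 'I_n -> 'I_n -> T -> R) (H K eps : R).
Hypothesis ca : comb_array P Y H K eps.

Local Notation total := (total P Y).

Lemma sum_crossE (G f df : R -> R) (s : 'S_n) : weight H G -> stein_test G f df ->
  P.-integrable setT (EFin \o (fun t => psum Y s finset.setT t * f (psum Y s finset.setT t))) /\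
  \sum_i crossE P Y f s i = \int[P]_t (psum Y s finset.setT t * f (psum Y s finset.setT t)).
Proof.
move=> wG fdf; have h i := crossE_integrable ca wG fdf s i.
pose F (r : seq 'I_n) t := \sum_(i <- r) Y i (s i) t * f (psum Y s finset.setT t).
have hF (r : seq 'I_n) : P.-integrable setT (EFin \o F r) /\
    \sum_(i <- r) crossE P Y f s i = \int[P]_t F r t.
  elim: r => [|i r [IH1 IH2]].
    have -> : F [::] = fun=> 0 by apply/funext => t; rewrite /F big_nil.
    by rewrite big_nil Rintegral_cstP; split => //; exact: integrable_cstR.
  have -> : F (i :: r) = fun t => Y i (s i) t * f (psum Y s finset.setT t) + F r t.
    by apply/funext => t; rewrite /F big_cons.
  rewrite big_cons IH2; split; first exact: integrableRD.
  by rewrite RintegralD.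
have -> : (fun t => psum Y s finset.setT t * f (psum Y s finset.setT t)) =
    F (index_enum (fintype_ordinal__canonical__fintype_Finite n)).
  apply/funext => t; rewrite /F {1}/psum mulr_suml.
  by apply: eq_bigl => i; rewrite inE.
by have [h1 h2] := hF (index_enum (fintype_ordinal__canonical__fintype_Finite n)); split.
Qed.

Definition mgf (h : R) := total (fun w => expR (h * w)).

Lemma is_derive_expRM (h x : R) : is_derive x 1 (fun w => expR (h * w)) (h * expR (h * x)).
Proof.
have h1 : is_derive x 1 (fun w : R => h * w) h.
  by have := @is_deriveZ _ _ _ (id : R -> R) h x 1 1 _; rewrite /GRing.scale/= mulr1; apply.
rewrite mulrC.
exact: (@is_derive1_comp R (@expR R) (fun w => h * w) x (expR (h * x)) h).
Qed.

Lemma measurable_expRM (h : R) : measurable_fun [set: R] (fun w => expR (h * w)).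
Proof. by apply: measurableT_comp => //; exact: measurable_funM. Qed.

Lemma weight_exp c h : 0 <= c -> 0 <= h <= H -> weight H (fun w => c * expR (h * w)).
Proof.
move=> c0 /andP[h0 hH]; split.
- by apply: measurable_funM => //; exact: measurable_expRM.
- by move=> w; rewrite mulr_ge0// expR_ge0.
- by move=> x y xy; rewrite ler_wpM2l// ler_expR ler_wpM2l.
- move=> w x x0; rewrite mulrCA ler_wpM2l// mulrDr expRD mulrC ler_wpM2r ?expR_ge0//.
  by rewrite ler_expR ler_wpM2r.
Qed.

Lemma expR_lip (h x y : R) : 0 <= h ->
  `|expR (h * x) - expR (h * y)| <= `|x - y| * (h * expR (h * Num.max x y)).
Proof.
move=> h0; suff main a b : a < b ->
    `|expR (h * b) - expR (h * a)| <= `|b - a| * (h * expR (h * b)).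
  have [xy|yx|->] := ltgtP x y.
  - by rewrite distrC (distrC x); exact: main.
  - exact: main.
  - by rewrite !subrr normr0 mul0r.
move=> ab.
have cf : {within `[a, b], continuous (fun w => expR (h * w))}.
  apply: continuous_subspaceT => z.
  by apply: differentiable_continuous; apply/derivable1_diffP; case: (is_derive_expRM h z).
have [c] := MVT ab (fun z _ => is_derive_expRM h z) cf.
rewrite in_itv/= => /andP[ac cb] ->.
rewrite normrM mulrC ler_wpM2l// ger0_norm ?mulr_ge0 ?expR_ge0//.
by rewrite ler_wpM2l// ler_expR ler_wpM2l// ltW.
Qed.

(** (1 + h)^2 dominates 1, h and h^2, the sizes of f, f' and f'' relative to exp(h w). *)
Lemma stein_test_exp (h : R) : 0 <= h ->
  stein_test (fun w => (1 + h) ^+ 2 * expR (h * w)) (fun w => expR (h * w))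
    (fun w => h * expR (h * w)).
Proof.
move=> h0.
have h1 : 1 <= (1 + h) ^+ 2 by rewrite exprn_ege1// lerDl.
have h2 : h <= (1 + h) ^+ 2 by rewrite sqrrD expr1n mul1r mulr2n; have := sqr_ge0 h; lra.
have h3 : h * h <= (1 + h) ^+ 2 by rewrite sqrrD expr1n mul1r expr2 mulr2n; lra.
split.
- by move=> x; exact: is_derive_expRM.
- by move=> w; rewrite ger0_norm ?expR_ge0// ler_peMl ?expR_ge0.
- by move=> w; rewrite ger0_norm ?mulr_ge0 ?expR_ge0// ler_wpM2r ?expR_ge0.
- move=> x y; rewrite -mulrBr normrM (ger0_norm h0) mulrC.
  apply: (le_trans (ler_wpM2r h0 (expR_lip x y h0))).
  rewrite -mulrA ler_wpM2l// mulrAC ler_wpM2r ?expR_ge0//.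
Qed.

(** The error in the logarithmic derivative of [mgf]; not to be confused with the ramp parameter of
    the same name. *)
Let eta : R := 16000 * K * eps * (1 + H) ^+ 2.

Lemma tame_exp (h : R) : 0 <= h <= H -> tame H (fun w => expR (h * w)).
Proof.
move=> hH; have := weight_tame (weight_exp ler01 hH).
by under eq_fun do rewrite mul1r.
Qed.

Lemma mgf_ge0 h : 0 <= mgf h.
Proof. by apply: sumr_ge0 => s _; apply: Rintegral_ge0 => t _; exact: expR_ge0. Qed.

(* Discrete form of [(ln mgf)' <= h + eta], from [exp (- x) >= 1 - x]. *)
Lemma mgf_step h del : 0 <= del -> del <= h -> h <= H ->
  (1 - del * (h + eta)) * mgf h <= mgf (h - del).
Proof.
move=> d0 dh hH.
have h0 : 0 <= h by exact: le_trans dh.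
have K0 : 0 <= K := le_trans ler01 (ca_K1 ca).
have e0 := eps_ge0 ca.
have hh : 0 <= h <= H by rewrite h0.
have hd : 0 <= h - del <= H by rewrite subr_ge0 dh/=; lra.
have c0 : 0 <= (1 + h) ^+ 2 by exact: sqr_ge0.
have a1 : (1 + h) ^+ 2 <= (1 + H) ^+ 2.
  by rewrite ler_pXn2r ?nnegrE//; lra.
have wG := weight_exp c0 hh.
have fdf := stein_test_exp h0.
have := stein_bound ca wG fdf.
set Z := \sum_(s : 'S_n) _.
have tZ c : total (fun w => c * expR (h * w)) = c * mgf h.
  rewrite /mgf /total mulr_sumr; apply: eq_bigr => s _.
  by rewrite /EW RintegralZl//; exact: (EW_integrable ca s finset.setT (tame_exp hh)).
rewrite !tZ ler_norml => /andP[_ hZ].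
have {}hZ : Z <= (h + eta) * mgf h.
  have : 16000 * K * eps * ((1 + h) ^+ 2 * mgf h) <= eta * mgf h.
    have a0 : 0 <= 16000 * K * eps := mulr_ge0 (mulr_ge0 (ler0n _ _) K0) e0.
    by rewrite /eta mulrA; exact: (ler_wpM2r (mgf_ge0 h) (ler_wpM2l a0 a1)).
  by move=> he; rewrite mulrDl -lerBlDl; exact: le_trans hZ he.
apply: (@le_trans _ _ (mgf h - del * Z)).
  rewrite mulrBl mul1r lerD2l lerN2 -mulrA.
  exact: (ler_wpM2l d0 hZ).
rewrite /mgf /total /Z mulr_sumr -sumrB; apply: ler_sum => s _.
have [i1 ->] := sum_crossE s wG fdf.
have i2 := EW_integrable ca s finset.setT (tame_exp hh).
have i3 := EW_integrable ca s finset.setT (tame_exp hd).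
have i1' := integrableRZ del i1.
rewrite /EW -RintegralZl// -RintegralB//.
apply: le_Rintegral => //; first exact: integrableRB.
move=> t _; set w := psum Y s finset.setT t.
rewrite mulrBl expRD mulrA -[X in X - _]mul1r -mulrBl mulrC ler_wpM2l ?expR_ge0//.
by have := expR_ge1Dx (- (del * w)); rewrite mulrC.
Qed.

Lemma mgf0 : mgf 0 = (n`!)%:R.
Proof.
rewrite /mgf /total.
under eq_bigr => s _ do (rewrite /EW; under eq_Rintegral do rewrite mul0r expR0).
under eq_bigr => s _ do rewrite Rintegral_cstP.
by rewrite sumr_const card_Sn.
Qed.

(** 1 / (1 - x) = 1 + x / (1 - x) <= exp(x / (1 - x)), and x / (1 - x) <= x + 2 x^2 for x <= 1/2. It
    inverts one step of [mgf_step] with an error of second order. *)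
Lemma inv_oneB_le_expR (x : R) : 0 <= x <= 1/2 -> 1 <= (1 - x) * expR (x + 2 * x ^+ 2).
Proof.
move=> /andP[x0 x1].
have h : 1 + x / (1 - x) <= expR (x / (1 - x)) by exact: expR_ge1Dx.
have y0 : 0 < 1 - x by lra.
have h2 : x / (1 - x) <= x + 2 * x ^+ 2.
  rewrite ler_pdivrMr//.
  have : 0 <= x ^+ 2 * (1 - 2 * x) by rewrite mulr_ge0 ?sqr_ge0//; lra.
  by lra.
have h3 : expR (x / (1 - x)) <= expR (x + 2 * x ^+ 2) by rewrite ler_expR.
have := ler_wpM2l (ltW y0) (le_trans h h3).
by rewrite mulrDr mulr1 mulrCA divff ?gt_eqF// mulr1; lra.
Qed.

(** A discrete Gronwall argument from 0 to h, which avoids differentiating under the integral. In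
    the exponent, the drift error h eta and the accumulated discretisation error are each at most 1,
    whence exp(2). *)
Lemma mgf_le (h : R) : 0 <= h <= H -> H * eta <= 1 ->
  mgf h <= (n`!)%:R * (expR 2 * expR (h ^+ 2 / 2)).
Proof.
move=> /andP[h0 hH] He.
have K0 : 0 <= K := le_trans ler01 (ca_K1 ca).
have e0 := eps_ge0 ca.
have eta0 : 0 <= eta := mulr_ge0 (mulr_ge0 (mulr_ge0 (ler0n _ _) K0) e0) (sqr_ge0 _).
have mstep := @mgf_step.
clearbody eta.
have he : 0 <= h + eta := addr_ge0 h0 eta0.
have p1 : 0 <= h * (2 * (h + eta)) := mulr_ge0 h0 (mulr_ge0 (ler0n _ _) he).
have p2 : 0 <= h * (h / 2 + 2 * h * (h + eta) ^+ 2).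
  apply: (mulr_ge0 h0); apply: addr_ge0; first by apply: divr_ge0.
  exact: (mulr_ge0 (mulr_ge0 (ler0n _ _) h0) (sqr_ge0 _)).
(* The number of steps exceeds [C]; its second term forces X <= 1/2, as [inv_oneB_le_expR] requires,
   and its third keeps the accumulated quadratic error below 1. *)
pose C := 1 + h * (2 * (h + eta)) + h * (h / 2 + 2 * h * (h + eta) ^+ 2).
have C1 : 0 < C by rewrite /C; lra.
pose N := (Num.truncn C).+1.
have CN : C <= N%:R by apply: ltW; exact: truncnS_gt.
have N0 : 0 < N%:R :> R by rewrite ltr0n.
clearbody N.
pose del := h / N%:R.
have del0 : 0 <= del by rewrite divr_ge0// ltW.
have delC : del * (2 * (h + eta)) <= 1 /\
    del * (h / 2 + 2 * h * (h + eta) ^+ 2) <= 1.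
  have delE a : del * a = (h * a) / N%:R by rewrite /del mulrAC.
  by rewrite !delE !ler_pdivrMr// !mul1r; split; apply: le_trans CN; rewrite /C; lra.
have [d1 d2] := delC.
pose X := del * (h + eta).
have X12 : X <= 1/2 by rewrite /X; lra.
have X0 : 0 <= X := mulr_ge0 del0 he.
(* The exponents form a Riemann sum at right end points, which exceeds (q del)^2 / 2 by del^2 / 2 at
   each step. *)
have step q : (q <= N)%N -> mgf (q%:R * del) <= (n`!)%:R *
    expR ((q%:R * del) ^+ 2 / 2 + q%:R * (del ^+ 2 / 2 + del * eta + 2 * X ^+ 2)).
  elim: q => [|q IH] qN.
    by rewrite !mul0r expr0n/= mul0r addr0 expR0 mulr1 mgf0.
  have {}IH := IH (ltnW qN).
  have qh : q.+1%:R * del <= h.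
    by rewrite /del mulrA ler_pdivrMr// mulrC ler_wpM2l// ler_nat.
  have qd : del <= q.+1%:R * del by rewrite ler_peMl// ler1n.
  have := mstep _ _ del0 qd (le_trans qh hH).
  have -> : q.+1%:R * del - del = q%:R * del by rewrite -natr1; ring.
  set x := del * (q.+1%:R * del + eta) => hs.
  have x0 : 0 <= x by rewrite mulr_ge0// addr_ge0// mulr_ge0.
  have xX : x <= X by rewrite ler_wpM2l// lerD2r.
  have := @inv_oneB_le_expR x; rewrite x0 (le_trans xX X12) => /(_ isT) h1.
  have E0 := expR_gt0 (x + 2 * x ^+ 2).
  have m0 := mgf_ge0 (q.+1%:R * del).
  move: (mgf (q.+1%:R * del)) (mgf (q%:R * del)) m0 hs IH => m m' m0 hs IH.
  have h2 : m <= expR (x + 2 * x ^+ 2) * m'.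
    apply: (le_trans _ (ler_wpM2l (ltW E0) hs)).
    have -> : expR (x + 2 * x ^+ 2) * ((1 - x) * m) =
      ((1 - x) * expR (x + 2 * x ^+ 2)) * m by ring.
    by rewrite -[leLHS]mul1r; exact: ler_wpM2r.
  apply: (le_trans h2); apply: (le_trans (ler_wpM2l (ltW E0) IH)).
  rewrite mulrCA ler_wpM2l// -expRD ler_expR.
  have : x ^+ 2 <= X ^+ 2 by rewrite ler_pXn2r.
  rewrite /x -natr1; move: (X ^+ 2) (_ ^+ 2) => a b.
  by move=> ab; lra.
have := step N (leqnn _).
have -> : N%:R * del = h by rewrite /del mulrC divfK// gt_eqF.
move=> /le_trans; apply; rewrite ler_wpM2l// -expRD ler_expR addrC lerD2r.
have -> : N%:R * (del ^+ 2 / 2 + del * eta + 2 * X ^+ 2) =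
   (N%:R * del) * (del / 2 + eta + 2 * del * (h + eta) ^+ 2) by rewrite /X; field.
have -> : N%:R * del = h by rewrite /del mulrC divfK// gt_eqF.
have := ler_wpM2r eta0 hH.
by lra.
Qed.

End moment_generating.

(** * Gaussian tails *)

Section gaussian.
Variable R : realType.
Local Notation mu := (@lebesgue_measure R).

Definition gpdf : R -> R := normal_pdf 0 1.

Lemma gpdfE (x : R) : gpdf x = normal_peak 1 * expR (- (x ^+ 2 / 2)).
Proof.
rewrite /gpdf normal_pdfE ?oner_neq0// /normal_fun subr0 expr1n -mulr_natr mul1r.
by rewrite mulNr.
Qed.

Lemma gpdf_gt0 x : 0 < gpdf x.
Proof. by rewrite gpdfE mulr_gt0 ?expR_gt0// normal_peak_gt0// oner_neq0. Qed.

Lemma is_derive_gpdf (x : R) : is_derive x 1 gpdf (- x * gpdf x).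
Proof.
rewrite (_ : gpdf = fun x => normal_peak 1 * expR (- (x ^+ 2 / 2))); last first.
  by apply/funext => y; rewrite gpdfE.
have h1 : is_derive x 1 (fun w : R => - (w ^+ 2 / 2)) (- x).
  by apply: is_derive_eq; rewrite /GRing.scale/=; field.
have h2 : is_derive x 1 (expR \o (fun w : R => - (w ^+ 2 / 2))) (expR (- (x ^+ 2 / 2)) * - x).
  exact: is_derive1_comp.
have h3 : is_derive x 1 (normal_peak 1 \*: (expR \o (fun w : R => - (w ^+ 2 / 2))))
    (normal_peak 1 *: (expR (- (x ^+ 2 / 2)) * - x)) by exact: is_deriveZ.
by rewrite (_ : - x * _ = normal_peak 1 *: (expR (- (x ^+ 2 / 2)) * - x))// /GRing.scale/=; ring.
Qed.

Lemma continuous_gpdf : continuous gpdf.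
Proof. by apply: continuous_normal_pdf; rewrite oner_neq0. Qed.

Lemma integrable_gpdf (A : set R) : measurable A -> mu.-integrable A (EFin \o gpdf).
Proof.
move=> mA; apply: (@integrableS _ _ _ mu setT) => //.
exact: integrable_normal_pdf.
Qed.

Lemma derive_primitive (g : R -> R) : continuous g -> mu.-integrable setT (EFin \o g) ->
  forall x : R, is_derive x 1 (fun w => \int[mu]_(t in `]-oo, w]) g t) (g x).
Proof.
move=> cg ig x.
have iu : mu.-integrable [set` Interval (BInfty _ true) (BRight (x + 1))] (EFin \o g).
  by apply: (@integrableS _ _ _ mu setT).
have xx1 : x < x + 1 by rewrite ltrDl.
have /= h := @continuous_FTC1 R g (BInfty _ true) x (x + 1) xx1 iu.
have [|d1 d2] := h _ (cg x); first exact: ltNyr.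
by apply: DeriveDef; [exact: d1|rewrite -derive1E; exact: d2].
Qed.

Lemma PhiE (x : R) : Phi x = \int[mu]_(t in `]-oo, x]) gpdf t.
Proof. by []. Qed.

Lemma is_derive_Phi (x : R) : is_derive x 1 (@Phi R) (gpdf x).
Proof.
exact: (derive_primitive continuous_gpdf (integrable_gpdf measurableT)).
Qed.

Lemma le_derive_tail (D D' : R -> R) (a : R) :
  (forall x, a <= x -> is_derive x 1 D (D' x)) -> (forall x, a <= x -> D' x <= 0) ->
  (forall x y, a <= x -> x <= y -> D y <= D x).
Proof.
move=> hD hD' x y ax; rewrite le_eqVlt => /predU1P[->//|xy].
have hxy z : x <= z -> is_derive z 1 D (D' z) by move=> xz; apply: hD; exact: le_trans xz.
have cD : {within `[x, y], continuous D}.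
  apply: derivable_within_continuous => z; rewrite in_itv/= => /andP[xz _].
  by case: (hxy z xz).
have hin z : z \in `]x, y[ -> is_derive z 1 D (D' z).
  by rewrite in_itv/= => /andP[xz _]; apply: hxy; exact: ltW.
have [c] := MVT xy hin cD.
rewrite in_itv/= => /andP[xc cy] e.
rewrite -subr_le0 e mulr_le0_ge0//; last by rewrite subr_ge0 ltW.
by apply: hD'; rewrite (le_trans ax)// ltW.
Qed.

Definition vanish (Q : R -> R) := forall e, 0 < e -> exists A, forall y, A <= y -> `|Q y| <= e.

(** A function that decreases to 0 at infinity is nonnegative; every Gaussian tail inequality below
    is proved by applying this to a difference. *)
Lemma tail_ge0 (D D' : R -> R) (a : R) :
  (forall x, a <= x -> is_derive x 1 D (D' x)) -> (forall x, a <= x -> D' x <= 0) ->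
  vanish D -> forall x, a <= x -> 0 <= D x.
Proof.
move=> hD hD' vD x ax; apply/ler_addgt0Pr => e e0.
have [A hA] := vD e e0.
have h1 := le_derive_tail hD hD' ax (_ : x <= Num.max A x).
have := hA (Num.max A x); rewrite le_max lexx/= => /(_ isT).
rewrite ler_norml => /andP[+ _].
by have := h1 ltac:(by rewrite le_max lexx orbT); lra.
Qed.

Lemma cvg_vanish (Q : R -> R) : Q x @[x --> +oo] --> (0 : R) -> vanish Q.
Proof.
move=> /cvgrPdist_le h e e0; have [A [_ hA]] := h _ e0.
exists (A + 1) => y Ay; have := hA y; rewrite sub0r normrN; apply.
by rewrite (lt_le_trans _ Ay)// ltrDl.
Qed.

(** Viewing [Phi] as the distribution function of the identity under the normal law supplies its
    limits at both infinities. *)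
Let idR : measurableTypeR R -> R := idfun.
Let idRV : {RV (@normal_prob R 0 1) >-> R} := mfun_of (@measurable_id _ _ setT : measurable_fun setT idR).

Let PhiEFin (x : R) : (Phi x)%:E = cdf idRV x.
Proof. by rewrite /Phi fineK//; exact: fin_num_measure. Qed.

Let PhiE_cdf : @Phi R = fine \o cdf idRV.
Proof. by apply/funext => x; rewrite -[RHS]/(fine (cdf idRV x)) -PhiEFin. Qed.

Lemma vanish_oneB_Phi : vanish (fun x => 1 - Phi x).
Proof.
apply: cvg_vanish; rewrite -(subrr (1 : R)); apply: cvgB; first exact: cvg_cst.
by rewrite PhiE_cdf; have /fine_cvgP[] := cvg_cdfy1 idRV.
Qed.

Lemma vanish_Phi_opp : vanish (fun x => Phi (- x)).
Proof.
have h : Phi x @[x --> -oo] --> (0 : R).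
  by rewrite PhiE_cdf; have /fine_cvgP[] := cvg_cdfNy0 idRV.
by apply: cvg_vanish; move/cvgNy_compNP : h.
Qed.

Lemma is_derive_oneB_Phi (x : R) : is_derive x 1 (fun x => 1 - Phi x) (- gpdf x).
Proof.
have h := is_derive_Phi x.
have h0 : is_derive x 1 (fun=> 1 : R) (0 : R) by exact: is_derive_cst.
by rewrite -[- _]sub0r; exact: (is_deriveB h0 h).
Qed.

Lemma is_derive_opp_comp (F : R -> R) (x a : R) : is_derive (- x) 1 F a ->
  is_derive x 1 (fun w => F (- w)) (- a).
Proof.
move=> h.
have h1 : is_derive x 1 (fun w : R => - w) (- 1) by exact: is_deriveN.
by have := @is_derive1_comp R F (fun w => - w) x a (- 1) h h1; rewrite mulrN1.
Qed.

Lemma gpdf_opp (x : R) : gpdf (- x) = gpdf x.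
Proof. by rewrite !gpdfE sqrrN. Qed.

Lemma is_derive_Phi_opp (x : R) : is_derive x 1 (fun x => Phi (- x)) (- gpdf x).
Proof. by rewrite -(gpdf_opp x); apply: is_derive_opp_comp; exact: is_derive_Phi. Qed.

Lemma gpdf_le_inv (x : R) : 0 < x -> gpdf x <= normal_peak 1 * (2 / x).
Proof.
move=> x0; rewrite gpdfE ler_wpM2l ?normal_peak_ge0//.
rewrite expRN -[leRHS]invrK lef_pV2 ?posrE ?expR_gt0 ?invr_gt0 ?divr_gt0//.
apply: le_trans (expR_ge1Dx _).
rewrite invf_div ler_pdivrMr//.
have := sqr_ge0 (x - 1); rewrite sqrrB expr1n mulr1 mulr2n; lra.
Qed.

Lemma vanish_dom (Q : R -> R) c : (forall x, 1 <= x -> `|Q x| <= c * gpdf x) -> vanish Q.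
Proof.
move=> h e e0.
pose C := (`|c| + 1) * normal_peak 1 * 2.
have pk := normal_peak_gt0 (oner_neq0 R).
have C0 : 0 < C by rewrite !mulr_gt0// ltr_wpDl.
exists (Num.max 1 (C / e)) => y; rewrite ge_max => /andP[y1 yC].
have y0 : 0 < y by exact: lt_le_trans y1.
apply: (le_trans (h y y1)).
apply: (@le_trans _ _ ((`|c| + 1) * gpdf y)).
  apply: (ler_wpM2r (ltW (gpdf_gt0 y))); apply: (le_trans (ler_norm c)).
  by rewrite lerDl.
apply: (le_trans (ler_wpM2l _ (gpdf_le_inv y0))); first by rewrite addr_ge0.
rewrite mulrA mulrA -/C ler_pdivrMr// mulrC -ler_pdivrMr//.
Qed.

Lemma vanishB (Q1 Q2 : R -> R) : vanish Q1 -> vanish Q2 -> vanish (fun x => Q1 x - Q2 x).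
Proof.
move=> h1 h2 e e0.
have e2 : 0 < e / 2 by rewrite divr_gt0.
have [A1 k1] := h1 _ e2; have [A2 k2] := h2 _ e2.
exists (Num.max A1 A2) => y; rewrite ge_max => /andP[y1 y2].
apply: (le_trans (ler_normB _ _)); have := k1 _ y1; have := k2 _ y2; lra.
Qed.

Section mills.
Variable Q : R -> R.
Hypothesis dQ : forall x : R, is_derive x 1 Q (- gpdf x).
Hypothesis vQ : vanish Q.

(** [Q] is abstract because Mills' inequalities serve twice: for 1 - Phi(x) on the right, and for
    Phi(- x) when bounding the Stein solution far to the left. *)
Lemma tail_Q_ge0 x : 0 <= Q x.
Proof.
apply: (tail_ge0 (D := Q) (D' := fun x => - gpdf x) (a := x)) => //.
by move=> y _; rewrite oppr_le0 ltW// gpdf_gt0.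
Qed.

(** The difference gpdf(y) / y - Q(y) has derivative - gpdf(y) / y^2. *)
Lemma mills_upper x : 0 < x -> x * Q x <= gpdf x.
Proof.
move=> x0.
suff : 0 <= gpdf x * x^-1 - Q x.
  by rewrite subr_ge0 ler_pdivlMr// mulrC.
pose D y := gpdf y * y^-1 - Q y.
have dD y : x <= y -> is_derive y 1 D (- gpdf y / y ^+ 2).
  move=> xy; have y0 : 0 < y by exact: lt_le_trans xy.
  have dp := is_derive_gpdf y.
  have di : is_derive y 1 (fun w : R => w^-1) (- y ^- 2).
    have h : is_derive y 1 (fun w : R => w) 1 by exact: is_derive_id.
    by have := @is_deriveV _ (fun w : R => w) y 1 1 (lt0r_neq0 y0) h; rewrite /GRing.scale/= mulr1; apply.
  have := is_deriveB (is_deriveM dp di) (dQ y).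
  rewrite (_ : _ - _ = - gpdf y / y ^+ 2)//.
  by rewrite /GRing.scale/=; field; rewrite gt_eqF.
apply: (tail_ge0 dD) => //.
- by move=> y xy; rewrite mulNr oppr_le0 divr_ge0 ?sqr_ge0// ltW// gpdf_gt0.
- apply: vanishB => //; apply: (@vanish_dom _ 1) => y y1.
  have y0 : 0 < y by exact: lt_le_trans y1.
  have g0 := ltW (gpdf_gt0 y).
  rewrite mul1r ger0_norm; last by rewrite divr_ge0// ltW.
  by rewrite ler_pdivrMr// ler_peMr.
Qed.

(** The difference Q(y) - y gpdf(y) / (1 + y^2) has derivative - 2 gpdf(y) / (1 + y^2)^2,
    nonpositive everywhere, so no sign condition on [x] arises. *)
Lemma mills_lower x : x * gpdf x <= (1 + x ^+ 2) * Q x.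
Proof.
have s0 y : 0 < 1 + y ^+ 2 :> R by rewrite ltr_pwDl// sqr_ge0.
suff : 0 <= Q x - gpdf x * (x * (1 + x ^+ 2)^-1).
  by rewrite subr_ge0 mulrA ler_pdivrMr// mulrC [leRHS]mulrC.
pose D y := Q y - gpdf y * (y * (1 + y ^+ 2)^-1).
have dD y : x <= y -> is_derive y 1 D (- 2 * gpdf y / (1 + y ^+ 2) ^+ 2).
  move=> _.
  have dp := is_derive_gpdf y.
  have ds : is_derive y 1 (fun w : R => 1 + w ^+ 2) (2 * y).
    by apply: is_derive_eq; rewrite /GRing.scale/=; ring.
  have h : is_derive y 1 (fun w : R => w) 1 by exact: is_derive_id.
  have di := @is_deriveV _ (fun w : R => 1 + w ^+ 2) y _ _ (lt0r_neq0 (s0 y)) ds.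
  have := is_deriveB (dQ y) (is_deriveM dp (is_deriveM h di)).
  rewrite (_ : _ - _ = - 2 * gpdf y / (1 + y ^+ 2) ^+ 2)//.
  by rewrite /GRing.scale/= fctE; field; rewrite gt_eqF.
apply: (tail_ge0 dD) => //.
- move=> y _; rewrite mulNr mulNr oppr_le0 divr_ge0 ?sqr_ge0// mulr_ge0//.
  by rewrite ltW// gpdf_gt0.
- apply: vanishB => //; apply: (@vanish_dom _ 1) => y y1.
  have y0 : 0 < y by exact: lt_le_trans y1.
  have g0 := ltW (gpdf_gt0 y).
  rewrite mul1r ger0_norm; last by rewrite mulr_ge0// divr_ge0// ltW.
  rewrite ler_piMr// ler_pdivrMr// mul1r.
  by have := sqr_ge0 (y - 1); rewrite sqrrB expr1n mulr1 mulr2n; lra.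
Qed.

End mills.
End gaussian.

(** * The Stein equation for a ramp *)

Section stein_solution.
Variable R : realType.
Local Notation mu := (@lebesgue_measure R).
Local Notation gpdf := (@gpdf R).
Local Notation Phi := (@Phi R).
Variables (a u eta : R).
Hypotheses (a1 : 1 <= a) (au : a <= u) (eta01 : 0 < eta <= 1).

Let u1 : 1 <= u := le_trans a1 au.
Let u0 : 0 < u := lt_le_trans ltr01 u1.
Let eta0 : 0 < eta. Proof. by have /andP[] := eta01. Qed.
Let eta1 : eta <= 1. Proof. by have /andP[] := eta01. Qed.

Definition ramp w := Num.min (Num.max ((w - a) * (u / eta)) 0) 1.

Let ue0 : 0 < u / eta. Proof. by rewrite divr_gt0. Qed.

Lemma ramp_ge0 w : 0 <= ramp w.
Proof. by rewrite /ramp le_min ler01 andbT le_max lexx orbT. Qed.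

Lemma ramp_le1 w : ramp w <= 1.
Proof. by rewrite /ramp ge_min lexx orbT. Qed.

Lemma ramp_eq0 w : w <= a -> ramp w = 0.
Proof.
move=> wa; rewrite /ramp max_r; first by rewrite min_l.
by rewrite mulr_le0_ge0// ?subr_le0// ltW.
Qed.

Lemma ramp_eq1 w : a + eta / u <= w -> ramp w = 1.
Proof.
move=> wa; have h : 1 <= (w - a) * (u / eta).
  by rewrite -ler_pdivrMr// div1r invf_div lerBrDl.
by rewrite /ramp min_r// le_max h.
Qed.

Lemma ramp_lip x y : `|ramp x - ramp y| <= `|x - y| * (u / eta).
Proof.
suff main v w : v <= w -> 0 <= ramp w - ramp v <= (w - v) * (u / eta).
  have [xy|/ltW yx] := leP x y.
    have /andP[h1 h2] := main _ _ xy.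
    by rewrite distrC (distrC x) ger0_norm// ger0_norm ?subr_ge0.
  have /andP[h1 h2] := main _ _ yx.
  by rewrite ger0_norm// ger0_norm ?subr_ge0.
move=> vw; have h : (v - a) * (u / eta) <= (w - a) * (u / eta).
  by apply: (ler_wpM2r (ltW ue0)); rewrite lerD2r.
have e : (w - v) * (u / eta) = (w - a) * (u / eta) - (v - a) * (u / eta) by ring.
rewrite e /ramp; move: (_ * _) (_ * _) h => p q qp.
rewrite /Num.max /Num.min.
by case: (ltP p 0) => ?; case: (ltP q 0) => ?; apply/andP; split; repeat case: ltP => ?; lra.
Qed.

Lemma continuous_ramp : continuous ramp.
Proof.
move=> x; apply/cvgrPdist_le => e e0.
have e' : 0 < e / (u / eta) by rewrite divr_gt0.
have nd : \forall y \near x, `|x - y| <= e / (u / eta).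
  by exact: (@cvgr_dist_le _ _ _ (nbhs x) _ id).
near=> y; apply: (le_trans (ramp_lip x y)).
by rewrite -ler_pdivlMr//; near: y.
Unshelve. all: by end_near. Qed.

Let g w := ramp w * gpdf w.

Let cg : continuous g.
Proof. by move=> x; apply: cvgM; [exact: continuous_ramp|exact: continuous_gpdf]. Qed.

Let ig (A : set R) : measurable A -> mu.-integrable A (EFin \o g).
Proof.
move=> mA; apply: le_integrable (integrable_gpdf mA) => //.
  by apply/measurable_EFinP; apply: measurable_funTS; exact: continuous_measurable_fun.
move=> x _ /=; rewrite lee_fin normrM ler_piMl// ger0_norm ?ramp_ge0//.
exact: ramp_le1.
Qed.

Definition ramp_prim w := \int[mu]_(t in `]-oo, w]) g t.
Definition ramp_mean := \int[mu]_t g t.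
Local Notation N := ramp_mean.

Lemma is_derive_ramp_prim (x : R) : is_derive x 1 ramp_prim (ramp x * gpdf x).
Proof. exact: (derive_primitive cg (ig measurableT)). Qed.

Lemma ramp_prim_eq0 w : w <= a -> ramp_prim w = 0.
Proof.
move=> wa; rewrite /ramp_prim (eq_Rintegral _ (g := fun=> 0)).
  by rewrite Rintegral_cst// mul0r.
move=> x; rewrite inE/= in_itv/= => xw.
by rewrite /g ramp_eq0 ?mul0r// (le_trans xw).
Qed.

Let split_integral (h : R -> R) w : mu.-integrable setT (EFin \o h) ->
  \int[mu]_t h t = \int[mu]_(t in `]-oo, w]) h t + \int[mu]_(t in `]w, +oo[) h t.
Proof.
move=> ih.
have e : setT = `]-oo, w] `|` `]w, +oo[ :> set R.
  apply/seteqP; split => x //= _; rewrite !in_itv/= andbT.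
  by case: (leP x w) => _; [left|right].
rewrite [in LHS]e Rintegral_setU//; first by rewrite -e.
apply/disj_setPLR => x /=; rewrite !in_itv/= andbT => h1 /=.
by apply/negP; rewrite -leNgt.
Qed.

(** The difference is the integral of the ramp against the density over the tail beyond [w], and the
    ramp lies between 0 and 1. *)
Lemma ramp_mean_sub w : 0 <= N - ramp_prim w <= 1 - Phi w.
Proof.
have pT : \int[mu]_t gpdf t = 1 by rewrite /Rintegral integral_normal_pdf.
have -> : N - ramp_prim w = \int[mu]_(t in `]w, +oo[) g t.
  by rewrite /N (split_integral w (ig measurableT)) /ramp_prim; ring.
have -> : 1 - Phi w = \int[mu]_(t in `]w, +oo[) gpdf t.
  by rewrite -pT (split_integral w (integrable_gpdf measurableT)) PhiE; ring.
apply/andP; split.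
  by apply: Rintegral_ge0 => x _; rewrite mulr_ge0 ?ramp_ge0// ltW// gpdf_gt0.
apply: le_Rintegral => //; [exact: ig|exact: integrable_gpdf|].
by move=> x _; rewrite ler_piMl ?ramp_le1// ltW// gpdf_gt0.
Qed.

Lemma ramp_mean_ge0 : 0 <= N.
Proof. by have /andP[h _] := ramp_mean_sub a; rewrite ramp_prim_eq0// subr0 in h. Qed.

Lemma ramp_mean_upper : N <= 1 - Phi a.
Proof. by have /andP[_ h] := ramp_mean_sub a; rewrite ramp_prim_eq0// subr0 in h. Qed.

Let Q1 (x : R) : 0 <= 1 - Phi x := tail_Q_ge0 (@is_derive_oneB_Phi R) (@vanish_oneB_Phi R) x.
Let Q2 (x : R) : 0 <= Phi (- x) := tail_Q_ge0 (@is_derive_Phi_opp R) (@vanish_Phi_opp R) x.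

Lemma Phi_ge0 x : 0 <= Phi x.
Proof. by have := Q2 (- x); rewrite opprK. Qed.

Lemma Phi_le1 x : Phi x <= 1.
Proof. by have := Q1 x; rewrite subr_ge0. Qed.

Lemma ramp_mean_le1 : N <= 1.
Proof. by apply: (le_trans ramp_mean_upper); rewrite gerBl Phi_ge0. Qed.

(** Beyond the end of the ramp both tails have the same derivative and both vanish at infinity. *)
Lemma ramp_mean_lower : 1 - Phi (a + eta / u) <= N.
Proof.
set b := a + eta / u.
have h : 0 <= (N - ramp_prim b) - (1 - Phi b).
  pose D x := (N - ramp_prim x) - (1 - Phi x).
  have dD x : b <= x -> is_derive x 1 D ((0 - ramp x * gpdf x) - (0 - gpdf x)).
    move=> _; have dN : is_derive x 1 (fun=> N) (0 : R) by exact: is_derive_cst.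
    have d1 : is_derive x 1 (fun=> 1 : R) (0 : R) by exact: is_derive_cst.
    exact: (is_deriveB (is_deriveB dN (is_derive_ramp_prim x)) (is_deriveB d1 (is_derive_Phi x))).
  apply: (tail_ge0 dD (a := b)) => //.
    by move=> x bx; rewrite ramp_eq1// mul1r subrr.
  apply: vanishB; last exact: vanish_oneB_Phi.
  move=> e e0; have [A hA] := @vanish_oneB_Phi R _ e0.
  exists A => y /hA; have /andP[h1 h2] := ramp_mean_sub y.
  by rewrite !ger0_norm//; apply: le_trans.
have := h; rewrite subr_ge0 => /le_trans; apply.
rewrite lerBlDr lerDl; apply: Rintegral_ge0 => x _.
by rewrite mulr_ge0 ?ramp_ge0// ltW// gpdf_gt0.
Qed.

(** The classical solution exp(w^2 / 2) times the integral of (ramp - N) exp(- t^2 / 2) up to [w].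
    Its derivative [stein_dsol] is defined as the right-hand side of the Stein equation, and
    [is_derive_stein_sol] justifies the name. *)
Definition stein_sol w := (ramp_prim w - N * Phi w) / gpdf w.
Definition stein_dsol w := w * stein_sol w + ramp w - N.
Local Notation f := stein_sol.
Local Notation df := stein_dsol.

Lemma is_derive_div_gpdf (F : R -> R) (x c : R) : is_derive x 1 F (c * gpdf x) ->
  is_derive x 1 (fun w => F w / gpdf w) (c + x * (F x / gpdf x)).
Proof.
move=> dF; have p0 := gpdf_gt0 x; have pn : gpdf x != 0 by rewrite gt_eqF.
have di := @is_deriveV _ gpdf x _ _ pn (is_derive_gpdf x).
have := is_deriveM dF di.
rewrite (_ : _ + _ = c + x * (F x / gpdf x))//.
by rewrite /GRing.scale/=; field.
Qed.

Lemma is_derive_stein_sol (x : R) : is_derive x 1 f (df x).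
Proof.
have dN : is_derive x 1 (fun w => N * Phi w) (N * gpdf x).
  have h := is_derive_Phi x.
  exact: (is_deriveZ N h).
have h := is_deriveB (is_derive_ramp_prim x) dN; rewrite -mulrBl in h.
have := is_derive_div_gpdf h.
rewrite (_ : _ + _ = df x)//.
rewrite /df -[in RHS]/(f x) -[X in _ + x * X]/(f x); ring.
Qed.

(** [stein_dsol] is w f(w) plus the ramp up to a constant, so its Lipschitz bound needs the
    derivative of w f(w). *)
Lemma is_derive_mul_stein_sol (x : R) : is_derive x 1 (fun w => w * f w) (f x + x * df x).
Proof.
have h1 : is_derive x 1 (fun w : R => w) 1 by exact: is_derive_id.
have := is_deriveM h1 (is_derive_stein_sol x).
by rewrite (_ : _ + _ = f x + x * df x)// /GRing.scale/=; ring.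
Qed.

(** The numerator is N (1 - Phi w) minus a tail integral, both between 0 and 1 - Phi w; Mills' upper
    inequality concludes. *)
Lemma stein_sol_tail w : 0 < w -> w * `|f w| <= 1.
Proof.
move=> w0; have p0 := gpdf_gt0 w.
have /andP[h1 h2] := ramp_mean_sub w.
have q := Q1 w; have N0 := ramp_mean_ge0; have N1 := ramp_mean_le1.
have h3 : `|ramp_prim w - N * Phi w| <= 1 - Phi w.
  have e : ramp_prim w - N * Phi w = N * (1 - Phi w) - (N - ramp_prim w) by ring.
  have k1 : N * (1 - Phi w) <= 1 - Phi w by rewrite ler_piMl.
  have k2 : 0 <= N * (1 - Phi w) by rewrite mulr_ge0.
  by rewrite e ler_norml; apply/andP; split; lra.
have m := mills_upper (@is_derive_oneB_Phi R) (@vanish_oneB_Phi R) w0.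
rewrite /f normrM normfV (gtr0_norm p0) mulrA ler_pdivrMr// mul1r.
by apply: le_trans m; rewrite ler_wpM2l// ltW.
Qed.

Let psi w := Phi w / gpdf w.

(** [N] is of the size of the Gaussian tail itself: this factor is what makes the error left of the
    ramp a relative one. *)
Lemma stein_sol_left w : w <= a -> f w = - (N * psi w).
Proof. by move=> wa; rewrite /f ramp_prim_eq0// sub0r /psi mulNr mulrA. Qed.

Lemma expR_half_le2 : expR (1 / 2) <= 2 :> R.
Proof.
have h := expR_ge1Dx (- (1/2) : R); rewrite expRN in h.
have e0 := expR_gt0 (1/2 : R).
have : (1/2) * expR (1/2) <= 1 :> R.
  by rewrite -ler_pdivlMr// [leRHS]div1r; lra.
by lra.
Qed.

Lemma normal_peak_inv_le3 : (normal_peak 1)^-1 <= 3 :> R.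
Proof.
rewrite /normal_peak invrK expr1n mul1r.
have -> : (3 : R) = Num.sqrt (3 ^+ 2) by rewrite sqrtr_sqr ger0_norm.
rewrite ler_wsqrtr//.
have := @pihalf_lt2 R; lra.
Qed.

Lemma psi_le w : 0 <= psi w <= 3 * expR (w ^+ 2 / 2).
Proof.
have p0 := gpdf_gt0 w.
apply/andP; split; first by apply: divr_ge0; [exact: Phi_ge0|exact: ltW].
apply: (@le_trans _ _ (1 / gpdf w)).
  by apply: ler_wpM2r; [rewrite invr_ge0 ltW|exact: Phi_le1].
rewrite gpdfE div1r invfM -expRN opprK ler_wpM2r ?expR_ge0//.
exact: normal_peak_inv_le3.
Qed.

Let env w : R := 13 * ((1 + Num.max w 0) ^+ 2 * expR (Num.max w 0 ^+ 2 / 2)).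

(** The three quantities are psi, psi' and psi''. For w >= 0 the bound Phi <= 1 is enough; for w <=
    -1 the cancellation in psi' and psi'' comes from the two Mills inequalities at - w. *)
Lemma psi_bounds w : [/\ psi w <= env w, `|1 + w * psi w| <= env w &
  `|psi w + w * (1 + w * psi w)| <= env w].
Proof.
have /andP[p0 p1] := psi_le w.
have e12 := expR_half_le2.
have [w0|w0] := leP 0 w.
  rewrite /env (max_l w0).
  have E1 : 1 <= expR (w ^+ 2 / 2) by rewrite -expR0 ler_expR divr_ge0// sqr_ge0.
  have wp : 0 <= w * psi w by rewrite mulr_ge0.
  have wwp : 0 <= w * (w * psi w) by rewrite mulr_ge0.
  move: p1 E1; set E := expR _ => p1 E1.
  have k1 : w * psi w <= 3 * (w * E) by have := ler_wpM2l w0 p1; lra.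
  have k2 : w * (w * psi w) <= 3 * (w ^+ 2 * E).
    by have := ler_wpM2l w0 k1; rewrite expr2; lra.
  have wE : w <= w * E by rewrite ler_peMr.
  have wE0 : 0 <= w * E by rewrite mulr_ge0// (le_trans _ E1).
  have w2E0 : 0 <= w ^+ 2 * E by rewrite mulr_ge0 ?sqr_ge0// (le_trans _ E1).
  have -> : 13 * ((1 + w) ^+ 2 * E) = 13 * E + 26 * (w * E) + 13 * (w ^+ 2 * E) by ring.
  by split; rewrite ?ger0_norm; lra.
rewrite /env (max_r (ltW w0)) addr0 expr1n expr0n/= mul0r expR0 !mulr1.
have [w1|w1] := leP w (-1).
  pose x := - w; have x1 : 1 <= x by rewrite /x lerNr.
  have x0 : 0 < x by exact: lt_le_trans x1.
  have wx : w = - x by rewrite /x opprK.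
  have m1 := mills_upper (@is_derive_Phi_opp R) (@vanish_Phi_opp R) x0.
  have m2 := mills_lower (@is_derive_Phi_opp R) (@vanish_Phi_opp R) x.
  have q0 := gpdf_gt0 x.
  have {}m1 : x * psi w <= 1.
    by rewrite /psi wx gpdf_opp mulrA ler_pdivrMr// mul1r.
  have {}m2 : x <= (1 + x ^+ 2) * psi w.
    by rewrite /psi wx gpdf_opp mulrA ler_pdivlMr.
  have m3 : x * (x * psi w) <= x by rewrite ler_piMr// ltW.
  have m4 : psi w <= x * psi w by rewrite ler_peMl.
  rewrite expr2 mulrDl mul1r -mulrA in m2.
  move: (psi w) p0 m1 m2 m3 m4 => q p0' m1 m2 m3 m4.
  clear p1 w0 w1; clearbody x; rewrite {}wx.
  by split; [lra | rewrite ler_norml; apply/andP; split; lra ..].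
have w2 : w ^+ 2 <= 1.
  by rewrite -real_normK ?num_real// exprn_ile1// ler0_norm ?ltW//; lra.
have E : expR (w ^+ 2 / 2) <= 2 by apply: le_trans e12; rewrite ler_expR; lra.
have p6 : psi w <= 6 by lra.
have wp1 : - psi w <= w * psi w by rewrite -mulN1r ler_wpM2r// ltW.
have wp2 : w * psi w <= 0 by rewrite mulr_le0_ge0// ltW.
have wwp : 0 <= w * (w * psi w) <= psi w.
  rewrite mulr_le0//=; last by rewrite ltW.
  by rewrite mulrA -expr2 ler_piMl.
have /andP[wwp1 wwp2] := wwp.
rewrite mulrDr mulr1.
by split; [lra| rewrite ler_norml; apply/andP; split; lra ..].
Qed.

End stein_solution.

Lemma weightD (R : realType) (H : R) (F G : R -> R) :
  weight H F -> weight H G -> weight H (fun w => F w + G w).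
Proof.
move=> [mF F0 Fle Fexp] [mG G0 Gle Gexp]; split.
- exact: measurable_funD.
- by move=> w; rewrite addr_ge0.
- by move=> x y xy; rewrite lerD// ?Fle// Gle.
- by move=> w x x0; rewrite mulrDr lerD// ?Fexp// Gexp.
Qed.

Lemma weight_sum (R : realType) (H : R) (I : Type) (r : seq I) (F : I -> R -> R) :
  (forall i, weight H (F i)) -> weight H (fun w => \sum_(i <- r) F i w).
Proof.
move=> wF; elim: r => [|i r IH].
  under eq_fun do rewrite big_nil.
  by split => // *; rewrite ?mulr0.
under eq_fun do rewrite big_cons.
exact: weightD.
Qed.

(** * An exponential weight dominating the Stein solution *)

Section stein_solution_test.
Variable R : realType.
Local Notation gpdf := (@gpdf R).
Local Notation Phi := (@Phi R).
Variables (a u eta : R).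
Hypotheses (a1 : 1 <= a) (au : a <= u) (eta01 : 0 < eta <= 1).

Let u1 : 1 <= u := le_trans a1 au.
Let u0 : 0 < u := lt_le_trans ltr01 u1.
Let eta0 : 0 < eta. Proof. by have /andP[] := eta01. Qed.
Let eta1 : eta <= 1. Proof. by have /andP[] := eta01. Qed.
Let ue0 : 0 < u / eta. Proof. by rewrite divr_gt0. Qed.
Let ueu : u <= u / eta. Proof. by rewrite ler_pdivlMr// ler_piMr// ltW. Qed.

Local Notation N := (ramp_mean a u eta).
Local Notation f := (stein_sol a u eta).
Local Notation df := (stein_dsol a u eta).
Local Notation ramp := (ramp a u eta).

Let N0 : 0 <= N. Proof. exact: ramp_mean_ge0. Qed.
Let N1 : N <= 1. Proof. exact: ramp_mean_le1. Qed.

(* On [k, k + 1[ the tangent exponential at [k] dominates exp (w^2 / 2) up to a constant,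
   which replaces the Gaussian growth of the Stein solution by tilts with [k <= u]. *)
Definition wt_coef (k : nat) : R := (1 + k%:R) ^+ 2 * expR (- (k%:R ^+ 2 / 2)).

Definition left_wt w := \sum_(k < (Num.truncn a).+1) wt_coef k * expR (k%:R * w).

(** The first term serves left of [a], with 104 = 13 * 8 from [psi_bounds] and [left_wt_ge]. The
    second, which equals 4 u / eta at [a], serves right of [a]: the 4 leaves room for the slope u /
    eta of the ramp beside the 3 u coming from w f(w). *)
Definition stein_wt w := (N * 104) * left_wt w + 4 * (u / eta) * expR (- (u * a)) * expR (u * w).

Lemma wt_coef_ge0 k : 0 <= wt_coef k.
Proof. exact: (mulr_ge0 (sqr_ge0 _) (expR_ge0 _)). Qed.

Lemma index_le (k : 'I_(Num.truncn a).+1) : 0 <= (k%:R : R) <= u.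
Proof.
rewrite ler0n/=; apply: le_trans au.
have a0 : 0 <= a := le_trans ler01 a1.
apply: (@le_trans _ _ (Num.truncn a)%:R); last by rewrite truncn_le.
by rewrite ler_nat -ltnS.
Qed.

Lemma weight_left : weight u left_wt.
Proof.
apply: weight_sum => k; apply: weight_exp; [exact: wt_coef_ge0|exact: index_le].
Qed.

Lemma weight_scale (c : R) (F : R -> R) : 0 <= c -> weight u F -> weight u (fun w => c * F w).
Proof.
move=> c0 [mF F0 Fle Fexp]; split.
- exact: measurable_funM.
- by move=> w; rewrite mulr_ge0.
- by move=> x y xy; rewrite ler_wpM2l// Fle.
- by move=> w x x0; rewrite mulrCA ler_wpM2l// Fexp.
Qed.

Let c0 : 0 <= 4 * (u / eta) * expR (- (u * a)).
Proof. exact: (mulr_ge0 (mulr_ge0 (ler0n _ _) (ltW ue0)) (expR_ge0 _)). Qed.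

Let N104 : 0 <= N * 104 := mulr_ge0 N0 (ler0n _ _).

Lemma weight_stein : weight u stein_wt.
Proof.
apply: weightD; first exact: weight_scale weight_left.
by apply: weight_exp => //; rewrite lexx andbT ltW.
Qed.


(** One term suffices, with k the integer part of [w] (k = 0 for negative [w]): k w - k^2 / 2 = w^2
    / 2 - (w - k)^2 / 2 loses at most a factor exp(1/2) <= 2, and (1 + w)^2 <= 4 (1 + k)^2, so 8 = 2
    * 4. *)
Lemma left_wt_ge w : w <= a ->
  (1 + Num.max w 0) ^+ 2 * expR (Num.max w 0 ^+ 2 / 2) <= 8 * left_wt w.
Proof.
move=> wa.
have term (k : 'I_(Num.truncn a).+1) : wt_coef k * expR (k%:R * w) <= left_wt w.
  rewrite /left_wt (bigD1 k)//= lerDl; apply: sumr_ge0 => i _.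
  exact: (mulr_ge0 (wt_coef_ge0 _) (expR_ge0 _)).
have L0 : 0 <= left_wt w by have [_ h _ _] := weight_left; exact: h.
have [w0|w0] := leP 0 w; last first.
  rewrite addr0 expr1n expr0n/= mul0r expR0 mulr1.
  have := term ord0; rewrite /wt_coef/= addr0 expr1n expr0n/= !mul0r oppr0 expR0 !mulr1.
  by move: L0; lra.
have kK : (Num.truncn w < (Num.truncn a).+1)%N by rewrite ltnS le_truncn.
have := term (Ordinal kK); rewrite /=.
have := truncn_itv w0 => /andP[].
rewrite -natr1 /wt_coef; have := ler0n R (Num.truncn w).
move: (_%:R) => k k0 kw wk h.
have e2 := expR_half_le2 R.
have h1 : (1 + w) ^+ 2 <= 4 * (1 + k) ^+ 2.
  rewrite (_ : 4 * (1 + k) ^+ 2 = (2 * (1 + k)) ^+ 2); last by ring.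
  by rewrite ler_pXn2r ?nnegrE//; lra.
have h2 : expR (w ^+ 2 / 2) <= 2 * (expR (- (k ^+ 2 / 2)) * expR (k * w)).
  rewrite -expRD.
  apply: (@le_trans _ _ (expR (1/2) * expR (- (k ^+ 2 / 2) + k * w))).
    rewrite -expRD ler_expR.
    have : (w - k) ^+ 2 <= 1 by rewrite exprn_ile1//; lra.
    by rewrite sqrrB mulr2n; lra.
  by rewrite ler_wpM2r ?expR_ge0.
apply: (le_trans (ler_pM (sqr_ge0 _) (expR_ge0 _) h1 h2)).
apply: (@le_trans _ _ (8 * ((1 + k) ^+ 2 * expR (- (k ^+ 2 / 2)) * expR (k * w)))).
  by rewrite le_eqVlt; apply/orP; left; apply/eqP; ring.
by rewrite ler_wpM2l.
Qed.

Let right_exp w := 4 * (u / eta) * expR (- (u * a)) * expR (u * w).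

Let right_expE w : right_exp w = 4 * (u / eta) * expR (u * (w - a)).
Proof. by rewrite /right_exp -mulrA -expRD; congr (_ * expR _); ring. Qed.

Let right_exp_ge0 w : 0 <= right_exp w.
Proof. exact: (mulr_ge0 c0 (expR_ge0 _)). Qed.

Let left_ge0 w : 0 <= N * 104 * left_wt w.
Proof. by apply: (mulr_ge0 N104); have [_ h _ _] := weight_left; exact: h. Qed.

Let right_bound w : a <= w -> u * w <= u * (u * expR (u * (w - a))).
Proof.
move=> aw; apply: ler_wpM2l; first exact: ltW.
have h : 1 + u * (w - a) <= expR (u * (w - a)) by exact: expR_ge1Dx.
have h1 : w - a <= u * (u * (w - a)).
  rewrite mulrA ler_peMl ?subr_ge0//.
  by rewrite -[leLHS]mulr1 ler_pM.
apply: le_trans (ler_wpM2l (ltW u0) h).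
rewrite mulrDr mulr1 -lerBlDl; apply: le_trans h1.
by apply: lerB.
Qed.

Lemma stein_sol_bounds w :
  [/\ `|f w| <= stein_wt w, `|df w| <= stein_wt w &
      `|f w + w * df w| <= N * 104 * left_wt w + 3 * u * expR (u * (w - a))].
Proof.
have E0 := expR_ge0 (u * (w - a)).
have R0 := right_exp_ge0 w; have L0 := left_ge0 w.
have [wa|/ltW aw] := leP w a.
  have [p1 p2 p3] := psi_bounds w.
  have lw := left_wt_ge wa.
  have fE : f w = - (N * (Phi w / gpdf w)) by exact: stein_sol_left.
  have dE : df w = - (N * (1 + w * (Phi w / gpdf w))).
    by rewrite /stein_dsol fE ramp_eq0// ; ring.
  have p0 : 0 <= Phi w / gpdf w by have /andP[] := psi_le w.
  have {}lw : N * (13 * ((1 + Num.max w 0) ^+ 2 * expR (Num.max w 0 ^+ 2 / 2))) <= N * 104 * left_wt w.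
    rewrite -mulrA; apply: ler_wpM2l => //.
    by move: lw; move: (_ ^+ 2 * expR _) (left_wt w) => x y; lra.
  have eE : f w + w * df w = - (N * (Phi w / gpdf w + w * (1 + w * (Phi w / gpdf w)))).
    by rewrite fE dE; ring.
  have nN X : `|- (N * X)| = N * `|X| by rewrite normrN normrM (ger0_norm N0).
  rewrite eE fE dE !nN (ger0_norm p0).
  split.
  - apply: (le_trans (ler_wpM2l N0 p1)); apply: (le_trans lw).
    by rewrite /stein_wt lerDl.
  - apply: (le_trans (ler_wpM2l N0 p2)); apply: (le_trans lw).
    by rewrite /stein_wt lerDl.
  - apply: (le_trans (ler_wpM2l N0 p3)); apply: (le_trans lw).
    by rewrite lerDl !mulr_ge0// ltW.
have w1 : 1 <= w := le_trans a1 aw.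
have w0 : 0 < w := lt_le_trans ltr01 w1.
have ft : w * `|f w| <= 1 by exact: stein_sol_tail.
have f1 : `|f w| <= 1 by apply: le_trans ft; rewrite ler_peMl.
have wf : `|w * f w| <= 1 by rewrite normrM gtr0_norm.
have t0 := ramp_ge0 a u eta w; have t1 := ramp_le1 a u eta w.
have d2 : `|df w| <= 2.
  rewrite /stein_dsol -addrA; apply: (le_trans (ler_normD _ _)).
  have : `|ramp w - N| <= 1.
    by have := N0; have := N1; rewrite ler_norml => ? ?; apply/andP; split; lra.
  by lra.
have E1 : 1 <= expR (u * (w - a)).
  by rewrite -expR0 ler_expR mulr_ge0 ?subr_ge0// ltW.
have r4 : 4 <= right_exp w.
  rewrite right_expE -mulrA ler_peMr//.
  by rewrite -[leLHS]mulr1 ler_pM// (le_trans u1).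
split.
- by apply: (le_trans f1); rewrite /stein_wt -/(right_exp w); lra.
- by apply: (le_trans d2); rewrite /stein_wt -/(right_exp w); lra.
- apply: (le_trans (ler_normD _ _)).
  have wd : `|w * df w| <= 2 * w by rewrite normrM gtr0_norm// mulrC ler_wpM2r// ltW.
  have wE : w <= u * expR (u * (w - a)).
    by have := right_bound aw; rewrite ler_pM2l.
  have uE : 1 <= u * expR (u * (w - a)) by rewrite -[leLHS]mulr1 ler_pM.
  by rewrite -mulrA; lra.
Qed.

(** The increment of f' is that of w f(w), handled by the mean value theorem, plus that of the
    ramp. *)
Lemma stein_sol_test : stein_test stein_wt f df.
Proof.
split.
- by move=> x; exact: is_derive_stein_sol.
- by move=> w; have [] := stein_sol_bounds w.
- by move=> w; have [] := stein_sol_bounds w.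
suff main x y : x < y -> `|df y - df x| <= (y - x) * stein_wt y.
  move=> x y; have [xy|yx|->] := ltgtP x y.
  - by rewrite distrC (distrC x) (gtr0_norm (_ : 0 < y - x)) ?subr_gt0//; exact: main.
  - by rewrite (gtr0_norm (_ : 0 < x - y)) ?subr_gt0//; exact: main.
  - by rewrite !subrr normr0 mul0r.
move=> xy.
have yx0 : 0 <= y - x by rewrite subr_ge0 ltW.
have [c ] := MVT xy (fun z _ => is_derive_mul_stein_sol a1 au eta01 z)
  (continuous_subspaceT (fun z => differentiable_continuous
    (proj1 (derivable1_diffP _ _) (@ex_derive _ _ _ _ _ _ _ (is_derive_mul_stein_sol a1 au eta01 z))))).
rewrite in_itv/= => /andP[xc cy] e.
have h1 : `|y * f y - x * f x| <= (y - x) * (N * 104 * left_wt y + 3 * u * expR (u * (y - a))).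
  rewrite e normrM (ger0_norm yx0) mulrC; apply: ler_wpM2l => //.
  have [_ _ h] := stein_sol_bounds c; apply: (le_trans h); apply: lerD.
    by apply: (ler_wpM2l N104); have [_ _ hl _] := weight_left; apply: hl; exact: ltW.
  apply: ler_wpM2l; first exact: (mulr_ge0 (ler0n _ _) (ltW u0)).
  by rewrite ler_expR ler_pM2l// lerD2r ltW.
(* The weight is evaluated at the larger point: if y <= a the ramp does not move at all, and if y >
   a the inserted exponential is at least 1. *)
have h2 : `|ramp y - ramp x| <= (y - x) * (u / eta * expR (u * (y - a))).
  have [ya|ay] := leP y a.
    have xa : x <= a := le_trans (ltW xy) ya.
    rewrite !ramp_eq0// subrr normr0.
    exact: (mulr_ge0 yx0 (mulr_ge0 (ltW ue0) (expR_ge0 _))).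
  have := @ramp_lip _ a u eta a1 au eta01 y x; rewrite (ger0_norm yx0) => /le_trans; apply.
  apply: ler_wpM2l => //; rewrite ler_peMr//; first exact: ltW.
  rewrite -expR0 ler_expR; apply: mulr_ge0; first exact: ltW.
  by rewrite subr_ge0 ltW.
have -> : df y - df x = (y * f y - x * f x) + (ramp y - ramp x).
  by rewrite /stein_dsol; ring.
apply: (le_trans (ler_normD _ _)); apply: (le_trans (lerD h1 h2)).
rewrite -mulrDr; apply: ler_wpM2l => //.
rewrite /stein_wt -/(right_exp y) right_expE -addrA lerD2l -mulrDl ler_wpM2r ?expR_ge0//.
by have := ueu; lra.
Qed.

End stein_solution_test.

(** * Tails of the permutation sum *)

Section smooth_tail.
Context d (T : measurableType d) (R : realType) (P : probability T R).
Variables (n : nat) (Y : 'I_n -> 'I_n -> T -> R) (K eps : R).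
Variables (a u eta : R).
Hypotheses (a1 : 1 <= a) (au : a <= u) (eta01 : 0 < eta <= 1).
Hypothesis ca : comb_array P Y u K eps.
Hypothesis small : u * (16000 * K * eps * (1 + u) ^+ 2) <= 1.

Let u1 : 1 <= u := le_trans a1 au.
Let u0 : 0 < u := lt_le_trans ltr01 u1.
Local Notation N := (ramp_mean a u eta).
Local Notation nf := ((n`!)%:R : R).

Let wG := weight_stein a1 au eta01.
Let fdf := stein_sol_test a1 au eta01.

Let nf0 : 0 <= nf. Proof. exact: ler0n. Qed.

Lemma tame_ramp : tame u (ramp a u eta).
Proof.
split; first by apply: continuous_measurable_fun; exact: continuous_ramp.
exists 1 => w; rewrite mul1r ger0_norm; last exact: ramp_ge0.
by apply: (le_trans (ramp_le1 _ _ _ _)); rewrite lerDl expR_ge0.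
Qed.

(** The Stein equation ramp - N = f' - w f, integrated and summed over permutations. *)
Lemma total_ramp : total P Y (ramp a u eta) - nf * N =
  total P Y (stein_dsol a u eta) - \sum_(s : 'S_n) \sum_i crossE P Y (stein_sol a u eta) s i.
Proof.
have -> : nf * N = \sum_(s : 'S_n) N by rewrite sumr_const card_Sn mulr_natl.
rewrite /total -!sumrB; apply: eq_bigr => s _.
have [i1 ->] := sum_crossE ca s wG fdf.
have i2 := EW_integrable ca s finset.setT tame_ramp.
have i3 := EW_integrable ca s finset.setT (stein_test_df_tame wG fdf).
have iN := @integrable_cstR _ _ _ P N.
rewrite /EW -[X in _ - X = _](Rintegral_cstP P) -!RintegralB//.
by apply: eq_Rintegral => t _; rewrite /stein_dsol; ring.
Qed.

(** The factor exp(- k^2 / 2) of [wt_coef] cancels the growth of [mgf] at k. Each term is then at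
    most a multiple of (1 + k)^2 <= 4 u^2, and there are at most 2 u of them: this is the source of
    u^3. *)
Lemma total_left : total P Y (left_wt a) <= nf * (expR 2 * (8 * u ^+ 3)).
Proof.
have -> : total P Y (left_wt a) = \sum_(k < (Num.truncn a).+1) wt_coef R k * mgf P Y k%:R.
  pose F s (r : seq 'I_(Num.truncn a).+1) t :=
    \sum_(k <- r) wt_coef R k * expR (k%:R * psum Y s finset.setT t).
  have hF s r : P.-integrable setT (EFin \o F s r) /\
     \int[P]_t F s r t = \sum_(k <- r) wt_coef R k * EW P Y s finset.setT (fun w => expR (k%:R * w)).
    elim: r => [|k r [IH1 IH2]].
      have -> : F s [::] = fun=> 0 by apply/funext => t; rewrite /F big_nil.
      by rewrite big_nil Rintegral_cstP; split => //; exact: integrable_cstR.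
    have ik := EW_integrable ca s finset.setT (tame_exp (index_le a1 au k)).
    have ik' := integrableRZ (wt_coef R k) ik.
    have -> : F s (k :: r) = fun t => wt_coef R k * expR (k%:R * psum Y s finset.setT t) + F s r t.
      by apply/funext => t; rewrite /F big_cons.
    rewrite big_cons -IH2; split; first exact: integrableRD.
    by rewrite RintegralD// /EW RintegralZl.
  rewrite /total; under eq_bigr => s _ do rewrite /EW -/(F s _) (hF s _).2.
  by rewrite exchange_big/=; apply: eq_bigr => k _; rewrite -mulr_sumr.
have hk (k : 'I_(Num.truncn a).+1) : wt_coef R k * mgf P Y k%:R <= nf * (expR 2 * (4 * u ^+ 2)).
  have m := mgf_le ca (index_le a1 au k) small.
  apply: (le_trans (ler_wpM2l (wt_coef_ge0 _ k) m)).
  have -> : wt_coef R k * (nf * (expR 2 * expR (k%:R ^+ 2 / 2))) =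
     nf * (expR 2 * ((1 + k%:R) ^+ 2 * (expR (- (k%:R ^+ 2 / 2)) * expR (k%:R ^+ 2 / 2)))).
    by rewrite /wt_coef; ring.
  rewrite -expRD addNr expR0 mulr1 ler_wpM2l// ler_wpM2l ?expR_ge0//.
  have /andP[k0 ku] := index_le a1 au k.
  have -> : 4 * u ^+ 2 = (2 * u) ^+ 2 by ring.
  by rewrite ler_pXn2r ?nnegrE//; have := u1; move: (k%:R) k0 ku => x ? ? ?; lra.
apply: (@le_trans _ _ (\sum_(k < (Num.truncn a).+1) nf * (expR 2 * (4 * u ^+ 2)))).
  by apply: ler_sum => k _; exact: hk.
rewrite sumr_const card_ord -[leLHS]mulr_natl.
have a0 : 0 <= a := le_trans ler01 a1.
have tK : (Num.truncn a).+1%:R <= 2 * u.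
  rewrite -natr1; have : (Num.truncn a)%:R <= a by rewrite truncn_le.
  by have := au; have := u1; move: (_%:R) => x ? ? ?; lra.
have c0 : 0 <= nf * (expR 2 * (4 * u ^+ 2)).
  exact: (mulr_ge0 nf0 (mulr_ge0 (expR_ge0 _) (mulr_ge0 (ler0n _ _) (sqr_ge0 _)))).
apply: (le_trans (ler_wpM2r c0 tK)).
by rewrite le_eqVlt; apply/orP; left; apply/eqP; ring.
Qed.

(** 832 = 104 * 8 from the left part of the weight; the right part is its coefficient times [mgf] at
    u, and for [a] near u the exponent u^2 / 2 - u a is near - u^2 / 2. *)
Lemma smooth_tail_bound :
  `|total P Y (ramp a u eta) - nf * N| <= 16000 * K * eps *
    (nf * (expR 2 * (N * 832 * u ^+ 3 + 4 * (u / eta) * expR (u ^+ 2 / 2 - u * a)))).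
Proof.
rewrite total_ramp distrC; apply: (le_trans (stein_bound ca wG fdf)).
have K0 : 0 <= K := le_trans ler01 (ca_K1 ca).
have e0 := eps_ge0 ca.
apply: (ler_wpM2l (mulr_ge0 (mulr_ge0 (ler0n _ _) K0) e0)).
have N0 : 0 <= N * 104 by apply: mulr_ge0; [exact: ramp_mean_ge0|exact: ler0n].
have /andP[eta0 _] := eta01.
pose c := 4 * (u / eta) * expR (- (u * a)).
have c0 : 0 <= c.
  exact: (mulr_ge0 (mulr_ge0 (ler0n _ _) (divr_ge0 (ltW u0) (ltW eta0))) (expR_ge0 _)).
have uu : 0 <= u <= u by rewrite ltW/=.
have -> : total P Y (stein_wt a u eta) = N * 104 * total P Y (left_wt a) + c * mgf P Y u.
  rewrite /mgf /total !mulr_sumr -big_split/=; apply: eq_bigr => s _.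
  have i1 := EW_integrable ca s finset.setT (weight_tame (weight_left a1 au)).
  have i2 := EW_integrable ca s finset.setT (tame_exp uu).
  have i1' := integrableRZ (N * 104) i1.
  have i2' := integrableRZ c i2.
  by rewrite /EW -!RintegralZl// -RintegralD.
have h1 := ler_wpM2l N0 total_left.
have h2 := ler_wpM2l c0 (mgf_le ca uu small).
apply: (le_trans (lerD h1 h2)).
rewrite (expRD (u ^+ 2 / 2)) le_eqVlt; apply/orP; left; apply/eqP.
by rewrite /c; ring.
Qed.

End smooth_tail.

Section tail_sandwich.
Context d (T : measurableType d) (R : realType) (P : probability T R).
Variables (n : nat) (Y : 'I_n -> 'I_n -> T -> R) (K eps : R).
Variables (u eta : R).
Hypotheses (u2 : 2 <= u) (eta01 : 0 < eta <= 1).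
Hypothesis ca : comb_array P Y u K eps.
Hypothesis small : 4 * 16000 * K * (eps * u ^+ 3) <= 1.

Local Notation nf := ((n`!)%:R : R).
Let nf0 : 0 < nf. Proof. by rewrite ltr0n fact_gt0. Qed.
Let K0 : 0 <= K := le_trans ler01 (ca_K1 ca).
Let eps0 := eps_ge0 ca.
Let u0 : 0 < u. Proof. by apply: lt_le_trans u2. Qed.
Let u1 : 1 <= u. Proof. by apply: le_trans u2; rewrite ler1n. Qed.
Let Ke : 0 <= K * eps := mulr_ge0 K0 eps0.
Let eta0 : 0 < eta. Proof. by have /andP[] := eta01. Qed.
Let eta1 : eta <= 1. Proof. by have /andP[] := eta01. Qed.

Lemma small_stein : u * (16000 * K * eps * (1 + u) ^+ 2) <= 1.
Proof.
have : 0 <= 16000 :> R := ler0n _ _.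
move: small; move: (16000 : R) => c sm c0; apply: le_trans sm.
have -> : 4 * c * K * (eps * u ^+ 3) = u * (c * K * eps * (4 * u ^+ 2)) by ring.
apply: (ler_wpM2l (ltW u0)).
apply: (ler_wpM2l (mulr_ge0 (mulr_ge0 c0 K0) eps0)).
rewrite (_ : 4 * u ^+ 2 = (2 * u) ^+ 2); last by ring.
by rewrite ler_pXn2r ?nnegrE//; have := u1; lra.
Qed.

(** n! times the tail probability at a uniform permutation independent of the array. *)
Definition perm_tail v := \sum_(s : 'S_n) fine (P (psum Y s finset.setT @^-1` `[v, +oo[)).

Lemma EW_indic s v : fine (P (psum Y s finset.setT @^-1` `[v, +oo[)) =
  \int[P]_t \1_(`[v, +oo[%classic) (psum Y s finset.setT t).
Proof.
rewrite /Rintegral; congr fine.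
have mA : measurable (psum Y s finset.setT @^-1` `[v, +oo[).
  by apply: measurable_preim => //; exact: (measurable_psum ca).
rewrite (eq_integral (fun t => (\1_(psum Y s finset.setT @^-1` `[v, +oo[) t)%:E))//.
by rewrite integral_indic// setIT.
Qed.

Let iindic s v : P.-integrable setT
  (EFin \o (fun t => \1_(`[v, +oo[%classic) (psum Y s finset.setT t) : R)).
Proof.
apply: le_integrableR (@integrable_cstR _ _ _ P 1).
  apply: measurableT_comp; last exact: (measurable_psum ca).
  exact: measurable_indic.
move=> t; rewrite ger0_norm// indicE; by case: (_ \in _).
Qed.

Lemma perm_tail_le_ramp a : 1 <= a -> a <= u -> a + eta / u <= u ->
  perm_tail u <= total P Y (ramp a u eta).
Proof.
move=> a1 au ab; apply: ler_sum => s _; rewrite EW_indic.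
have ir := EW_integrable ca s finset.setT (tame_ramp a1 au eta01).
have ii := iindic s u; apply: le_Rintegral => //.
move=> t _; rewrite indicE; case: (boolP (_ \in _)) => [|_] /=; last exact: ramp_ge0.
rewrite inE/= in_itv/= andbT => h; rewrite ramp_eq1//.
by exact: le_trans h.
Qed.

Lemma ramp_le_perm_tail : total P Y (ramp u u eta) <= perm_tail u.
Proof.
apply: ler_sum => s _; rewrite EW_indic.
have ir := EW_integrable ca s finset.setT (tame_ramp u1 (lexx u) eta01).
have ii := iindic s u; apply: le_Rintegral => //.
move=> t _; rewrite indicE; case: (boolP (_ \in _)) => [_|] /=; first exact: ramp_le1.
by rewrite notin_setE/= in_itv/= andbT => /negP; rewrite -ltNge => /ltW h; rewrite ramp_eq0.
Qed.

End tail_sandwich.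

(** * The Gaussian tail within distance eta / u of u *)

Section gaussian_window.
Variable R : realType.
Local Notation gpdf := (@gpdf R).
Local Notation Phi := (@Phi R).
Variables u eta : R.
Hypotheses (u2 : 2 <= u) (eta01 : 0 < eta <= 1).
Local Notation q := (1 - Phi u).

Let u0 : 0 < u. Proof. by apply: lt_le_trans u2. Qed.
Let u1 : 1 <= u. Proof. by apply: le_trans u2; rewrite ler1n. Qed.
Let eta0 : 0 < eta. Proof. by have /andP[] := eta01. Qed.
Let eta1 : eta <= 1. Proof. by have /andP[] := eta01. Qed.
Let u4 : 4 <= u ^+ 2.
Proof. by rewrite (_ : 4 = 2 ^+ 2); [rewrite ler_pXn2r ?nnegrE// ltW|rewrite -natrX]. Qed.

Lemma gpdf_le_tail : u * gpdf u <= (1 + u ^+ 2) * q.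
Proof. exact: (mills_lower (@is_derive_oneB_Phi R) (@vanish_oneB_Phi R)). Qed.

Lemma tail_gt0 : 0 < q.
Proof.
have := lt_le_trans (mulr_gt0 u0 (gpdf_gt0 u)) gpdf_le_tail.
by rewrite pmulr_rgt0//; have := u4; lra.
Qed.

Lemma gpdf_shift (x y c : R) : y ^+ 2 <= x ^+ 2 + 2 * c -> gpdf x <= gpdf y * expR c.
Proof.
move=> h; rewrite !gpdfE -[leRHS]mulrA -expRD ler_wpM2l ?normal_peak_ge0// ler_expR; lra.
Qed.

Lemma window_left_ge1 : 1 <= u - eta / u.
Proof.
have : eta / u <= 1 by rewrite ler_pdivrMr// mul1r (le_trans eta1).
by have := u2; lra.
Qed.

(** Mills' upper inequality at a = u - eta / u and the lower one at u, linked by a^2 >= u^2 - 2 eta;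
    the denominator comes from u a = u^2 - eta >= u^2 - 1. *)
Lemma tail_window_le : 1 - Phi (u - eta / u) <= q * ((1 + u ^+ 2) / (u ^+ 2 - 1) * expR eta).
Proof.
set a := u - eta / u.
have a1 : 1 <= a := window_left_ge1.
have a0 : 0 < a := lt_le_trans ltr01 a1.
have h1 := mills_upper (@is_derive_oneB_Phi R) (@vanish_oneB_Phi R) a0.
have h2 : gpdf a <= gpdf u * expR eta.
  apply: gpdf_shift.
  have -> : a ^+ 2 = u ^+ 2 - 2 * eta + (eta / u) ^+ 2 by rewrite /a; field; rewrite gt_eqF.
  by have := sqr_ge0 (eta / u); lra.
have Q0 : 0 <= 1 - Phi a by rewrite subr_ge0; exact: Phi_le1.
have E0 := expR_gt0 eta.
have D0 : 0 < u ^+ 2 - 1 by have := u4; lra.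
have -> : q * ((1 + u ^+ 2) / (u ^+ 2 - 1) * expR eta) =
  ((1 + u ^+ 2) * q) * expR eta / (u ^+ 2 - 1) by ring.
rewrite ler_pdivlMr//.
apply: (@le_trans _ _ (u * (a * (1 - Phi a)))).
  have -> : u * (a * (1 - Phi a)) = (1 - Phi a) * (u ^+ 2 - eta).
    by rewrite /a; field; rewrite gt_eqF.
  by apply: ler_wpM2l => //; have := eta1; lra.
apply: (le_trans (ler_wpM2l (ltW u0) (le_trans h1 h2))).
by rewrite mulrA; apply: (ler_wpM2r (ltW E0)); exact: gpdf_le_tail.
Qed.

(** The mirror image at b = u + eta / u. Since (eta / u)^2 <= eta, b^2 <= u^2 + 3 eta, which gives
    both the exponent 3/2 eta and 1 + b^2 <= u^2 + 4. *)
Lemma tail_window_ge : q * (u ^+ 2 / (u ^+ 2 + 4) * expR (- (3 / 2 * eta))) <= 1 - Phi (u + eta / u).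
Proof.
set b := u + eta / u.
have eu0 : 0 <= eta / u by rewrite divr_ge0// ltW.
have bu : u <= b by rewrite lerDl.
have bE : b ^+ 2 = u ^+ 2 + 2 * eta + (eta / u) ^+ 2 by rewrite /b; field; rewrite gt_eqF.
have eu2 : (eta / u) ^+ 2 <= eta.
  apply: (@le_trans _ _ (eta / u)); last by rewrite ler_pdivrMr// ler_peMr// ltW.
  by rewrite expr2 ler_piMl// ler_pdivrMr// mul1r (le_trans eta1).
have h1 := mills_lower (@is_derive_oneB_Phi R) (@vanish_oneB_Phi R) b.
have h2 : gpdf u * expR (- (3 / 2 * eta)) <= gpdf b.
  have h : gpdf u <= gpdf b * expR (3 / 2 * eta) by apply: gpdf_shift; rewrite bE; lra.
  by rewrite expRN ler_pdivrMr ?expR_gt0.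
have h3 := mills_upper (@is_derive_oneB_Phi R) (@vanish_oneB_Phi R) u0.
have Q0 : 0 <= 1 - Phi b by rewrite subr_ge0; exact: Phi_le1.
have E0 := expR_gt0 (- (3 / 2 * eta)).
have D0 : 0 < u ^+ 2 + 4 by have := u4; lra.
have -> : q * (u ^+ 2 / (u ^+ 2 + 4) * expR (- (3 / 2 * eta))) =
  u * ((u * q) * expR (- (3 / 2 * eta))) / (u ^+ 2 + 4) by ring.
rewrite ler_pdivrMr//.
apply: (@le_trans _ _ (u * gpdf b)).
  by apply: (ler_wpM2l (ltW u0)); apply: le_trans h2; exact: (ler_wpM2r (ltW E0)).
apply: (@le_trans _ _ (b * gpdf b)); first by apply: ler_wpM2r => //; exact/ltW/gpdf_gt0.
apply: (le_trans h1); rewrite mulrC; apply: ler_wpM2l => //.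
by rewrite bE; have := eta1; have := eta0; lra.
Qed.

Lemma expR1_le4 : expR 1 <= 4 :> R.
Proof.
have -> : expR 1 = expR (1/2) * expR (1/2) :> R by rewrite -expRD; congr expR; field.
have h := @expR_half_le2 R.
have := ler_pM (expR_ge0 _) (expR_ge0 _) h h.
by lra.
Qed.

Lemma window_N_le (N : R) : N <= q * ((1 + u ^+ 2) / (u ^+ 2 - 1) * expR eta) -> N <= 7 * q.
Proof.
move=> /le_trans; apply; rewrite mulrC; apply: ler_wpM2r; first exact/ltW/tail_gt0.
have D0 : 0 < u ^+ 2 - 1 by have := u4; lra.
(* For u >= 2 the quotient is at most 5/3, and exp(eta) <= exp(1) <= 4; 20/3 is below 7. *)
apply: (@le_trans _ _ (5 / 3 * 4)); last by lra.
have e4 : expR eta <= 4.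
  apply: (@le_trans _ _ (expR 1)); first by rewrite ler_expR.
  exact: expR1_le4.
have f53 : (1 + u ^+ 2) / (u ^+ 2 - 1) <= 5 / 3.
  by rewrite ler_pdivrMr//; have := u4; lra.
apply: (ler_pM _ (expR_ge0 _) f53 e4).
by apply: divr_ge0; have := u4; lra.
Qed.

(** Both parts of the error become multiples of the tail [q]. The left one uses N <= 7 q, with 7 *
    832 = 5824; the right one uses exp(1 - u^2 / 2) <= 12 gpdf(u) and gpdf(u) <= (5/4) u q, with 4 *
    12 * 5/4 = 60. The sum stays below 6000. *)
Lemma window_error (N a : R) : 0 <= N -> N <= 7 * q -> u - eta / u <= a ->
  N * 832 * u ^+ 3 + 4 * (u / eta) * expR (u ^+ 2 / 2 - u * a) <= q * (60 * 100 * (u ^+ 3 / eta)).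
Proof.
move=> N0 Nq ua; have q0 := tail_gt0.
have h1 : expR (u ^+ 2 / 2 - u * a) <= 4 * (3 * ((5/4) * u * q)).
  apply: (@le_trans _ _ (expR (1 + - (u ^+ 2 / 2)))).
    rewrite ler_expR; have := ler_wpM2l (ltW u0) ua.
    have -> : u * (u - eta / u) = u ^+ 2 - eta by field; rewrite gt_eqF.
    by have := eta1; lra.
  rewrite expRD; apply: ler_pM; rewrite ?expR_ge0//.
    exact: expR1_le4.
  apply: (@le_trans _ _ (3 * gpdf u)).
    rewrite gpdfE mulrA ler_peMl ?expR_ge0//.
    have p0 : 0 < normal_peak (1 : R) by apply: normal_peak_gt0; rewrite oner_eq0.
    by have := @normal_peak_inv_le3 R; rewrite -(ler_pM2r p0) mulVf// gt_eqF.
  apply: ler_wpM2l => //; rewrite -(ler_pM2l u0).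
  apply: (le_trans gpdf_le_tail).
  have -> : u * (5 / 4 * u * q) = (5/4 * u ^+ 2) * q by ring.
  by apply: (ler_wpM2r (ltW q0)); have := u4; lra.
have ue : 0 <= 4 * (u / eta) := mulr_ge0 (ler0n _ _) (divr_ge0 (ltW u0) (ltW eta0)).
have h2 := ler_wpM2l ue h1.
have h3 : N * 832 * u ^+ 3 <= q * (5824 * (u ^+ 3 / eta)).
  have h : u ^+ 3 <= u ^+ 3 / eta by rewrite ler_pdivlMr// ler_piMr// exprn_ge0// ltW.
  apply: (@le_trans _ _ (7 * q * 832 * u ^+ 3)).
    apply: ler_wpM2r; first by rewrite exprn_ge0// ltW.
    exact: (ler_wpM2r (ler0n _ _)).
  have -> : 7 * q * 832 * u ^+ 3 = q * (5824 * u ^+ 3) by ring.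
  apply: (ler_wpM2l (ltW q0)); exact: (ler_wpM2l (ler0n _ _)).
have h4 : 4 * (u / eta) * (4 * (3 * (5 / 4 * u * q))) <= q * (60 * (u ^+ 3 / eta)).
  have -> : 4 * (u / eta) * (4 * (3 * (5 / 4 * u * q))) = q * (60 * (u ^+ 2 / eta)) by field; rewrite gt_eqF.
  apply: (ler_wpM2l (ltW q0)); apply: (ler_wpM2l (ler0n _ _)).
  apply: ler_wpM2r; first by rewrite invr_ge0 ltW.
  by rewrite ler_weXn2l.
have h5 : 0 <= q * (u ^+ 3 / eta).
  apply: (mulr_ge0 (ltW q0)); apply: divr_ge0; last exact: ltW.
  by rewrite exprn_ge0// ltW.
move: h2 h3 h4 h5; move: (u ^+ 3 / eta) (4 * (u / eta)) => x y.
move: (N * _ * _) (y * expR _) (y * _) => z t s; rewrite !(mulrCA q).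
by move: (q * x) => p; lra.
Qed.

End gaussian_window.

Section tail_bounds.
Context d (T : measurableType d) (R : realType) (P : probability T R).
Variables (n : nat) (Y : 'I_n -> 'I_n -> T -> R) (K eps : R).
Variables (u eta : R).
Hypotheses (u2 : 2 <= u) (eta01 : 0 < eta <= 1).
Hypothesis ca : comb_array P Y u K eps.
Hypothesis small : 4 * 16000 * K * (eps * u ^+ 3) <= 1.
Local Notation q := (1 - @Phi R u).
Local Notation nf := ((n`!)%:R : R).

Let u0 : 0 < u. Proof. by apply: lt_le_trans u2. Qed.
Let eta0 : 0 < eta. Proof. by have /andP[] := eta01. Qed.
Let K0 : 0 <= K := le_trans ler01 (ca_K1 ca).
Let nf0 : 0 <= nf. Proof. exact: ler0n. Qed.

(** The error relative to 1 - Phi(u), of order eps u^3 / eta for fixed K. *)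
Definition tail_err : R := 16000 * K * eps * (expR 2 * (60 * 100 * (u ^+ 3 / eta))).

Lemma ramp_error (a : R) : 1 <= a -> a <= u -> u - eta / u <= a ->
  ramp_mean a u eta <= 7 * q ->
  `|total P Y (ramp a u eta) - nf * ramp_mean a u eta| <= nf * (q * tail_err).
Proof.
move=> a1 au ua N7.
apply: (le_trans (smooth_tail_bound a1 au eta01 ca (small_stein u2 ca small))).
have N0 : 0 <= ramp_mean a u eta by exact: ramp_mean_ge0.
have h := window_error u2 eta01 N0 N7 ua.
have e0 := eps_ge0 ca.
rewrite /tail_err.
have : 0 <= 16000 :> R := ler0n _ _.
move: h; move: (16000 : R) (60 * 100 * _) (ramp_mean a u eta * _ * _ + _) => c A B h c0.
have -> : nf * (q * (c * K * eps * (expR 2 * A))) = (c * K * eps) * (nf * (expR 2 * (q * A))) by ring.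
apply: (ler_wpM2l (mulr_ge0 (mulr_ge0 c0 K0) e0)).
by apply: (ler_wpM2l nf0); apply: ler_wpM2l; [exact: expR_ge0|].
Qed.

Lemma perm_tail_upper :
  perm_tail P Y u <= nf * (q * ((1 + u ^+ 2) / (u ^+ 2 - 1) * expR eta + tail_err)).
Proof.
have a1 := window_left_ge1 u2 eta01.
have au : u - eta / u <= u by rewrite gerBl divr_ge0// ltW.
have ab : u - eta / u + eta / u <= u by rewrite subrK.
apply: (le_trans (perm_tail_le_ramp eta01 ca a1 au ab)).
have N1 := le_trans (ramp_mean_upper a1 au eta01) (tail_window_le u2 eta01).
have N7 := window_N_le u2 eta01 N1.
have := ramp_error a1 au (lexx _) N7; rewrite ler_norml => /andP[_].
rewrite lerBlDr => /le_trans; apply.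
rewrite (mulrDr q) mulrDr addrC lerD2r.
exact: ler_wpM2l.
Qed.

Lemma perm_tail_lower :
  nf * (q * (u ^+ 2 / (u ^+ 2 + 4) * expR (- (3 / 2 * eta)) - tail_err)) <= perm_tail P Y u.
Proof.
have u1 : 1 <= u by apply: le_trans u2; rewrite ler1n.
apply: le_trans (ramp_le_perm_tail u2 eta01 ca).
have N1 := ramp_mean_upper u1 (lexx u) eta01.
have q0 := tail_gt0 u2.
have N7 : ramp_mean u u eta <= 7 * q by apply: (le_trans N1); rewrite ler_peMl ?ltW// ltr1n.
have ua : u - eta / u <= u by rewrite gerBl divr_ge0// ltW.
have := ramp_error u1 (lexx u) ua N7; rewrite ler_norml => /andP[+ _].
rewrite lerBrDl => h; apply: le_trans h.
rewrite mulrBr mulrBr lerD2r.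
apply: ler_wpM2l => //; apply: (le_trans (tail_window_ge u2 eta01)).
exact: ramp_mean_lower.
Qed.

End tail_bounds.

(** * Normalisation of the array *)

Section exponential_moments.
Context d (T : measurableType d) (R : realType) (P : probability T R).
Variables (Z : T -> R) (M D : R).
Hypotheses (mZ : measurable_fun setT Z) (M0 : 0 < M) (D0 : 0 < D).
Hypothesis iZ : forall k : nat, P.-integrable setT (fun t => (Z t ^+ k)%:E).

Local Notation amom k := (\int[P]_t (`|Z t| ^+ k)).

Hypothesis hZ : forall s k : nat, (1 <= s <= 3)%N -> (s <= k)%N ->
  `|\int[P]_t (Z t ^+ k)| <= D * (k`!)%:R * M ^+ (k - s) * amom s.

Lemma integrable_absX k : P.-integrable setT (EFin \o (fun t => `|Z t| ^+ k)).
Proof.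
have := integrable_abse (iZ k); apply: eq_integrable => // t _ /=.
by rewrite normrX.
Qed.

Lemma absX_mean_ge0 k : 0 <= amom k.
Proof. by apply: Rintegral_ge0 => t _; rewrite exprn_ge0. Qed.

(* The hypothesis controls even powers only; an odd power is interpolated between its
   two even neighbours. *)
Lemma absX_mean_le s p : (1 <= s <= 3)%N -> (s <= p)%N ->
  amom p <= (1 + D) * (p.+1`!)%:R * M ^+ (p - s) * amom s.
Proof.
move=> s13 sp; have a0 := absX_mean_ge0 s.
have even k : (s <= k)%N -> ~~ odd k -> amom k <= D * (k`!)%:R * M ^+ (k - s) * amom s.
  move=> sk ek; apply: le_trans (hZ s13 sk); apply: (le_trans _ (ler_norm _)).
  by under eq_Rintegral => t _ do rewrite -normrX ger0_norm ?real_exprn_even_ge0 ?num_real//.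
have M'0 k : 0 <= M ^+ k by rewrite exprn_ge0// ltW.
have [ep|op] := boolP (~~ odd p).
  apply: (le_trans (even _ sp ep)); apply: ler_wpM2r => //; apply: ler_wpM2r => //.
  apply: ler_pM => //; [exact: ltW|by lra|].
  by rewrite ler_nat leq_pmull.
rewrite negbK in op.
(* For odd p = s the lower even neighbour p - 1 lies below [s], where the hypothesis says nothing;
   but then the claim is trivial. *)
have [<-|] := eqVneq s p.
  rewrite subnn expr0 mulr1 ler_peMl//.
  have : 1 <= (s.+1`!)%:R :> R by rewrite ler1n fact_gt0.
  by have := D0; move: (_%:R) => x y z; nra.
move=> nsp; have sp' : (s < p)%N by rewrite ltn_neqAle nsp.
case: p op sp' {sp nsp} => // p; rewrite /= ltnS => ep sp.
have h1 := even _ sp ep.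
have h2 : amom p.+2 <= D * (p.+2`!)%:R * M ^+ (p.+2 - s) * amom s.
  by apply: even; [exact: leq_trans sp (leq_trans (leqnSn _) (leqnSn _))|rewrite /= negbK].
have i0 := integrable_absX p; have i2 := integrable_absX p.+2.
have i0' := integrableRZ (M / 2) i0; have i2' := integrableRZ (2 * M)^-1 i2.
(* Arithmetic-geometric inequality x <= M / 2 + x^2 / (2 M), weighted by [M] so that both neighbours
   contribute the same power of [M]. *)
have : amom p.+1 <= \int[P]_t (M / 2 * `|Z t| ^+ p + (2 * M)^-1 * `|Z t| ^+ p.+2).
  apply: le_Rintegral => //; [exact: integrable_absX|exact: integrableRD|].
  move=> t _; rewrite !exprS; move: (`|Z t|) (normr_ge0 (Z t)) => x x0.
  have -> : M / 2 * x ^+ p + (2 * M)^-1 * (x * (x * x ^+ p)) =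
    ((M ^+ 2 + x ^+ 2) / (2 * M)) * x ^+ p by field; rewrite gt_eqF.
  apply: ler_wpM2r; first exact: exprn_ge0.
  rewrite ler_pdivlMr ?mulr_gt0//.
  by have := sqr_ge0 (M - x); lra.
rewrite RintegralD// !RintegralZl// => /le_trans; apply.
have h1' := ler_wpM2l (ltW (divr_gt0 M0 (ltr0n R 2))) h1.
have c2 : 0 <= (2 * M)^-1 by rewrite invr_ge0 mulr_ge0// ltW.
have h2' := ler_wpM2l c2 h2.
apply: (le_trans (lerD h1' h2')).
have e1 : (p.+2 - s = (p - s).+2)%N by rewrite -addn2 -addnBAC// addn2.
have e2 : (p.+1 - s = (p - s).+1)%N by rewrite -addn1 -addnBAC// addn1.
rewrite e1 e2 !exprS.
have -> : M / 2 * (D * p`!%:R * M ^+ (p - s) * amom s) +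
   (2 * M)^-1 * (D * (p.+2)`!%:R * (M * (M * M ^+ (p - s))) * amom s) =
   (D / 2 * (p`!%:R + (p.+2)`!%:R)) * (M * M ^+ (p - s) * amom s) by field; rewrite gt_eqF.
have -> : (1 + D) * (p.+2)`!%:R * (M * M ^+ (p - s)) * amom s =
   ((1 + D) * (p.+2)`!%:R) * (M * M ^+ (p - s) * amom s) by ring.
apply: ler_wpM2r; first exact: (mulr_ge0 (mulr_ge0 (ltW M0) (M'0 _)) a0).
have f1 : p`!%:R <= (p.+2)`!%:R :> R by rewrite ler_nat !factS mulnA leq_pmull.
have := ler_wpM2l (ltW D0) f1; have : 0 <= p`!%:R :> R := ler0n _ _.
move: f1; move: (p`!%:R : R) (p.+2`!%:R : R) => x y xy x0 Dxy; have : 0 <= y := le_trans x0 xy.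
by lra.
Qed.

(** (s + k + 1)! <= (k + 4)!, with 4! = 24 at k = 0 and growth ratio k + 5 <= 16 (k + 1). The
    generous 16 pairs with the threshold 1/32 on h M. *)
Lemma fact_ratio_le s k : (s <= 3)%N -> ((s + k).+1`!)%:R <= 24 * 16 ^+ k * (k`!)%:R :> R.
Proof.
move=> s3; have h : ((s + k).+1`! <= 24 * 16 ^ k * k`!)%N.
  have h : ((s + k).+1`! <= (k + 4)`!)%N by apply: leq_fact; rewrite addn4 ltnS -addn3 addnC leq_add2l.
  apply: (leq_trans h).
  elim: k {h} => [|k IH]; first by [].
  rewrite addSn factS (factS k) expnS.
  apply: (@leq_trans ((k + 4).+1 * (24 * 16 ^ k * k`!))); first by rewrite leq_mul2l IH orbT.
  have -> : (24 * (16 * 16 ^ k) * (k.+1 * k`!) = (16 * k.+1) * (24 * 16 ^ k * k`!))%N by ring.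
  rewrite leq_mul2r mulnS (_ : (k + 4).+1 = 5 + k)%N; last by rewrite addnC.
  by rewrite leq_add ?orbT// leq_pmull.
by move: h; rewrite -(ler_nat R) !natrM natrX.
Qed.

(** The factorials cancel up to 24 * 16^k, so the term is bounded by a multiple of (16 h M)^k, and
    16 h M <= 1/2. *)
Lemma expR_moment_term s k h : (1 <= s <= 3)%N -> 0 <= h -> h * M <= 1 / 32 ->
  h ^+ k / (k`!)%:R * amom (s + k) <= 24 * (1 + D) * amom s * (1 / 2) ^+ k.
Proof.
move=> s13 h0 hM; have a0 := absX_mean_ge0 s.
have f0 : 0 < (k`!)%:R :> R by rewrite ltr0n fact_gt0.
have := absX_mean_le s13 (leq_addr k s); rewrite addKn => h1.
have c0 : 0 <= h ^+ k / (k`!)%:R by rewrite divr_ge0 ?exprn_ge0// ltW.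
apply: (le_trans (ler_wpM2l c0 h1)).
have s3 : (s <= 3)%N by case/andP: s13.
have h2 := @fact_ratio_le s k s3.
have c1 : 0 <= (1 + D) * ((h * M) ^+ k * amom s) / (k`!)%:R.
  apply: divr_ge0; last exact: ltW.
  apply: mulr_ge0; first by have := D0; lra.
  by apply: mulr_ge0 => //; rewrite exprn_ge0// mulr_ge0// ltW.
have -> : h ^+ k / k`!%:R * ((1 + D) * ((s + k).+1)`!%:R * M ^+ k * amom s) =
   (1 + D) * ((h * M) ^+ k * amom s) / (k`!)%:R * ((s + k).+1)`!%:R by rewrite exprMn; field; rewrite gt_eqF.
apply: (le_trans (ler_wpM2l c1 h2)).
have -> : (1 + D) * ((h * M) ^+ k * amom s) / k`!%:R * (24 * 16 ^+ k * k`!%:R) =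
  24 * (1 + D) * amom s * (16 * (h * M)) ^+ k by rewrite [(16 * _) ^+ k]exprMn; field; rewrite gt_eqF.
apply: ler_wpM2l.
  apply: mulr_ge0 => //; apply: mulr_ge0; [exact: ler0n|by have := D0; lra].
have x0 : 0 <= h * M by rewrite mulr_ge0// ltW.
by apply: lerXn2r; rewrite ?nnegrE; lra.
Qed.

Lemma sum_half_pow (n : nat) : \sum_(0 <= k < n) (1 / 2) ^+ k <= 2 :> R.
Proof.
suff -> : \sum_(0 <= k < n) (1 / 2) ^+ k = 2 - 2 * (1 / 2) ^+ n :> R.
  by rewrite gerBl mulr_ge0// exprn_ge0.
elim: n => [|n IH]; first by rewrite big_nil expr0 mulr1 subrr.
by rewrite big_nat_recr//= IH exprS; field.
Qed.

Lemma expR_nneseries (x : R) : 0 <= x ->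
  (expR x)%:E = (\sum_(0 <= k <oo) (x ^+ k / (k`!)%:R)%:E)%E.
Proof.
move=> x0; rewrite /expR -EFin_lim; last exact: is_cvg_series_exp_coeff.
congr (limn _); apply/funext => n /=.
by rewrite /series/= -sumEFin.
Qed.

(* 48 = 24 * sum_k 2^-k, where 24 * 16^k bounds (s + k + 1)! / k!. *)
Lemma expR_moment s h : (1 <= s <= 3)%N -> 0 <= h -> h * M <= 1 / 32 ->
  (\int[P]_t (`|Z t| ^+ s * expR (h * `|Z t|))%:E <= (48 * (1 + D) * amom s)%:E)%E.
Proof.
move=> s13 h0 hM.
pose f k t := ((h ^+ k / (k`!)%:R) * `|Z t| ^+ (s + k))%:E.
have c0 k : 0 <= h ^+ k / (k`!)%:R by rewrite divr_ge0 ?exprn_ge0.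
have f0 k t : (0 <= f k t)%E by rewrite lee_fin mulr_ge0// exprn_ge0.
have mf k : measurable_fun setT (f k).
  by apply/measurable_EFinP; apply: measurable_funM => //; apply: measurable_funX; exact: measurableT_comp.
(* The exponential is expanded in its power series; all terms are nonnegative, so sum and integral
   may be exchanged. *)
have -> : (\int[P]_t (`|Z t| ^+ s * expR (h * `|Z t|))%:E =
    \int[P]_t (\sum_(0 <= k <oo) f k t))%E.
  apply: eq_integral => t _; rewrite EFinM expR_nneseries ?mulr_ge0//.
  rewrite -nneseriesZl; last by move=> k _; rewrite lee_fin divr_ge0 ?exprn_ge0 ?mulr_ge0.
  by apply: eq_eseriesr => k _; rewrite /f -EFinM exprMn exprD; congr EFin; ring.
rewrite integral_nneseries//.
apply: lime_le; first by apply: is_cvg_nneseries => k _ _; exact: integral_ge0.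
apply: nearW => n.
have -> : (\sum_(0 <= k < n) \int[P]_t f k t)%E = (\sum_(0 <= k < n) (h ^+ k / (k`!)%:R * amom (s + k)))%:E.
  rewrite -sumEFin; apply: eq_bigr => k _.
  rewrite /f; under eq_integral do rewrite EFinM.
  have ia := integrable_absX (s + k).
  rewrite integralZl// [RHS]EFinM; congr (_ * _)%E.
  by rewrite /Rintegral fineK//; exact: integrable_fin_num.
rewrite lee_fin.
apply: (@le_trans _ _ (\sum_(0 <= k < n) 24 * (1 + D) * amom s * (1 / 2) ^+ k)).
  by apply: ler_sum => k _; exact: expR_moment_term.
rewrite -mulr_sumr.
have -> : 48 * (1 + D) * amom s = 24 * (1 + D) * amom s * 2 by ring.
apply: ler_wpM2l; last exact: sum_half_pow.
apply: mulr_ge0; last exact: absX_mean_ge0.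
by apply: mulr_ge0; [exact: ler0n|have := D0; lra].
Qed.

Lemma integrable_expR_moment s h : (s <= 3)%N -> 0 <= h -> h * M <= 1 / 32 ->
  P.-integrable setT (EFin \o (fun t => `|Z t| ^+ s * expR (h * `|Z t|))).
Proof.
move=> s3 h0 hM.
have m s' : measurable_fun setT (fun t => `|Z t| ^+ s' * expR (h * `|Z t|)).
  apply: measurable_funM; first by apply: measurable_funX; exact: measurableT_comp.
  by apply: measurableT_comp => //; apply: measurable_funM => //; exact: measurableT_comp.
have pos s' : (0 < s')%N -> (s' <= 3)%N ->
    P.-integrable setT (EFin \o (fun t => `|Z t| ^+ s' * expR (h * `|Z t|))).
  move=> s0' s3'; apply/integrableP; split; first exact/measurable_EFinP.
  rewrite (eq_integral (fun t => (`|Z t| ^+ s' * expR (h * `|Z t|))%:E)); last first.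
    by move=> t _ /=; rewrite ger0_norm// mulr_ge0 ?expR_ge0// exprn_ge0.
  have s13 : (1 <= s' <= 3)%N by rewrite s0'.
  by apply: (le_lt_trans (expR_moment s13 h0 hM)); exact: ltry.
(* The moment hypothesis starts at s = 1; for s = 0, splitting at |Z| = 1 gives exp(h |Z|) <= exp(h)
   + |Z| exp(h |Z|). *)
case: s s3 => [|s] s3; last exact: pos.
have i1 := pos 1%N isT isT.
have ic := integrable_cstR P (expR h).
apply: (@le_integrableR _ _ _ _ _ (fun t => expR h + `|Z t| ^+ 1 * expR (h * `|Z t|))) => //.
  move=> t; rewrite expr0 mul1r expr1 ger0_norm ?expR_ge0//.
  have [z1|z1] := leP `|Z t| 1.
    rewrite -[leLHS]addr0; apply: lerD; last by rewrite mulr_ge0 ?expR_ge0.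
    by rewrite ler_expR ler_piMr.
  rewrite -[leLHS]add0r; apply: lerD; first exact: expR_ge0.
  by rewrite ler_peMl ?expR_ge0// ltW.
exact: integrableRD.
Qed.

End exponential_moments.

Section normalised_array.
Context d (T : measurableType d) (R : realType) (P : probability T R).
Variables (n : nat) (X : 'I_n -> 'I_n -> {RV P >-> R}) (M D u : R).
Hypotheses (n2 : (2 <= n)%N) (M0 : 0 < M) (D0 : 0 < D) (u0 : 0 < u).
Hypothesis X_indep : mutually_independent (fun ij : 'I_n * 'I_n => X ij.1 ij.2).
Hypothesis iX : forall (i j : 'I_n) (k : nat),
  P.-integrable [set: T] (fun w => (X i j w ^+ k)%:E).
Hypothesis X_col0 : forall j, \sum_(i < n) moment X i j 1 = 0.
Hypothesis X_row0 : forall i, \sum_(j < n) moment X i j 1 = 0.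
Hypothesis B0 : 0 < Bn X.
Hypothesis X_moments : forall (i j : 'I_n) (s k : nat),
  (1 <= s <= 3)%N -> (s <= k)%N ->
  `|moment X i j k| <= D * (k`!)%:R * M ^+ (k - s) * abs_moment X i j s.

Local Notation r := (Num.sqrt (Bn X)).
Definition scaled i j t := r^-1 * X i j t.
Definition lyap := gamma_n X / Num.sqrt n%:R.
Local Notation Y := scaled.
Local Notation eps := lyap.
Local Notation K := (48 * (1 + D)).

Lemma momentE i j k : moment X i j k = \int[P]_t (X i j t ^+ k).
Proof. by rewrite /moment unlock. Qed.

Lemma abs_momentE i j k : abs_moment X i j k = \int[P]_t (`|X i j t| ^+ k).
Proof. by rewrite /abs_moment unlock. Qed.

Let r0 : 0 < r. Proof. by rewrite sqrtr_gt0. Qed.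
Let ri0 : 0 <= r^-1. Proof. by rewrite invr_ge0 ltW. Qed.
Let n0 : 0 < n%:R :> R. Proof. by rewrite ltr0n ltnW. Qed.
Let sn0 : 0 < Num.sqrt n%:R :> R. Proof. by rewrite sqrtr_gt0. Qed.

Let hX i j : forall s k : nat, (1 <= s <= 3)%N -> (s <= k)%N ->
  `|\int[P]_t (X i j t ^+ k)| <= D * (k`!)%:R * M ^+ (k - s) * \int[P]_t (`|X i j t| ^+ s).
Proof. by move=> s k s13 sk; rewrite -momentE -abs_momentE; exact: X_moments. Qed.

Let iabs i j k := @integrable_absX _ _ _ P (X i j) (iX i j) k.

Let scaled_abs i j t k : `|Y i j t| ^+ k = r^-1 ^+ k * `|X i j t| ^+ k.
Proof. by rewrite /scaled normrM exprMn (ger0_norm ri0). Qed.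

Lemma scaled_moment i j k : \int[P]_t (`|Y i j t| ^+ k) = r^-1 ^+ k * abs_moment X i j k.
Proof.
have ia := iabs i j k; under eq_Rintegral do rewrite scaled_abs.
by rewrite RintegralZl// abs_momentE.
Qed.

Lemma abs_moment2 i j : abs_moment X i j 2 = moment X i j 2.
Proof. by rewrite abs_momentE momentE; apply: eq_Rintegral => t _; rewrite real_normK ?num_real. Qed.

Let scaled_mean i j : \int[P]_t Y i j t = r^-1 * moment X i j 1.
Proof.
have iX1 := iX i j 1; rewrite momentE -RintegralZl//.
Qed.

Lemma sum_moment2 : \sum_i \sum_j moment X i j 2 = n%:R * Bn X.
Proof. by rewrite /Bn mulVKf// gt_eqF. Qed.

Lemma gamma_m1 i j : Num.sqrt n%:R / r * abs_moment X i j 1 <= gamma_n X.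
Proof.
rewrite /gamma_n !le_max; apply/orP; left; apply/orP; left.
apply: le_trans (le_bigmax _ _ i); exact: (le_bigmax _ (fun j => _ * abs_moment X i j 1) j).
Qed.

Lemma gamma_row i : \sum_(j < n) (moment X i j 2 / Bn X) <= gamma_n X.
Proof.
rewrite /gamma_n !le_max; apply/orP; left; apply/orP; right.
exact: (le_bigmax _ (fun i => \sum_(j < n) (moment X i j 2 / Bn X)) i).
Qed.

Lemma gamma_m3 : \sum_i \sum_j (abs_moment X i j 3 / (Num.sqrt n%:R * Bn X `^ (3 / 2))) <= gamma_n X.
Proof. by rewrite /gamma_n !le_max lexx !orbT. Qed.

(** The n normalised row sums of second moments add up to n, so their maximum is at least 1.
    Consequently 1 / n <= 1 / sqrt n <= eps. *)
Lemma gamma_ge1 : 1 <= gamma_n X.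
Proof.
rewrite -(ler_pM2l n0) mulr1.
have e : \sum_i \sum_(j < n) (moment X i j 2 / Bn X) = n%:R :> R.
  under eq_bigr do rewrite -mulr_suml.
  by rewrite -mulr_suml sum_moment2 mulfK// gt_eqF.
rewrite -[leLHS]e.
apply: (@le_trans _ _ (\sum_(i < n) gamma_n X)); last by rewrite sumr_const card_ord [leRHS]mulr_natl.
by apply: ler_sum => i _; exact: gamma_row.
Qed.

Lemma powR32 : Bn X `^ (3 / 2) = r ^+ 3.
Proof.
have -> : 3 / 2 = 2^-1 * 3%:R :> R by rewrite mulrC.
by rewrite powRrM powR12_sqrt ?ltW// powR_mulrn// ltW.
Qed.

Hypothesis uM : u * M <= r / 32.
Hypothesis uKe : u * (K * eps) <= 1 / 2.

Let h := u / r.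
Let h0 : 0 <= h. Proof. by rewrite divr_ge0// ltW. Qed.
Let hM : h * M <= 1 / 32.
Proof. by rewrite /h mulrAC ler_pdivrMr//; move: uM; lra. Qed.

Let scaled_exp i j k t : `|Y i j t| ^+ k * expR (u * `|Y i j t|) =
  r^-1 ^+ k * (`|X i j t| ^+ k * expR (h * `|X i j t|)).
Proof.
rewrite scaled_abs -mulrA; congr (_ * (_ * expR _)).
by rewrite /scaled normrM (ger0_norm ri0) mulrA.
Qed.

(** A tilt u on the normalised scale is h = u / sqrt(B_n) on the original one, so u M <= sqrt(B_n) /
    32 is exactly the condition h M <= 1/32 for exponential moments. The bounds by [eps] are read
    off from the first and last members of the maximum in [gamma_n]. *)
Lemma scaled_array : comb_array P Y u K eps.
Proof.
have iexp i j k k3 := @integrable_expR_moment _ _ _ P (X i j) M D (measurable_funP (X i j)) M0 D0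
   (iX i j) (hX i j) k h k3 h0 hM.
have K1 : 1 <= K by have := D0; lra.
split => //.
- exact: ltW.
- by move=> i j; apply: measurable_funM.
- move=> J A mA.
  have mB p : measurable ((fun x : R => r^-1 * x) @^-1` A p).
    rewrite -[X in measurable X]setTI; apply: (_ : measurable_fun setT (fun x : R => r^-1 * x)) => //.
    exact: measurable_funM.
  exact: (X_indep J mB).
- move=> i j k k3; have := integrableRZ (r^-1 ^+ k) (iexp i j k k3).
  by apply: eq_integrable => // t _ /=; rewrite scaled_exp.
- move=> i j k k13; have k3 : (k <= 3)%N by case/andP: k13.
  have ie := iexp i j k k3.
  under eq_Rintegral do rewrite scaled_exp.
  rewrite RintegralZl// scaled_moment mulrCA; apply: ler_wpM2l; first exact: exprn_ge0.
  have := @expR_moment _ _ _ P (X i j) M D (measurable_funP (X i j)) M0 D0 (iX i j) (hX i j) k h k13 h0 hM.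
  rewrite -abs_momentE -lee_fin => /(le_trans _); apply.
  by rewrite /Rintegral fineK//; exact: integrable_fin_num.
- move=> i; under eq_bigr do rewrite scaled_mean.
  by rewrite -mulr_sumr X_row0 mulr0.
- move=> j; under eq_bigr do rewrite scaled_mean.
  by rewrite -mulr_sumr X_col0 mulr0.
- move=> i j; have := scaled_moment i j 1.
  under eq_Rintegral do rewrite expr1.
  move=> ->; rewrite expr1 /eps ler_pdivlMr//; apply: le_trans (gamma_m1 i j).
  by rewrite le_eqVlt; apply/orP; left; apply/eqP; ring.
- under eq_bigr do (under eq_bigr do rewrite scaled_moment abs_moment2).
  under eq_bigr do rewrite -mulr_sumr.
  rewrite -mulr_sumr sum_moment2 exprVn sqr_sqrtr ?ltW// mulrCA mulVf ?mulr1// gt_eqF//.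
- under eq_bigr do (under eq_bigr do rewrite scaled_moment).
  under eq_bigr do rewrite -mulr_sumr.
  rewrite -mulr_sumr.
  have := gamma_m3; under eq_bigr do rewrite -mulr_suml.
  rewrite -mulr_suml powR32 invfM => g3.
  have -> : n%:R * eps = Num.sqrt n%:R * gamma_n X.
    by rewrite /eps -{1}(sqr_sqrtr (ltW n0)); field; rewrite gt_eqF.
  rewrite -ler_pdivrMl//; apply: le_trans g3; rewrite exprVn.
  by rewrite le_eqVlt; apply/orP; left; apply/eqP; ring.
- rewrite /eps; apply: (@le_trans _ _ (1 / Num.sqrt n%:R)); last first.
    by rewrite ler_pM2r ?invr_gt0//; exact: gamma_ge1.
  rewrite div1r lef_pV2 ?posrE//.
  have s1 : 1 <= Num.sqrt n%:R :> R by rewrite -[leLHS]sqrtr1 ler_wsqrtr// ler1n ltnW.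
  rewrite -[leRHS](sqr_sqrtr (ltW n0)) expr2 ler_peMr//.
Qed.

End normalised_array.

(** * Conditioning on the random permutation *)

Section random_permutation.
Context d (T : measurableType d) (R : realType) (P : probability T R).
Variables (n : nat) (X : 'I_n -> 'I_n -> {RV P >-> R}) (pi : T -> 'S_n).
Hypothesis pi_uniform : uniform_random_perm P pi.
Hypothesis pi_indep : independent_systems P
  (sigma_family (fun ij : 'I_n * 'I_n => X ij.1 ij.2)) (sigma_perm pi).
Hypothesis B0 : 0 < Bn X.
Local Notation r := (Num.sqrt (Bn X)).
Local Notation Y := (scaled X).

Let r0 : 0 < r. Proof. by rewrite sqrtr_gt0. Qed.

(** Independence from [pi] is given only for events of the sigma-algebra generated by the array, so
    measurability of the sum is established with respect to that smaller sigma-algebra. *)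
Lemma sigma_family_psum s v :
  sigma_family (fun ij : 'I_n * 'I_n => X ij.1 ij.2) (psum Y s finset.setT @^-1` `[v, +oo[).
Proof.
pose G := \bigcup_(i in [set: 'I_n * 'I_n]) preimage_set_system [set: T] (X i.1 i.2) measurable.
have mX i j : measurable_fun [set: g_sigma_algebraType G] (X i j : g_sigma_algebraType G -> R).
  move=> _ A mA; apply: sub_sigma_algebra.
  by exists (i, j) => //; exists A.
have mY : measurable_fun [set: g_sigma_algebraType G] (psum Y s finset.setT).
  have -> : psum Y s finset.setT = fun t => \sum_(i <- enum finset.setT) Y i (s i) t.
    by apply/funext => t; rewrite /psum big_enum.
  by apply: measurable_sum => i; exact: measurable_funM.
have := mY measurableT `[v, +oo[%classic (measurable_itv _).
by rewrite setTI.
Qed.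

Lemma perm_tail_prob u :
  fine (P [set w | u * r <= comb_sum X pi w]) = (n`!)%:R^-1 * perm_tail P Y u.
Proof.
(* The event is partitioned by the value of [pi]; on each piece the sum is that of a fixed
   permutation, and independence gives the factor 1 / n!. *)
pose A s := pi @^-1` [set s] `&` psum Y s finset.setT @^-1` `[u, +oo[.
have mpsum s : measurable (psum Y s finset.setT @^-1` `[u, +oo[).
  have := @sigma_family_psum s u; apply: smallest_sub; first exact: sigma_algebra_measurable.
  move=> B [i _ [C mC <-]]; exact: measurable_funP.
have mA s : measurable (A s).
  by apply: measurableI => //; exact: (pi_uniform s).1.
have PA s : P (A s) = (((n`!)%:R^-1)%:E * P (psum Y s finset.setT @^-1` `[u, +oo[))%E.
  rewrite /A setIC pi_indep.
  - by rewrite (pi_uniform s).2 muleC.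
  - exact: sigma_family_psum.
  - by exists [set s] => //; rewrite setTI.
have -> : [set w | u * r <= comb_sum X pi w] = \bigcup_(s in [set: 'S_n]) A s.
  apply/seteqP; split => w /=.
    move=> h; exists (pi w) => //; split => //=.
    rewrite in_itv/= andbT.
    have -> : psum Y (pi w) finset.setT w = r^-1 * comb_sum X pi w.
      by rewrite /psum /comb_sum mulr_sumr; apply: eq_bigl => i; rewrite inE.
    by rewrite ler_pdivlMl// mulrC.
  move=> [s _ [/= <-]]; rewrite in_itv/= andbT.
  have -> : psum Y (pi w) finset.setT w = r^-1 * comb_sum X pi w.
    by rewrite /psum /comb_sum mulr_sumr; apply: eq_bigl => i; rewrite inE.
  by rewrite ler_pdivlMl// mulrC.
rewrite measure_fin_bigcup//; last 2 first.
- exact: finite_finset.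
- by move=> s1 s2 _ _ [w [[/= <- _] [/= <- _]]].
rewrite (_ : setT = [set` [pred _ : 'S_n | true]]); last by apply/seteqP; split.
rewrite -(bigfs _ (enum_uniq 'S_n)); last by move=> s _; rewrite mem_enum.
rewrite big_enum /=.
under eq_bigr => s _ do rewrite PA -(fineK (fin_num_measure P _ (mpsum s))) -EFinM.
by rewrite sumEFin/= -mulr_sumr.
Qed.

End random_permutation.

(** * The ratio of the tails and the passage to the limit *)

Section tail_ratio.
Context d (T : measurableType d) (R : realType) (P : probability T R).
Variables (n : nat) (Y : 'I_n -> 'I_n -> T -> R) (K eps u del : R).
Hypotheses (u2 : 2 <= u) (del01 : 0 < del <= 1).
Hypothesis ca : comb_array P Y u K eps.
Hypothesis small : 4 * 16000 * K * (eps * u ^+ 3) <= 1.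
Local Notation q := (1 - @Phi R u).
Local Notation nf := ((n`!)%:R : R).
Local Notation eta := (del / 8).
Hypothesis del_u : 16 / del <= u.
Hypothesis err_le : tail_err K eps u eta <= del / 4.

(** The error budget with eta = del / 8: since u >= 16 / del, the rational factors are within del /
    4 of 1. The main terms then lie between 1 - 7/16 del and 1 + 9/16 del, and [tail_err] adds at
    most del / 4 on either side. *)
Lemma tail_ratio : `|1 - nf^-1 * perm_tail P Y u / q| <= del.
Proof.
have /andP[d0 d1] := del01.
have eta01 : 0 < eta <= 1 by apply/andP; split; lra.
have q0 := tail_gt0 u2.
have nf0 : 0 < nf by rewrite ltr0n fact_gt0.
have up := perm_tail_upper u2 eta01 ca small.
have lo := perm_tail_lower u2 eta01 ca small.
have u1 : 1 <= u by apply: le_trans u2; rewrite ler1n.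
have udel : 16 <= del * u ^+ 2.
  have : 16 / del <= u ^+ 2.
    by apply: (le_trans del_u); rewrite expr2 ler_peMr// (le_trans ler01).
  by rewrite ler_pdivrMr// mulrC.
have e1 : expR eta <= 1 + del / 4.
  have h : (1 - eta) * expR eta <= 1.
    have h1 := expR_ge1Dx (- eta); rewrite expRN -[(expR _)^-1]div1r in h1.
    by rewrite -ler_pdivlMr ?expR_gt0.
  have : expR eta <= (1 - eta)^-1 by rewrite -[(1 - eta)^-1]div1r ler_pdivlMr; [rewrite mulrC|lra].
  move=> /le_trans; apply; rewrite -[(1 - eta)^-1]div1r ler_pdivrMr; last by lra.
  by nra.
have e2 : 1 - 3 / 16 * del <= expR (- (3 / 2 * eta)).
  by have := expR_ge1Dx (- (3 / 2 * eta)); lra.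
have f1 : (1 + u ^+ 2) / (u ^+ 2 - 1) <= 1 + del / 4.
  have u4 : 16 <= u ^+ 2 by apply: (le_trans udel); rewrite ler_piMl// sqr_ge0.
  by rewrite ler_pdivrMr; nra.
have f2 : 1 - del / 4 <= u ^+ 2 / (u ^+ 2 + 4).
  by rewrite ler_pdivlMr; have := sqr_ge0 u; nra.
have g1 : (1 + u ^+ 2) / (u ^+ 2 - 1) * expR eta <= 1 + 9 / 16 * del.
  apply: (@le_trans _ _ ((1 + del / 4) * (1 + del / 4))); last by nra.
  apply: (ler_pM _ (expR_ge0 _) f1 e1).
  have u4 : 16 <= u ^+ 2 by apply: (le_trans udel); rewrite ler_piMl// sqr_ge0.
  by apply: divr_ge0; lra.
have g2 : 1 - 7 / 16 * del <= u ^+ 2 / (u ^+ 2 + 4) * expR (- (3 / 2 * eta)).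
  apply: (@le_trans _ _ ((1 - del / 4) * (1 - 3 / 16 * del))); first by nra.
  by apply: ler_pM => //; lra.
rewrite -(ler_pdivrMl _ _ nf0) in up; rewrite -(ler_pdivlMl _ _ nf0) in lo.
move: up lo.
move: (nf^-1 * _) => p up lo.
have {}up : p / q <= 1 + del.
  rewrite ler_pdivrMr// mulrC; apply: (le_trans up); apply: (ler_wpM2l (ltW q0)).
  by move: err_le g1; move: (tail_err _ _ _ _) (_ * expR _) => x y; lra.
have {}lo : 1 - del <= p / q.
  rewrite ler_pdivlMr// mulrC; apply: (le_trans _ lo); apply: (ler_wpM2l (ltW q0)).
  by move: err_le g2; move: (tail_err _ _ _ _) (_ * expR _) => x y; lra.
by rewrite distrC ler_norml; apply/andP; split; lra.
Qed.

End tail_ratio.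

Theorem theorem1 (R : realType) (d : nat -> measure_display)
  (T : forall n, measurableType (d n)) (P : forall n, probability (T n) R)
  (X : forall n, 'I_n -> 'I_n -> {RV (P n) >-> R})
  (pi : forall n, T n -> 'S_n) (M : R ^nat) (D : R)
  (X_indep : forall n, (2 <= n)%N ->
     mutually_independent (fun ij : 'I_n * 'I_n => X n ij.1 ij.2))
  (X_finite_moments : forall n, (2 <= n)%N -> forall (i j : 'I_n) (k : nat),
     (P n).-integrable [set: T n] (fun w => (X n i j w ^+ k)%:E))
  (X_col0 : forall n, (2 <= n)%N -> forall j : 'I_n,
     \sum_(i < n) moment (X n) i j 1 = 0)
  (X_row0 : forall n, (2 <= n)%N -> forall i : 'I_n,
     \sum_(j < n) moment (X n) i j 1 = 0)
  (pi_uniform : forall n, (2 <= n)%N -> uniform_random_perm (P n) (pi n))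
  (pi_indep : forall n, (2 <= n)%N ->
     independent_systems (P n)
       (sigma_family (fun ij : 'I_n * 'I_n => X n ij.1 ij.2))
       (sigma_perm (pi n)))
  (B_gt0 : forall n, (2 <= n)%N -> 0 < Bn (X n))
  (M_gt0 : forall n, (2 <= n)%N -> 0 < M n)
  (M_ndecr : forall m n, (2 <= m)%N -> (m <= n)%N -> M m <= M n)
  (D_gt0 : 0 < D)
  (X_moments : forall n, (2 <= n)%N -> forall (i j : 'I_n) (s k : nat),
     (1 <= s <= 3)%N -> (s <= k)%N ->
     `|moment (X n) i j k|
       <= D * (k`!)%:R * M n ^+ (k - s) * abs_moment (X n) i j s) :
  forall u : R ^nat,
    (forall n, (2 <= n)%N -> 0 < u n) ->
    u n @[n --> \oo] --> +oo ->
    (fun n => u n ^+ 3 : R^o) =o_\oo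
      (fun n => Num.sqrt n%:R / gamma_n (X n) : R^o) ->
    (fun n => u n : R^o) =o_\oo (fun n => Num.sqrt (Bn (X n)) / M n : R^o) ->
    asymp_equiv
      (fun n => fine ((P n)
         [set w | u n * Num.sqrt (Bn (X n)) <= comb_sum (X n) (pi n) w]))
      (fun n => 1 - Phi (u n)).
Proof.
move=> u u_gt0 u_infty ou oM.
pose K : R := 48 * (1 + D).
have K0 : 0 < K by apply: mulr_gt0 => //; have := D_gt0; lra.
apply/cvgrPdist_le => del' del'0.
pose del := Num.min del' 1.
have del01 : 0 < del <= 1 by rewrite lt_min del'0 ltr01/= ge_min lexx orbT.
have /andP[del0 del1] := del01.
have dd : del <= del' by rewrite ge_min lexx.
pose c16 : R := 16000.
have c160 : 0 < c16 by rewrite ltr0n.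
pose C := c16 * K * (expR 2 * (60 * 100)).
have C0 : 0 < C.
  apply: (mulr_gt0 (mulr_gt0 c160 K0)); apply: mulr_gt0; first exact: expR_gt0.
  by apply: mulr_gt0; rewrite ltr0n.
pose e1 := (4 * c16 * K)^-1.
have c4 : 0 < 4 * c16 * K by apply: (mulr_gt0 (mulr_gt0 _ c160) K0); rewrite ltr0n.
have e10 : 0 < e1 by rewrite invr_gt0.
have d8 : 0 < del / 8 by rewrite divr_gt0.
pose e2 := del / 8 * (del / 4) / C.
have e20 : 0 < e2 by rewrite divr_gt0// mulr_gt0// divr_gt0.
(* The bound on eps u^3 serves three purposes: [e1] makes the Stein error small enough for [mgf_le],
   [e2] brings [tail_err] below del / 4, and 1 / (2 K) gives K eps u <= 1/2, as u <= u^3. *)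
pose e := Num.min (Num.min e1 e2) (2 * K)^-1.
have e0 : 0 < e by rewrite !lt_min e10 e20 invr_gt0 mulr_gt0.
have en1 : e <= e1 by rewrite /e !ge_min lexx.
have en2 : e <= e2 by rewrite /e !ge_min lexx orbT.
have en3 : e <= (2 * K)^-1 by rewrite /e !ge_min lexx orbT.
have i32 : 0 < 1 / 32 :> R by rewrite divr_gt0.
have /eqoP/(_ _ e0) ou' := ou.
have /eqoP/(_ _ i32) oM' := oM.
have nu : \forall n \near \oo, Num.max 2 (16 / del) <= u n by move/cvgryPge : u_infty; exact.
have n_ge2 : \forall n \near \oo, (2 <= n)%N by exact: nbhs_infty_ge.
near=> n.
have n2 : (2 <= n)%N by near: n.
have : Num.max 2 (16 / del) <= u n by near: n.
rewrite ge_max => /andP[u2 udel].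
have u0 := u_gt0 n n2.
have h1 : `|u n ^+ 3| <= e * `|Num.sqrt n%:R / gamma_n (X n)| by near: n.
have h2 : `|u n| <= 1 / 32 * `|Num.sqrt (Bn (X n)) / M n| by near: n.
have B0 := B_gt0 n n2; have M0 := M_gt0 n n2.
have g1 := gamma_ge1 n2 B0.
have g0 : 0 < gamma_n (X n) := lt_le_trans ltr01 g1.
have s0 : 0 < Num.sqrt n%:R :> R by rewrite sqrtr_gt0 ltr0n ltnW.
have r0 : 0 < Num.sqrt (Bn (X n)) by rewrite sqrtr_gt0.
pose eps := lyap (X n).
have eu : eps * u n ^+ 3 <= e.
  move: h1; rewrite (ger0_norm (exprn_ge0 3 (ltW u0))) (gtr0_norm (divr_gt0 s0 g0)).
  by rewrite mulrA ler_pdivlMr// => h1; rewrite /eps /lyap mulrAC ler_pdivrMr// mulrC.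
have uM : u n * M n <= Num.sqrt (Bn (X n)) / 32.
  move: h2; rewrite (gtr0_norm u0) (gtr0_norm (divr_gt0 r0 M0)) mulrA ler_pdivlMr// => h2.
  by apply: (le_trans h2); rewrite mulrC div1r.
have eps0 : 0 <= eps by rewrite divr_ge0// ltW.
have uKe : u n * (K * eps) <= 1 / 2.
  apply: (@le_trans _ _ (K * (eps * u n ^+ 3))).
    rewrite mulrCA; apply: (ler_wpM2l (ltW K0)); rewrite mulrC; apply: ler_wpM2l => //.
    by apply: ler_eXnr => //; apply: le_trans u2; rewrite ler1n.
  apply: (le_trans (ler_wpM2l (ltW K0) (le_trans eu en3))).
  by rewrite invfM mulrCA mulfV ?gt_eqF// mulr1 div1r.
have ca := scaled_array n2 M0 D_gt0 u0 (X_indep n n2) (X_finite_moments n n2)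
  (X_col0 n n2) (X_row0 n n2) B0 (X_moments n n2) uM uKe.
have small : 4 * c16 * K * (eps * u n ^+ 3) <= 1.
  by rewrite -(ler_pdivlMl _ _ c4) mulr1; exact: le_trans eu en1.
have errl : c16 * K * eps * (expR 2 * (60 * 100 * (u n ^+ 3 / (del / 8)))) <= del / 4.
  have -> : c16 * K * eps * (expR 2 * (60 * 100 * (u n ^+ 3 / (del / 8)))) =
    (eps * u n ^+ 3 * C) / (del / 8) by rewrite /C; move: (c16) => c; ring.
  rewrite (ler_pdivrMr _ _ d8) [leRHS]mulrC -(ler_pdivlMr _ _ C0).
  exact: le_trans eu en2.
rewrite (perm_tail_prob (pi_uniform n n2) (pi_indep n n2) B0).
exact: (le_trans (tail_ratio u2 del01 ca small udel errl) dd).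
Unshelve. all: by end_near.
Qed.
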